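(* Let $f(z)=z+a_2z^2+a_3z^3+\cdots\in\mathcal{C}_{\arcsin}$ and let $\Gamma_1,\Gamma_2$ be the first two inverse logarithmic coefficients of $f$. Then $$-\left(\frac{1}{6\pi}+\frac{3}{4(5+2\pi)}\right)\le |\Gamma_2|-|\Gamma_1|\le \frac{1}{6\pi}.$$ Both inequalities are sharp, i.e. for each of them there is a function in $\mathcal{C}_{\arcsin}$ for which equality holds.
   Context: Let $\Omega=\{z\in\mathbb{C}:|z|<1\}$. Let $\mathcal{A}$ be the family of analytic functions $f$ in $\Omega$ normalized by $f(z)=z+\sum_{n=2}^{\infty}a_nz^n$, and let $\mathcal{S}\subset\mathcal{A}$ be the subclass of univalent functions. A Schwarz function is an analytic $\omega:\Omega\to\mathbb{C}$ with $\omega(0)=0$ and $|\omega(z)|\le 1$ on $\Omega$. For analytic $g,h$ in $\Omega$, $g\prec h$ (subordination) means that there is a Schwarz function $\omega$ with $g(z)=h(\omega(z))$ for all $z\in\Omega$. With $\arcsin$ the principal branch ($\arcsin 0=0$), define $$\mathcal{C}_{\arcsin}=\left\{f\in\mathcal{S}:\ 1+\frac{zf''(z)}{f'(z)}\prec 1+\frac{2}{\pi}\arcsin z \text{ in } \Omega\right\}.$$ The inverse logarithmic coefficients $\Gamma_n$ of $f\in\mathcal{S}$ are defined, near the origin, by $\log\left(\frac{f^{-1}(z)}{z}\right)=2\sum_{n=1}^{\infty}\Gamma_nz^n$ with $\log 1=0$. Thus $\Gamma_1=-\frac12a_2$ and $\Gamma_2=-\frac12\left(a_3-\frac32a_2^2\right)$.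 *)

(* Defs.v *)
From Stdlib Require Import Reals.
From Coquelicot Require Export Coquelicot.

Local Open Scope R_scope.
Local Open Scope C_scope.

(* Principal argument, in (-PI, PI]; the value at 0 is irrelevant. *)
Definition Carg (z : C) : R :=
  if Rle_dec 0 (Im z) then acos (Re z / Cmod z) else (- acos (Re z / Cmod z))%R.

Definition Clog (z : C) : C := (ln (Cmod z), Carg z).

(* [Csqrt 0 = 0], hence no use of [Clog] here. *)
Definition Csqrt (z : C) : C :=
  sqrt (Cmod z) * (cos (Carg z / 2), sin (Carg z / 2)).

(* Principal branch, with cuts on the real rays (-oo, -1) and (1, +oo). *)
Definition Carcsin (z : C) : C := - Ci * Clog (Ci * z + Csqrt (1 - z ^ 2)).

(** Functions on the unit disc.  They are total functions [C -> C] of which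
    only the values on [Omega] matter. *)

Definition Omega (z : C) : Prop := Cmod z < 1.

Definition analytic_in_disc (f : C -> C) : Prop :=
  forall z : C, Omega z -> @ex_derive C_AbsRing C_NormedModule f z.

Definition class_A (f : C -> C) : Prop :=
  analytic_in_disc f /\
  exists a : nat -> C, a 0%nat = 0 /\ a 1%nat = 1 /\
    forall z : C, Omega z -> @is_pseries C_AbsRing C_NormedModule a z (f z).

Definition univalent (f : C -> C) : Prop :=
  forall z w : C, Omega z -> Omega w -> f z = f w -> z = w.

Definition class_S (f : C -> C) : Prop := class_A f /\ univalent f.

Definition schwarz_function (w : C -> C) : Prop :=
  analytic_in_disc w /\ w 0 = 0 /\ forall z : C, Omega z -> Cmod (w z) <= 1.

Definition subordinate (g h : C -> C) : Prop :=
  exists w : C -> C, schwarz_function w /\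
    forall z : C, Omega z -> g z = h (w z).

(* [C_derive f] is the total complex derivative; for [f] in [class_S] it is
   analytic and nonzero on [Omega]. *)
Definition class_C_arcsin (f : C -> C) : Prop :=
  class_S f /\
  subordinate (fun z => 1 + z * C_derive (C_derive f) z / C_derive f z)
              (fun z => 1 + RtoC (2 / PI) * Carcsin z).

(* [g] is the inverse of [f] on a disc around 0 of radius [r]; it is unique
   when [f] is univalent.  Since [g z / z] tends to 1 at 0, the principal
   logarithm is, near 0, the branch with [log 1 = 0].  [G 0] is not used. *)
Definition inverse_log_coeffs (f : C -> C) (G : nat -> C) : Prop :=
  exists (g : C -> C) (r : R), 0 < r /\
    (forall z : C, Cmod z < r -> Omega (g z) /\ f (g z) = z) /\
    (forall z : C, z <> 0 -> Cmod z < r ->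
       exists s : C,
         @is_series C_AbsRing C_NormedModule
           (fun n : nat => G (S n) * z ^ (S n)) s /\
         Clog (g z / z) = 2 * s).

(* Main.v *)
(* Write z f''/f' = (2/pi) arcsin w with w = c1 z + c2 z^2 + ... a Schwarz function.
   Comparing coefficients, Gamma_1 = - c1 / (2 pi) and
   Gamma_2 = - (c2 - 5 c1^2 / (2 pi)) / (6 pi), so with x = |c1| and |c2| <= 1 - x^2
   both bounds are elementary inequalities in x; the lower one is attained at
   x = 3 pi / (5 + 2 pi).

   To have |c2| <= 1 - |c1|^2, w must be shown to have a power series: it equals
   sin ((pi/2) z f''/f'), hence is C^1 once f' is known not to vanish, and a C^1
   complex differentiable function has a Taylor series by the homotopy proof of
   Cauchy's formula. The bound then comes from integrating over circles.

   The extremal functions belong to w = z^2 and w = z (z + c) / (1 + c z). Given such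
   a w, f' = exp Q with z Q' = (2/pi) arcsin w satisfies |Im Q| < pi/2, so that
   Re f' > 0 and f is univalent. *)

Require Import Defs.
From Stdlib Require Import Reals Lra Lia.
From Coquelicot Require Import Coquelicot.
Local Open Scope R_scope.

(** The homotopy argument differentiates under the integral sign, so it asks for a continuous
    derivative, whereas a Schwarz function is only given as complex differentiable. Regularity is
    therefore carried over to [w] from [f], which comes with a power series. Solving for [w] is
    possible although only |w| <= 1 is known, because sin (arcsin x) = x holds for the principal
    [Carcsin] at every complex x, branch cuts included. The same equation keeps f' away from 0:
    |arcsin w| <= 2 + pi bounds |z f''| by a multiple of |f'|, and a Gronwall argument along rays,
    starting from f'(0) = 1, excludes zeros. Coefficients of quotients and composites are compared
    through second order expansions with error O(z^3), so power series are never composed. With k =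
    5 / (2 pi), the inequality |c2 - k c1^2| >= k x^2 - (1 - x^2) bounds 6 pi (|Gamma_2| -
    |Gamma_1|) below by (k + 1) x^2 - 3 x - 1; 3 pi / (5 + 2 pi) is the vertex of this parabola.
    Since [inverse_log_coeffs] is a relation, sharpness also requires an actual inverse near 0
    together with the expansion of its logarithm. *)

(** * Modulus inequalities *)

Lemma Cmod_sub_sym (x y : C) : Cmod (x - y) = Cmod (y - x).
Proof. rewrite <- Cmod_opp. f_equal. ring. Qed.

Lemma Cmod_sub_le (x y : C) : Cmod (x - y) <= Cmod x + Cmod y.
Proof. unfold Cminus. rewrite <- (Cmod_opp y). apply Cmod_triangle. Qed.

Lemma Cmod_sub_ge (x y : C) : Cmod x - Cmod y <= Cmod (x - y).
Proof.
  assert (H := Cmod_triangle (x - y) y).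
  replace (x - y + y)%C with x in H by ring. lra.
Qed.

Lemma Cmod_dist_triangle (x y z : C) : Cmod (x - z) <= Cmod (x - y) + Cmod (y - z).
Proof. replace (x - z)%C with ((x - y) + (y - z))%C by ring. apply Cmod_triangle. Qed.

Lemma Cmod_eq_of_sub_0 (x y : C) : Cmod (x - y) = 0 -> x = y.
Proof.
  intros H. apply Cmod_eq_0 in H.
  replace x with ((x - y) + y)%C by ring. rewrite H. ring.
Qed.

Lemma Cmod_pos (x : C) : x <> 0%C -> 0 < Cmod x.
Proof. apply Cmod_gt_0. Qed.

Lemma C_neq_0_of_Cmod (x : C) : 0 < Cmod x -> x <> 0%C.
Proof. apply Cmod_gt_0. Qed.

Lemma C_neq_0_of_Re (x : C) : 0 < Re x -> x <> 0%C.
Proof. intros H E. rewrite E in H. simpl in H. lra. Qed.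

Lemma im_le_Cmod (c : C) : Rabs (Im c) <= Cmod c.
Proof. eapply Rle_trans; [apply Rmax_r | apply (Rmax_Cmod c)]. Qed.

Lemma Cmod_le_re_im (c : C) : Cmod c <= Rabs (Re c) + Rabs (Im c).
Proof.
  destruct c as [x y]. unfold Cmod, Re, Im; simpl fst; simpl snd.
  assert (Hx := Rabs_pos x). assert (Hy := Rabs_pos y).
  rewrite <- (sqrt_pow2 (Rabs x + Rabs y)) by lra.
  apply sqrt_le_1_alt.
  rewrite <- (pow2_abs x), <- (pow2_abs y). nra.
Qed.

(** * Continuity and complex derivatives *)

(** Stated through the modulus so that estimates close by [ring] and [lra]; [cder_is_derive] and
    [ccont_continuous] translate to filters. *)
Definition ccont (f : C -> C) (z : C) : Prop :=
  forall eps, 0 < eps ->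
    exists d, 0 < d /\ forall y, Cmod (y - z) < d -> Cmod (f y - f z) < eps.

(* Caratheodory's form of differentiability: all the rules of differentiation
   reduce to the rules of continuity. *)
Definition cder (f : C -> C) (z l : C) : Prop :=
  exists q : C -> C, q z = l /\ ccont q z /\
    forall y, f y = (f z + q y * (y - z))%C.

Lemma ccont_const (c z : C) : ccont (fun _ => c) z.
Proof.
  intros e He. exists 1; split; [lra|]. intros y _. cbv beta.
  replace (c - c)%C with (RtoC 0) by ring. rewrite Cmod_0. exact He.
Qed.

Lemma ccont_id (z : C) : ccont (fun y => y) z.
Proof. intros e He. exists e; auto. Qed.

Lemma ccont_ext_loc (f g : C -> C) (z : C) (d : R) : 0 < d ->
  (forall y, Cmod (y - z) < d -> f y = g y) -> ccont f z -> ccont g z.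
Proof.
  intros Hd Hfg Hf e He. destruct (Hf e He) as (d' & Hd' & H).
  exists (Rmin d d'). split; [apply Rmin_pos; auto|]. intros y Hy.
  assert (Hz : Cmod (z - z) < d)
    by (replace (z - z)%C with (RtoC 0) by ring; rewrite Cmod_0; auto).
  assert (Hyd : Cmod (y - z) < d) by (eapply Rlt_le_trans; [exact Hy | apply Rmin_l]).
  rewrite <- (Hfg z Hz), <- (Hfg y Hyd).
  apply H. eapply Rlt_le_trans; [exact Hy | apply Rmin_r].
Qed.

Lemma ccont_plus (f g : C -> C) (z : C) :
  ccont f z -> ccont g z -> ccont (fun y => f y + g y)%C z.
Proof.
  intros Hf Hg e He.
  destruct (Hf (e / 2)) as (d1 & Hd1 & H1); [lra|].
  destruct (Hg (e / 2)) as (d2 & Hd2 & H2); [lra|].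
  exists (Rmin d1 d2). split; [apply Rmin_pos; auto|]. intros y Hy.
  replace (f y + g y - (f z + g z))%C with ((f y - f z) + (g y - g z))%C by ring.
  eapply Rle_lt_trans; [apply Cmod_triangle|].
  specialize (H1 y (Rlt_le_trans _ _ _ Hy (Rmin_l _ _))).
  specialize (H2 y (Rlt_le_trans _ _ _ Hy (Rmin_r _ _))). lra.
Qed.

Lemma ccont_bounded (f : C -> C) (z : C) : ccont f z ->
  exists d, 0 < d /\ forall y, Cmod (y - z) < d -> Cmod (f y) < Cmod (f z) + 1.
Proof.
  intros Hf. destruct (Hf 1) as (d & Hd & H); [lra|].
  exists d. split; auto. intros y Hy. specialize (H y Hy).
  assert (H' := Cmod_sub_ge (f y) (f z)). lra.
Qed.

Lemma ccont_mult (f g : C -> C) (z : C) :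
  ccont f z -> ccont g z -> ccont (fun y => f y * g y)%C z.
Proof.
  intros Hf Hg e He.
  destruct (ccont_bounded f z Hf) as (d0 & Hd0 & H0).
  assert (Pf := Cmod_ge_0 (f z)). assert (Pg := Cmod_ge_0 (g z)).
  destruct (Hf (e / (2 * (Cmod (g z) + 1)))) as (d1 & Hd1 & H1).
  { apply Rdiv_lt_0_compat; lra. }
  destruct (Hg (e / (2 * (Cmod (f z) + 1)))) as (d2 & Hd2 & H2).
  { apply Rdiv_lt_0_compat; lra. }
  exists (Rmin d0 (Rmin d1 d2)). split; [repeat apply Rmin_pos; auto|]. intros y Hy.
  assert (Hy0 := Rlt_le_trans _ _ _ Hy (Rmin_l _ _)).
  assert (Hy' := Rlt_le_trans _ _ _ Hy (Rmin_r _ _)).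
  assert (Hy1 := Rlt_le_trans _ _ _ Hy' (Rmin_l _ _)).
  assert (Hy2 := Rlt_le_trans _ _ _ Hy' (Rmin_r _ _)).
  specialize (H0 y Hy0). specialize (H1 y Hy1). specialize (H2 y Hy2).
  replace (f y * g y - f z * g z)%C with (f y * (g y - g z) + (f y - f z) * g z)%C by ring.
  eapply Rle_lt_trans; [apply Cmod_triangle|]. rewrite !Cmod_mult.
  assert (A : Cmod (f y) * Cmod (g y - g z) <= e / 2).
  { replace (e / 2) with ((Cmod (f z) + 1) * (e / (2 * (Cmod (f z) + 1)))) by (field; lra).
    apply Rmult_le_compat; try apply Cmod_ge_0; lra. }
  assert (B : Cmod (f y - f z) * Cmod (g z) < e / 2).
  { replace (e / 2) with ((e / (2 * (Cmod (g z) + 1))) * (Cmod (g z) + 1)) by (field; lra).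
    apply Rle_lt_trans with (Cmod (f y - f z) * (Cmod (g z) + 1)).
    - apply Rmult_le_compat_l; [apply Cmod_ge_0 | lra].
    - apply Rmult_lt_compat_r; lra. }
  lra.
Qed.

Lemma ccont_comp (f g : C -> C) (z : C) :
  ccont f z -> ccont g (f z) -> ccont (fun y => g (f y)) z.
Proof.
  intros Hf Hg e He. destruct (Hg e He) as (d & Hd & H).
  destruct (Hf d Hd) as (d' & Hd' & H'). exists d'; auto.
Qed.

Lemma ccont_inv (f : C -> C) (z : C) :
  f z <> 0%C -> ccont f z -> ccont (fun y => / f y)%C z.
Proof.
  intros Hz Hf e He. assert (P := Cmod_pos _ Hz).
  destruct (Hf (Rmin (Cmod (f z) / 2) (e * (Cmod (f z) * Cmod (f z)) / 2))) as (d & Hd & H).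
  { apply Rmin_pos; [lra|]. assert (0 < e * (Cmod (f z) * Cmod (f z))); [|lra].
    apply Rmult_lt_0_compat; [|apply Rmult_lt_0_compat]; lra. }
  exists d. split; auto. intros y Hy. specialize (H y Hy).
  assert (H1 := Rlt_le_trans _ _ _ H (Rmin_l _ _)).
  assert (H2 := Rlt_le_trans _ _ _ H (Rmin_r _ _)).
  assert (Py : Cmod (f z) / 2 < Cmod (f y)).
  { assert (H' := Cmod_sub_ge (f z) (f y)). rewrite Cmod_sub_sym in H'. lra. }
  assert (Ny : f y <> 0%C) by (apply C_neq_0_of_Cmod; lra).
  replace (/ f y - / f z)%C with (- (f y - f z) * / (f y * f z))%C by (field; auto).
  rewrite Cmod_mult, Cmod_opp, Cmod_inv, Cmod_mult by (apply Cmult_neq_0; auto).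
  apply (Rmult_lt_reg_r (Cmod (f y) * Cmod (f z))); [apply Rmult_lt_0_compat; lra|].
  rewrite Rmult_assoc, Rinv_l, Rmult_1_r by (apply Rgt_not_eq; apply Rmult_lt_0_compat; lra).
  eapply Rlt_trans; [exact H2|].
  replace (e * (Cmod (f z) * Cmod (f z)) / 2) with (e * (Cmod (f z) / 2 * Cmod (f z))) by field.
  apply Rmult_lt_compat_l; auto with real.
Qed.

Lemma cder_ccont (f : C -> C) (z l : C) : cder f z l -> ccont f z.
Proof.
  intros (q & _ & Hq & H).
  apply (ccont_ext_loc (fun y => f z + q y * (y + - z))%C f z 1); [lra| |].
  - intros y _. rewrite (H y). ring.
  - apply ccont_plus; [apply ccont_const|]. apply ccont_mult; auto.
    apply ccont_plus; [apply ccont_id | apply ccont_const].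
Qed.

Lemma cder_const (c z : C) : cder (fun _ => c) z 0.
Proof. exists (fun _ => RtoC 0). split; auto. split; [apply ccont_const|]. intros; ring. Qed.

Lemma cder_id (z : C) : cder (fun y => y) z 1.
Proof. exists (fun _ => RtoC 1). split; auto. split; [apply ccont_const|]. intros; ring. Qed.

Lemma cder_plus (f g : C -> C) (z a b : C) :
  cder f z a -> cder g z b -> cder (fun y => f y + g y)%C z (a + b).
Proof.
  intros (p & <- & Hp & H1) (q & <- & Hq & H2).
  exists (fun y => p y + q y)%C. split; auto. split; [apply ccont_plus; auto|].
  intros y. rewrite (H1 y), (H2 y). ring.
Qed.

Lemma cder_mult (f g : C -> C) (z a b : C) :
  cder f z a -> cder g z b -> cder (fun y => f y * g y)%C z (a * g z + f z * b).
Proof.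
  intros Hf Hg. assert (Cg := cder_ccont _ _ _ Hg).
  destruct Hf as (p & <- & Hp & H1). destruct Hg as (q & <- & Hq & H2).
  exists (fun y => p y * g y + f z * q y)%C. split; auto. split.
  - apply ccont_plus; apply ccont_mult; auto using ccont_const.
  - intros y. rewrite (H1 y), (H2 y). ring.
Qed.

Lemma cder_comp (f g : C -> C) (z a b : C) :
  cder f z a -> cder g (f z) b -> cder (fun y => g (f y)) z (b * a).
Proof.
  intros Hf (q & <- & Hq & H2). assert (Cf := cder_ccont _ _ _ Hf).
  destruct Hf as (p & <- & Hp & H1).
  exists (fun y => q (f y) * p y)%C. split; auto. split.
  - apply ccont_mult; auto. apply ccont_comp; auto.
  - intros y. rewrite (H2 (f y)) at 1.
    assert (E : (f y - f z = p y * (y - z))%C) by (rewrite (H1 y) at 1; ring).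
    rewrite E. ring.
Qed.

(** The identity in [cder] is demanded for all [y], so the slope function is kept near [z] and
    replaced by the plain difference quotient of [g] elsewhere. *)
Lemma cder_ext_loc (f g : C -> C) (z l : C) (d : R) : 0 < d ->
  (forall y, Cmod (y - z) < d -> f y = g y) -> cder f z l -> cder g z l.
Proof.
  intros Hd Hfg (q & Hl & Hq & H).
  assert (Hz : f z = g z).
  { apply Hfg. replace (z - z)%C with (RtoC 0) by ring. rewrite Cmod_0; auto. }
  exists (fun y => if Rlt_dec (Cmod (y - z)) d then q y else (g y - g z) / (y - z))%C.
  assert (Hz' : Cmod (z - z) < d) by (replace (z - z)%C with (RtoC 0) by ring; rewrite Cmod_0; auto).
  split; [destruct (Rlt_dec _ _); [auto | contradiction]|].
  split.
  - apply (ccont_ext_loc q _ z d); auto. intros y Hy.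
    destruct (Rlt_dec _ _); [auto | contradiction].
  - intros y. destruct (Rlt_dec _ _) as [Hy|Hy].
    + rewrite <- (Hfg y Hy), <- Hz. apply H.
    + field. apply C_neq_0_of_Cmod. lra.
Qed.

Lemma cder_inv (f : C -> C) (z a : C) :
  f z <> 0%C -> cder f z a -> cder (fun y => / f y)%C z (- a / (f z * f z)).
Proof.
  intros Hz Hf. assert (Cf := cder_ccont _ _ _ Hf).
  assert (Ci' := ccont_inv f z Hz Cf).
  assert (P := Cmod_pos _ Hz).
  destruct (Cf (Cmod (f z))) as (d & Hd & Hnz); auto.
  destruct Hf as (p & <- & Hp & H).
  apply (cder_ext_loc
    (fun y => / f z + (- p y * / f y * / f z) * (y - z))%C _ z _ d Hd).
  - intros y Hy. specialize (Hnz y Hy).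
    assert (Ny : f y <> 0%C).
    { intros E. rewrite E in Hnz. replace (0 - f z)%C with (- f z)%C in Hnz by ring.
      rewrite Cmod_opp in Hnz. lra. }
    assert (E : (p y * (y - z) = f y - f z)%C) by (rewrite (H y) at 1; ring).
    replace (- p y * / f y * / f z * (y - z))%C
      with (- (p y * (y - z)) * / f y * / f z)%C by ring.
    rewrite E. field. auto.
  - exists (fun y => - p y * / f y * / f z)%C. split; [field; auto|]. split.
    + apply ccont_mult; [|apply ccont_const]. apply ccont_mult; auto.
      apply (ccont_ext_loc (fun y => - (1) * p y)%C _ z 1); [lra| |].
      * intros; ring.
      * apply ccont_mult; auto using ccont_const.
    + intros y. ring.
Qed.

(** Substituting g y into the slope identity of [f] gives y - w = q (g y) (g y - g w). Since q o g
    is continuous and nonzero at [w], its inverse is a slope function for [g]. *)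
Lemma cder_inverse (f g : C -> C) (w l d : C) (r : R) :
  0 < r -> (forall y, Cmod (y - w) < r -> f (g y) = y) -> ccont g w ->
  cder f (g w) l -> l <> 0%C -> cder g w (/ l).
Proof.
  intros Hr Hfg Cg (q & <- & Hq & H) Hl.
  assert (Cqg : ccont (fun y => q (g y)) w) by (apply ccont_comp; auto).
  assert (P := Cmod_pos _ Hl).
  destruct (Cqg (Cmod (q (g w)))) as (d' & Hd' & Hnz); auto.
  assert (Ew : f (g w) = w).
  { apply Hfg. replace (w - w)%C with (RtoC 0) by ring. rewrite Cmod_0; auto. }
  apply (cder_ext_loc (fun y => g w + / q (g y) * (y - w))%C _ w _ (Rmin r d')).
  - apply Rmin_pos; auto.
  - intros y Hy. assert (Hy1 := Rlt_le_trans _ _ _ Hy (Rmin_l _ _)).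
    assert (Hy2 := Rlt_le_trans _ _ _ Hy (Rmin_r _ _)).
    specialize (Hnz y Hy2).
    assert (Ny : q (g y) <> 0%C).
    { intros E. rewrite E in Hnz. replace (0 - q (g w))%C with (- q (g w))%C in Hnz by ring.
      rewrite Cmod_opp in Hnz. lra. }
    assert (E := H (g y)). rewrite (Hfg y Hy1), Ew in E.
    rewrite E at 2. field. auto.
  - exists (fun y => / q (g y))%C. split; auto. split; [apply ccont_inv; auto|].
    intros; ring.
Qed.

Lemma cder_unique (f : C -> C) (z a b : C) : cder f z a -> cder f z b -> a = b.
Proof.
  intros (p & <- & Hp & H1) (q & <- & Hq & H2).
  apply Cmod_eq_of_sub_0. apply Rle_antisym; [|apply Cmod_ge_0].
  apply le_epsilon. intros e He. rewrite Rplus_0_l.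
  destruct (Hp (e / 2)) as (d1 & Hd1 & K1); [lra|].
  destruct (Hq (e / 2)) as (d2 & Hd2 & K2); [lra|].
  set (d := Rmin d1 d2). assert (Hd : 0 < d) by (apply Rmin_pos; auto).
  set (y := (z + RtoC (d / 2))%C).
  assert (Ey : (y - z)%C = RtoC (d / 2)) by (unfold y; ring).
  assert (Hy : Cmod (y - z) < d).
  { rewrite Ey, Cmod_R, Rabs_pos_eq; lra. }
  specialize (K1 y (Rlt_le_trans _ _ _ Hy (Rmin_l _ _))).
  specialize (K2 y (Rlt_le_trans _ _ _ Hy (Rmin_r _ _))).
  assert (E : p y = q y).
  { assert (E := H1 y). rewrite (H2 y) in E.
    assert (N : (y - z)%C <> 0%C).
    { rewrite Ey. apply C_neq_0_of_Cmod. rewrite Cmod_R, Rabs_pos_eq; lra. }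
    assert (E' : (p y * (y - z) = q y * (y - z))%C).
    { transitivity (f z + p y * (y - z) - f z)%C; [ring|]. rewrite <- E. ring. }
    transitivity (p y * (y - z) / (y - z))%C; [field; auto|].
    rewrite E'. field; auto. }
  rewrite E in K1. rewrite Cmod_sub_sym in K1.
  assert (T := Cmod_dist_triangle (p z) (q y) (q z)). lra.
Qed.

Lemma cder_eq (f : C -> C) (z a b : C) : cder f z a -> a = b -> cder f z b.
Proof. intros H <-. exact H. Qed.

(** A second order remainder makes the difference quotient continuous at [z]. This is how [Cexp] and
    power series are differentiated. *)
Lemma cder_of_quadratic (f : C -> C) (z l : C) (K d : R) : 0 < d ->
  (forall y, Cmod (y - z) < d ->
     Cmod (f y - f z - l * (y - z)) <= K * (Cmod (y - z) * Cmod (y - z))) ->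
  cder f z l.
Proof.
  intros Hd H.
  assert (Dec : forall x y : C, {x = y} + {x <> y}) by (apply Ceq_dec).
  exists (fun y => if Dec y z then l else (f y - f z) / (y - z))%C.
  split; [destruct (Dec z z); [auto | contradiction]|].
  split.
  - intros e He. exists (Rmin d (e / (Rabs K + 1))).
    assert (PK := Rabs_pos K).
    split. { apply Rmin_pos; auto. apply Rdiv_lt_0_compat; lra. }
    intros y Hy. destruct (Dec z z) as [_|]; [|contradiction].
    destruct (Dec y z) as [->|N].
    { replace (l - l)%C with (RtoC 0) by ring. rewrite Cmod_0; auto. }
    assert (N' : (y - z)%C <> 0%C).
    { intros E. apply N. replace y with ((y - z) + z)%C by ring. rewrite E; ring. }
    assert (P := Cmod_pos _ N').
    replace ((f y - f z) / (y - z) - l)%C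
      with ((f y - f z - l * (y - z)) / (y - z))%C by (field; auto).
    rewrite Cmod_div by auto.
    specialize (H y (Rlt_le_trans _ _ _ Hy (Rmin_l _ _))).
    assert (Hy2 := Rlt_le_trans _ _ _ Hy (Rmin_r _ _)).
    apply (Rmult_lt_reg_r (Cmod (y - z))); auto.
    unfold Rdiv. rewrite Rmult_assoc, Rinv_l, Rmult_1_r by lra.
    eapply Rle_lt_trans; [exact H|].
    rewrite <- Rmult_assoc. apply Rmult_lt_compat_r; auto.
    apply Rle_lt_trans with ((Rabs K) * Cmod (y - z)).
    { apply Rmult_le_compat_r; [lra | apply Rle_abs]. }
    apply Rle_lt_trans with ((Rabs K + 1) * Cmod (y - z)).
    { apply Rmult_le_compat_r; lra. }
    apply Rlt_le_trans with ((Rabs K + 1) * (e / (Rabs K + 1))).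
    { apply Rmult_lt_compat_l; lra. }
    apply Req_le. field. lra.
  - intros y. destruct (Dec y z) as [->|N]; [ring|].
    field. intros E. apply N. replace y with ((y - z) + z)%C by ring. rewrite E; ring.
Qed.

Lemma cder_is_derive (f : C -> C) (z l : C) :
  cder f z l <-> @is_derive C_AbsRing C_NormedModule f z l.
Proof.
  split.
  - intros (q & <- & Hq & H). split; [apply is_linear_scal_l|].
    intros x Hx. apply (is_filter_lim_locally_unique (K := C_AbsRing) (V := AbsRing_NormedModule C_AbsRing)) in Hx. subst x. intros e.
    destruct (Hq e (cond_pos e)) as (d & Hd & K).
    exists (mkposreal d Hd). intros y Hy.
    change (Cmod (y - z) < d) in Hy. specialize (K y Hy).
    change (Cmod (f y - f z - (y - z) * q z) <= e * Cmod (y - z)).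
    rewrite (H y).
    replace (f z + q y * (y - z) - f z - (y - z) * q z)%C
      with ((q y - q z) * (y - z))%C by ring.
    rewrite Cmod_mult. apply Rmult_le_compat_r; [apply Cmod_ge_0 | lra].
  - intros (_ & H). specialize (H z (fun P HP => HP)).
    assert (Dec : forall x y : C, {x = y} + {x <> y}) by (apply Ceq_dec).
    exists (fun y => if Dec y z then l else (f y - f z) / (y - z))%C.
    split; [destruct (Dec z z); [auto | contradiction]|].
    split.
    + intros e He. assert (He2 : 0 < e / 2) by lra.
      destruct (H (mkposreal _ He2)) as (d & Hd).
      exists (pos d). split; [apply cond_pos|]. intros y Hy.
      destruct (Dec z z) as [_|]; [|contradiction].
      destruct (Dec y z) as [->|N].
      { replace (l - l)%C with (RtoC 0) by ring. rewrite Cmod_0; auto. }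
      assert (N' : (y - z)%C <> 0%C).
      { intros E. apply N. replace y with ((y - z) + z)%C by ring. rewrite E; ring. }
      assert (P := Cmod_pos _ N').
      specialize (Hd y Hy).
      change (Cmod (f y - f z - (y - z) * l) <= e / 2 * Cmod (y - z)) in Hd.
      replace ((f y - f z) / (y - z) - l)%C
        with ((f y - f z - (y - z) * l) / (y - z))%C by (field; auto).
      rewrite Cmod_div by auto.
      apply Rle_lt_trans with (e / 2); [|lra].
      apply (Rmult_le_reg_r (Cmod (y - z))); auto.
      unfold Rdiv at 1. rewrite Rmult_assoc, Rinv_l, Rmult_1_r by lra. exact Hd.
    + intros y. destruct (Dec y z) as [->|N]; [ring|].
      field. intros E. apply N. replace y with ((y - z) + z)%C by ring. rewrite E; ring.
Qed.

(** * Functions with a continuous complex derivative *)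

(** Continuity of [f'] is built in because differentiation under the integral sign in
    [is_derive_rint_pt] relies on it. *)
Definition hol (D : C -> Prop) (f : C -> C) : Prop :=
  exists f' : C -> C, forall z, D z -> cder f z (f' z) /\ ccont f' z.

Lemma hol_ccont D f z : hol D f -> D z -> ccont f z.
Proof. intros (f' & H) Hz. eapply cder_ccont. apply H; auto. Qed.

Lemma hol_const D c : hol D (fun _ => c).
Proof. exists (fun _ => RtoC 0). intros z _. split; [apply cder_const | apply ccont_const]. Qed.

Lemma hol_id D : hol D (fun y => y).
Proof. exists (fun _ => RtoC 1). intros z _. split; [apply cder_id | apply ccont_const]. Qed.

Lemma hol_plus D f g : hol D f -> hol D g -> hol D (fun y => f y + g y)%C.
Proof.
  intros (f' & Hf) (g' & Hg). exists (fun y => f' y + g' y)%C. intros z Hz.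
  destruct (Hf z Hz), (Hg z Hz). split; [apply cder_plus | apply ccont_plus]; auto.
Qed.

Lemma hol_mult D f g : hol D f -> hol D g -> hol D (fun y => f y * g y)%C.
Proof.
  intros (f' & Hf) (g' & Hg). exists (fun y => f' y * g y + f y * g' y)%C. intros z Hz.
  destruct (Hf z Hz), (Hg z Hz). split; [apply cder_mult; auto|].
  apply ccont_plus; apply ccont_mult; eauto using cder_ccont.
Qed.

Lemma hol_inv D f : hol D f -> (forall z, D z -> f z <> 0%C) -> hol D (fun y => / f y)%C.
Proof.
  intros (f' & Hf) Hn. exists (fun y => (- (1) * f' y) * / (f y * f y))%C. intros z Hz.
  destruct (Hf z Hz) as [H1 H2]. split.
  - replace (- (1) * f' z * / (f z * f z))%C with (- f' z / (f z * f z))%C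
      by (unfold Cdiv; ring).
    apply cder_inv; auto.
  - apply ccont_mult; [apply ccont_mult; auto using ccont_const|].
    apply ccont_inv; [apply Cmult_neq_0; auto|].
    apply ccont_mult; eapply cder_ccont; eauto.
Qed.

Lemma hol_comp (D E : C -> Prop) f g :
  hol D f -> hol E g -> (forall z, D z -> E (f z)) -> hol D (fun y => g (f y)).
Proof.
  intros (f' & Hf) (g' & Hg) HE. exists (fun y => g' (f y) * f' y)%C. intros z Hz.
  destruct (Hf z Hz), (Hg (f z) (HE z Hz)). split; [apply cder_comp; auto|].
  apply ccont_mult; auto. apply ccont_comp; eauto using cder_ccont.
Qed.

Lemma hol_ext (D : C -> Prop) f g : (forall z, D z -> exists d, 0 < d /\
   forall y, Cmod (y - z) < d -> f y = g y) -> hol D f -> hol D g.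
Proof.
  intros Hfg (f' & Hf). exists f'. intros z Hz. destruct (Hf z Hz).
  split; auto. destruct (Hfg z Hz) as (d & Hd & E). eapply cder_ext_loc; eauto.
Qed.

Lemma hol_sub (D E : C -> Prop) f : (forall z, D z -> E z) -> hol E f -> hol D f.
Proof. intros H (f' & Hf). exists f'. auto. Qed.

(** * The complex exponential, logarithm and arcsine *)

Definition Cexp (z : C) : C := (exp (Re z) * cos (Im z), exp (Re z) * sin (Im z))%R.

Lemma Cexp_plus (a b : C) : Cexp (a + b) = (Cexp a * Cexp b)%C.
Proof.
  destruct a as [x y], b as [x' y']. unfold Cexp, Cmult, Cplus; simpl.
  rewrite exp_plus, cos_plus, sin_plus. apply injective_projections; simpl; ring.
Qed.

Lemma Cexp_0 : Cexp 0 = 1%C.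
Proof. unfold Cexp; simpl. rewrite exp_0, cos_0, sin_0. apply injective_projections; simpl; ring. Qed.

Lemma Cmod_Cexp (z : C) : Cmod (Cexp z) = exp (Re z).
Proof.
  unfold Cmod, Cexp; simpl fst; simpl snd.
  replace ((exp (Re z) * cos (Im z)) ^ 2 + (exp (Re z) * sin (Im z)) ^ 2)
    with (exp (Re z) ^ 2 * (Rsqr (sin (Im z)) + Rsqr (cos (Im z)))) by (unfold Rsqr; ring).
  rewrite sin2_cos2, Rmult_1_r. apply sqrt_pow2. left; apply exp_pos.
Qed.

Lemma Cexp_neq_0 (z : C) : Cexp z <> 0%C.
Proof. apply C_neq_0_of_Cmod. rewrite Cmod_Cexp. apply exp_pos. Qed.

Lemma Cexp_opp (z : C) : Cexp (- z) = (/ Cexp z)%C.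
Proof.
  assert (H : (Cexp (- z) * Cexp z = 1)%C).
  { rewrite <- Cexp_plus. replace (- z + z)%C with (RtoC 0) by ring. apply Cexp_0. }
  transitivity (Cexp (- z) * Cexp z / Cexp z)%C.
  - field. apply Cexp_neq_0.
  - rewrite H. field. apply Cexp_neq_0.
Qed.

Lemma Rabs_sin_le (t : R) : Rabs (sin t) <= Rabs t.
Proof.
  destruct (MVT_gen sin 0 t cos) as (c & _ & E).
  - intros x _. apply is_derive_Reals, derivable_pt_lim_sin.
  - intros x _. apply continuity_sin.
  - rewrite sin_0 in E. replace (sin t) with (cos c * (t - 0)) by lra.
    rewrite Rabs_mult, Rminus_0_r.
    rewrite <- (Rmult_1_l (Rabs t)) at 2. apply Rmult_le_compat_r; [apply Rabs_pos|].
    apply Rabs_le, COS_bound.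
Qed.

Lemma one_sub_cos_bound (y : R) : 0 <= 1 - cos y <= y * y / 2.
Proof.
  split; [generalize (COS_bound y); lra|].
  replace y with (2 * (y / 2)) at 1 by field. rewrite cos_2a_sin.
  assert (H := Rabs_sin_le (y / 2)). apply Rsqr_le_abs_1 in H. unfold Rsqr in H. lra.
Qed.

Lemma sin_sub_id_bound (y : R) : Rabs y <= 1 / 2 -> Rabs (sin y - y) <= y * y / 4.
Proof.
  intros Hy.
  destruct (MVT_gen (fun t => sin t - t) 0 y (fun t => cos t - 1)) as (c & Hc & E).
  - intros x _. auto_derive; auto. ring.
  - intros x _. apply continuity_pt_minus; [apply continuity_sin | apply derivable_continuous, derivable_id].
  - rewrite sin_0 in E. replace (sin y - y) with ((cos c - 1) * y) by lra.
    assert (B := one_sub_cos_bound c).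
    assert (Hcy : c * c <= y * y).
    { unfold Rmin, Rmax in Hc. destruct (Rle_dec 0 y); nra. }
    rewrite Rabs_mult, Rabs_left1 by lra.
    assert (P := Rabs_pos y).
    apply Rle_trans with (y * y / 2 * Rabs y); [apply Rmult_le_compat_r; lra|].
    assert (0 <= y * y) by nra. nra.
Qed.

Lemma exp_sub_bound (x : R) : Rabs x <= 1 / 2 -> 0 <= exp x - 1 - x <= 2 * (x * x).
Proof.
  intros H. apply Rabs_le_between in H.
  split; [generalize (exp_ineq1_le x); lra|].
  assert (A := exp_ineq1_le (- x)). rewrite exp_Ropp in A.
  assert (P := exp_pos x).
  assert (B : exp x <= / (1 - x)).
  { rewrite <- (Rinv_inv (exp x)). apply Rinv_le_contravar; lra. }
  assert (D : / (1 - x) <= 1 + x + 2 * (x * x)); [|lra].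
  apply (Rmult_le_reg_l (1 - x)); [lra|]. rewrite Rinv_r by lra. nra.
Qed.

(** Real and imaginary parts are split into the second order errors of exp, cos and sin; the cross
    term is absorbed by 2 |x| |y| <= x^2 + y^2. The factor 4 is generous. *)
Lemma Cexp_quadratic (h : C) : Cmod h < 1 / 2 ->
  Cmod (Cexp h - 1 - h) <= 4 * (Cmod h * Cmod h).
Proof.
  destruct h as [x y]. intros H.
  assert (Hx : Rabs x <= 1 / 2) by (generalize (re_le_Cmod (x, y)); simpl; lra).
  assert (Hy : Rabs y <= 1 / 2) by (generalize (im_le_Cmod (x, y)); simpl; lra).
  assert (E := exp_sub_bound x Hx). assert (S := sin_sub_id_bound y Hy).
  assert (K := one_sub_cos_bound y). assert (SA := Rabs_sin_le y).
  assert (KB := COS_bound y).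
  replace (Cmod (x, y) * Cmod (x, y)) with (x * x + y * y)
    by (replace (Cmod (x, y) * Cmod (x, y)) with (Cmod (x, y) ^ 2) by ring;
        rewrite Cmod2_alt; simpl; ring).
  eapply Rle_trans; [apply Cmod_le_re_im|].
  unfold Cexp, Cminus, Cplus, Copp; simpl.
  replace (exp x * cos y + - (1) + - x)
    with ((exp x - 1 - x) * cos y + (1 + x) * - (1 - cos y)) by ring.
  replace (exp x * sin y + - 0 + - y)
    with ((exp x - 1 - x) * sin y + x * sin y + (sin y - y)) by ring.
  apply Rabs_le_between in Hx.
  assert (A1 : Rabs ((exp x - 1 - x) * cos y + (1 + x) * - (1 - cos y))
    <= 2 * (x * x) + y * y).
  { set (u := exp x - 1 - x) in *. set (v := 1 - cos y) in *.
    assert (U1 : 0 <= u * (1 + cos y)) by (apply Rmult_le_pos; lra).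
    assert (U2 : 0 <= u * (1 - cos y)) by (apply Rmult_le_pos; lra).
    assert (V1 : 0 <= (1 + x) * v) by (apply Rmult_le_pos; lra).
    assert (V2 : 0 <= (1 - x) * v) by (apply Rmult_le_pos; lra).
    apply Rabs_le. lra. }
  assert (P1 := Rabs_pos x). assert (P2 := Rabs_pos y).
  assert (Q1 : x * x = Rabs x * Rabs x) by (rewrite <- Rabs_mult, Rabs_pos_eq; nra).
  assert (Q2 : y * y = Rabs y * Rabs y) by (rewrite <- Rabs_mult, Rabs_pos_eq; nra).
  assert (A2 : Rabs ((exp x - 1 - x) * sin y + x * sin y + (sin y - y))
    <= 2 * (x * x) * Rabs y + Rabs x * Rabs y + y * y / 4).
  { eapply Rle_trans; [apply Rabs_triang|]. apply Rplus_le_compat; [|exact S].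
    eapply Rle_trans; [apply Rabs_triang|]. rewrite !Rabs_mult.
    apply Rplus_le_compat.
    - rewrite (Rabs_pos_eq (exp x - 1 - x)) by lra.
      apply Rmult_le_compat; try lra. apply Rabs_pos.
    - apply Rmult_le_compat_l; lra. }
  assert (2 * (x * x) * Rabs y <= x * x) by nra.
  assert (S1 := Rle_0_sqr (Rabs x - Rabs y)). unfold Rsqr in S1.
  assert (S2 := Rle_0_sqr x). assert (S3 := Rle_0_sqr y). unfold Rsqr in S2, S3.
  lra.
Qed.

Lemma cder_Cexp (z : C) : cder Cexp z (Cexp z).
Proof.
  apply (cder_of_quadratic Cexp z (Cexp z) (Cmod (Cexp z) * 4) (1 / 2)); [lra|].
  intros y Hy.
  replace (Cexp y) with (Cexp z * Cexp (y - z))%C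
    by (rewrite <- Cexp_plus; f_equal; ring).
  replace (Cexp z * Cexp (y - z) - Cexp z - Cexp z * (y - z))%C
    with (Cexp z * (Cexp (y - z) - 1 - (y - z)))%C by ring.
  rewrite Cmod_mult, Rmult_assoc.
  apply Rmult_le_compat_l; [apply Cmod_ge_0 | apply Cexp_quadratic; auto].
Qed.

Lemma hol_Cexp D : hol D Cexp.
Proof.
  exists Cexp. intros z _. split; [apply cder_Cexp|].
  eapply cder_ccont, cder_Cexp.
Qed.

(** * Principal argument, logarithm and square root *)

Lemma Re_div_Cmod_bound (z : C) : z <> 0%C -> -1 <= Re z / Cmod z <= 1.
Proof.
  intros Hz. assert (P := Cmod_pos _ Hz). assert (H := re_le_Cmod z).
  apply Rabs_le_between in H.
  split; apply (Rmult_le_reg_r (Cmod z)); auto;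
    unfold Rdiv; rewrite Rmult_assoc, Rinv_l, Rmult_1_r by lra; lra.
Qed.

Lemma cos_Carg (z : C) : z <> 0%C -> cos (Carg z) = Re z / Cmod z.
Proof.
  intros Hz. assert (B := Re_div_Cmod_bound z Hz).
  unfold Carg. destruct (Rle_dec 0 (Im z)); [|rewrite cos_neg]; apply cos_acos; lra.
Qed.

Lemma sin_Carg (z : C) : z <> 0%C -> sin (Carg z) = Im z / Cmod z.
Proof.
  intros Hz. assert (B := Re_div_Cmod_bound z Hz). assert (P := Cmod_pos _ Hz).
  assert (E : sqrt (1 - (Re z / Cmod z)²) = Rabs (Im z) / Cmod z).
  { rewrite <- (Rabs_pos_eq (Cmod z)) at 2 by lra. rewrite <- Rabs_div by lra.
    rewrite <- sqrt_Rsqr_abs. f_equal. unfold Rsqr.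
    apply (Rmult_eq_reg_r (Cmod z ^ 2)); [|apply Rgt_not_eq; nra].
    assert (Q := Cmod2_alt z).
    replace ((1 - Re z / Cmod z * (Re z / Cmod z)) * Cmod z ^ 2)
      with (Cmod z ^ 2 - Re z ^ 2) by (field; lra).
    replace (Im z / Cmod z * (Im z / Cmod z) * Cmod z ^ 2) with (Im z ^ 2) by (field; lra). lra. }
  unfold Carg. destruct (Rle_dec 0 (Im z)) as [H|H].
  - rewrite sin_acos by lra. rewrite E, Rabs_pos_eq; auto.
  - rewrite sin_neg, sin_acos by lra. rewrite E, Rabs_left by lra. field. lra.
Qed.

Lemma Cexp_Clog (z : C) : z <> 0%C -> Cexp (Clog z) = z.
Proof.
  intros Hz. assert (P := Cmod_pos _ Hz). unfold Cexp, Clog; simpl.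
  rewrite cos_Carg, sin_Carg, exp_ln by auto.
  destruct z as [x y]. apply injective_projections; simpl; field; lra.
Qed.

Lemma Carg_bound (z : C) : Rabs (Carg z) <= PI.
Proof.
  assert (B := acos_bound (Re z / Cmod z)).
  unfold Carg. destruct (Rle_dec 0 (Im z)); apply Rabs_le; lra.
Qed.

Lemma ccont_Re_lift (h : R -> R) (f : C -> C) (z : C) :
  ccont f z -> continuity_pt h (Re (f z)) -> ccont (fun y => RtoC (h (Re (f y)))) z.
Proof.
  intros Hf Hh e He. destruct (Hh e He) as (d & Hd & H).
  destruct (Hf d Hd) as (d' & Hd' & H'). exists d'. split; auto. intros y Hy.
  specialize (H' y Hy). rewrite <- RtoC_minus, Cmod_R.
  destruct (Req_dec (Re (f y)) (Re (f z))) as [E|N].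
  { rewrite E, Rminus_diag, Rabs_R0; auto. }
  apply H. split; [split; [exact I | auto]|].
  simpl. unfold Rdist. eapply Rle_lt_trans; [|exact H'].
  eapply Rle_trans; [|apply re_le_Cmod]. apply Req_le. f_equal.
Qed.

Lemma ccont_Cmod (z : C) : ccont (fun y => RtoC (Cmod y)) z.
Proof.
  intros e He. exists e. split; auto. intros y Hy.
  rewrite <- RtoC_minus, Cmod_R.
  assert (H1 := Cmod_sub_ge y z). assert (H2 := Cmod_sub_ge z y).
  rewrite Cmod_sub_sym in H2. apply Rabs_lt_between. lra.
Qed.

Lemma ccont_Re (z : C) : ccont (fun y => RtoC (Re y)) z.
Proof. apply (ccont_Re_lift (fun x => x) (fun y => y)); [apply ccont_id | apply continuity_pt_id]. Qed.

Lemma ccont_Im (z : C) : ccont (fun y => RtoC (Im y)) z.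
Proof.
  apply (ccont_ext_loc (fun y => RtoC (Re (- Ci * y))) _ z 1); [lra| |].
  - intros [a b] _. f_equal. simpl. ring.
  - apply (ccont_Re_lift (fun x => x) (fun y => - Ci * y)%C); [|apply continuity_pt_id].
    apply ccont_mult; [apply ccont_const | apply ccont_id].
Qed.

Lemma Carg_pos_Re (z : C) : 0 < Re z -> - (PI / 2) < Carg z < PI / 2.
Proof.
  intros H. assert (Hz := C_neq_0_of_Re _ H). assert (P := Cmod_pos _ Hz).
  assert (C1 : 0 < cos (Carg z)) by (rewrite cos_Carg by auto; apply Rdiv_lt_0_compat; auto).
  assert (B := Carg_bound z). apply Rabs_le_between in B.
  split; apply Rnot_le_lt; intros N.
  - rewrite <- cos_neg in C1. assert (cos (- Carg z) <= 0); [|lra].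
    apply cos_le_0; lra.
  - assert (cos (Carg z) <= 0); [|lra]. apply cos_le_0; lra.
Qed.

(** On the right half-plane this form removes the case split of [Carg] on the sign of the imaginary
    part, and continuity of [Clog] becomes visible. *)
Lemma Carg_atan (z : C) : 0 < Re z -> Carg z = atan (Im z / Re z).
Proof.
  intros H. assert (Hz := C_neq_0_of_Re _ H). assert (P := Cmod_pos _ Hz).
  rewrite <- (atan_tan (Carg z)) by (apply Carg_pos_Re; auto).
  f_equal. unfold tan. rewrite cos_Carg, sin_Carg by auto. field. lra.
Qed.

Lemma ccont_Clog (z : C) : 0 < Re z -> ccont Clog z.
Proof.
  intros H. assert (Hz := C_neq_0_of_Re _ H). assert (P := Cmod_pos _ Hz).
  apply (ccont_ext_loc (fun y => RtoC (ln (Re (RtoC (Cmod y))))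
    + Ci * RtoC (atan (Re (RtoC (Im y) * / RtoC (Re y)))))%C _ z (Re z)); auto.
  - intros y Hy. assert (Hy' : 0 < Re y).
    { assert (A := re_le_Cmod (y - z)). destruct y, z; simpl in *.
      assert (B := Rle_lt_trans _ _ _ A Hy). apply Rabs_lt_between in B. lra. }
    unfold Clog. rewrite Carg_atan by auto.
    replace (Re (RtoC (Im y) * / RtoC (Re y))) with (Im y / Re y).
    + apply injective_projections; simpl; ring.
    + rewrite <- RtoC_inv by lra. simpl. unfold Rdiv. ring.
  - apply ccont_plus.
    + apply (ccont_Re_lift ln (fun y => RtoC (Cmod y))); [apply ccont_Cmod|].
      apply derivable_continuous_pt. exists (/ Cmod z). apply derivable_pt_lim_ln; auto.
    + apply ccont_mult; [apply ccont_const|].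
      apply (ccont_Re_lift atan (fun y => RtoC (Im y) * / RtoC (Re y))%C).
      * apply ccont_mult; [apply ccont_Im|]. apply ccont_inv; [|apply ccont_Re].
        apply C_neq_0_of_Cmod. rewrite Cmod_R, Rabs_pos_eq; lra.
      * apply derivable_continuous_pt. eexists. apply derivable_pt_lim_atan.
Qed.

(** [Clog] is a continuous right inverse of [Cexp], so [cder_inverse] applies. *)
Lemma cder_Clog (z : C) : 0 < Re z -> cder Clog z (/ z).
Proof.
  intros H. assert (Hz := C_neq_0_of_Re _ H).
  apply (cder_inverse Cexp Clog z z (/ z) (Re z) H); auto using ccont_Clog.
  - intros y Hy. apply Cexp_Clog, C_neq_0_of_Re.
    assert (A := re_le_Cmod (y - z)). destruct y, z; simpl in *.
    assert (B := Rle_lt_trans _ _ _ A Hy). apply Rabs_lt_between in B. lra.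
  - rewrite <- (Cexp_Clog z Hz) at 2. apply cder_Cexp.
Qed.

Lemma hol_Clog : hol (fun z => 0 < Re z) Clog.
Proof.
  exists (fun z => / z)%C. intros z Hz. split; [apply cder_Clog; auto|].
  apply ccont_inv; [apply C_neq_0_of_Re; auto | apply ccont_id].
Qed.

Lemma Cmod_Csqrt (z : C) : Cmod (Csqrt z) = sqrt (Cmod z).
Proof.
  unfold Csqrt. rewrite Cmod_mult, Cmod_R, Rabs_pos_eq by apply sqrt_pos.
  rewrite <- (Rmult_1_r (sqrt (Cmod z))) at 2. f_equal.
  unfold Cmod; simpl fst; simpl snd.
  replace (cos (Carg z / 2) ^ 2 + sin (Carg z / 2) ^ 2)
    with ((sin (Carg z / 2))² + (cos (Carg z / 2))²) by (unfold Rsqr; ring).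
  rewrite sin2_cos2. apply sqrt_1.
Qed.

Lemma Csqrt_exp (z : C) : z <> 0%C -> Csqrt z = Cexp (Clog z * RtoC (1 / 2)).
Proof.
  intros Hz. assert (P := Cmod_pos _ Hz). unfold Csqrt, Cexp, Clog; simpl.
  replace (ln (Cmod z) * (1 / 2) - Carg z * 0) with (/ 2 * ln (Cmod z)) by field.
  replace (ln (Cmod z) * 0 + Carg z * (1 / 2)) with (Carg z / 2) by field.
  change (exp (/ 2 * ln (Cmod z))) with (Rpower (Cmod z) (/ 2)).
  rewrite Rpower_sqrt by auto. apply injective_projections; simpl; ring.
Qed.

Lemma Csqrt_sqr (z : C) : (Csqrt z * Csqrt z)%C = z.
Proof.
  destruct (Ceq_dec z 0) as [->|Hz].
  - unfold Csqrt. rewrite Cmod_0, sqrt_0. ring.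
  - rewrite Csqrt_exp, <- Cexp_plus by auto.
    replace (Clog z * RtoC (1 / 2) + Clog z * RtoC (1 / 2))%C with (Clog z).
    + apply Cexp_Clog; auto.
    + destruct (Clog z). apply injective_projections; simpl; field.
Qed.

Lemma Re_Csqrt_pos (z : C) : 0 < Re z -> 0 < Re (Csqrt z).
Proof.
  intros H. assert (P := Cmod_pos _ (C_neq_0_of_Re _ H)).
  assert (B := Carg_pos_Re z H). assert (PP := PI_RGT_0).
  unfold Csqrt; simpl. rewrite Rmult_0_l, Rminus_0_r.
  apply Rmult_lt_0_compat; [apply sqrt_lt_R0; auto | apply cos_gt_0; lra].
Qed.

Lemma hol_Csqrt : hol (fun z => 0 < Re z) Csqrt.
Proof.
  apply (hol_ext _ (fun z => Cexp (Clog z * RtoC (1 / 2)))%C).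
  - intros z Hz. exists (Re z). split; auto. intros y Hy. symmetry.
    apply Csqrt_exp, C_neq_0_of_Re.
    assert (A := re_le_Cmod (y - z)). destruct y, z; simpl in *.
    assert (B := Rle_lt_trans _ _ _ A Hy). apply Rabs_lt_between in B. lra.
  - apply (hol_comp _ (fun _ => True) (fun z => Clog z * RtoC (1 / 2))%C Cexp); auto using hol_Cexp.
    apply hol_mult; [apply hol_Clog | apply hol_const].
Qed.

(* [exp (i arcsin z)], whose inverse is [Csqrt (1 - z ^ 2) - Ci * z]. *)
Definition arcsin_arg (z : C) : C := (Ci * z + Csqrt (1 - z ^ 2))%C.

Lemma arcsin_arg_inv (z : C) :
  (arcsin_arg z * (Csqrt (1 - z ^ 2) - Ci * z) = 1)%C.
Proof.
  unfold arcsin_arg.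
  replace ((Ci * z + Csqrt (1 - z ^ 2)) * (Csqrt (1 - z ^ 2) - Ci * z))%C
    with (Csqrt (1 - z ^ 2) * Csqrt (1 - z ^ 2) - (Ci * Ci) * z ^ 2)%C by (simpl; ring).
  rewrite Csqrt_sqr.
  replace (Ci * Ci)%C with (- (1))%C by (apply injective_projections; simpl; ring). ring.
Qed.

Lemma arcsin_arg_neq_0 (z : C) : arcsin_arg z <> 0%C.
Proof.
  intros E. assert (H := arcsin_arg_inv z). rewrite E in H.
  apply (f_equal fst) in H. simpl in H. lra.
Qed.

Lemma Cexp_Carcsin (z : C) : Cexp (Ci * Carcsin z) = arcsin_arg z.
Proof.
  unfold Carcsin. fold (arcsin_arg z).
  rewrite <- (Cexp_Clog (arcsin_arg z)) at 2 by apply arcsin_arg_neq_0. f_equal.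
  destruct (Clog (arcsin_arg z)). apply injective_projections; simpl; ring.
Qed.

(** The right-hand side is sin (arcsin z) in exponentials. It holds on the branch cuts too, so a
    Schwarz function can be recovered from its arcsine without excluding |w z| = 1. *)
Lemma sin_Carcsin (z : C) :
  z = ((Cexp (Ci * Carcsin z) - / Cexp (Ci * Carcsin z)) * / (2 * Ci))%C.
Proof.
  rewrite Cexp_Carcsin.
  assert (E : (/ arcsin_arg z = Csqrt (1 - z ^ 2) - Ci * z)%C).
  { transitivity (/ arcsin_arg z * (arcsin_arg z * (Csqrt (1 - z ^ 2) - Ci * z)))%C.
    - rewrite arcsin_arg_inv. ring.
    - field. apply arcsin_arg_neq_0. }
  rewrite E. unfold arcsin_arg. field.
  apply C_neq_0_of_Cmod. rewrite Cmod_Ci. lra.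
Qed.

(** Both [arcsin_arg z] and its inverse sqrt (1 - z^2) - i z have modulus at most 1 + 2 |z| <= exp
    (2 |z|), which bounds the logarithm from both sides. *)
Lemma ln_arcsin_arg_bound (z : C) : Rabs (ln (Cmod (arcsin_arg z))) <= 2 * Cmod z.
Proof.
  set (s := Csqrt (1 - z ^ 2)). set (x := Cmod z).
  assert (Px : 0 <= x) by apply Cmod_ge_0.
  assert (Bs : Cmod s <= 1 + x).
  { unfold s. rewrite Cmod_Csqrt. rewrite <- (sqrt_pow2 (1 + x)) by lra.
    apply sqrt_le_1_alt. eapply Rle_trans; [apply Cmod_sub_le|].
    rewrite Cmod_1, Cmod_pow. fold x. nra. }
  assert (BI : Cmod (Ci * z) = x) by (rewrite Cmod_mult, Cmod_Ci, Rmult_1_l; auto).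
  assert (B1 : Cmod (arcsin_arg z) <= exp (2 * x)).
  { apply Rle_trans with (1 + 2 * x); [|generalize (exp_ineq1_le (2 * x)); lra].
    unfold arcsin_arg. eapply Rle_trans; [apply Cmod_triangle|]. fold s. rewrite BI. lra. }
  assert (B2 : Cmod (s - Ci * z) <= exp (2 * x)).
  { apply Rle_trans with (1 + 2 * x); [|generalize (exp_ineq1_le (2 * x)); lra].
    eapply Rle_trans; [apply Cmod_sub_le|]. rewrite BI. lra. }
  assert (P := Cmod_pos _ (arcsin_arg_neq_0 z)).
  assert (I := arcsin_arg_inv z). fold s in I. apply (f_equal Cmod) in I.
  rewrite Cmod_mult, Cmod_1 in I.
  assert (B3 : exp (- (2 * x)) <= Cmod (arcsin_arg z)).
  { rewrite exp_Ropp.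
    replace (Cmod (arcsin_arg z)) with (/ Cmod (s - Ci * z)).
    - apply Rinv_le_contravar; auto. assert (Q := Cmod_ge_0 (s - Ci * z)).
      destruct Q as [Q|Q]; auto. rewrite <- Q in I. lra.
    - apply (Rmult_eq_reg_r (Cmod (s - Ci * z))).
      + rewrite I. apply Rinv_l. intros E. rewrite E in I. lra.
      + intros E. rewrite E in I. lra. }
  apply Rabs_le. split.
  - rewrite <- (ln_exp (- (2 * x))). apply ln_le; auto. apply exp_pos.
  - rewrite <- (ln_exp (2 * x)). apply ln_le; auto.
Qed.

Lemma Im_Carcsin_bound (z : C) : Rabs (Im (Carcsin z)) <= 2 * Cmod z.
Proof.
  eapply Rle_trans; [|apply ln_arcsin_arg_bound]. apply Req_le.
  unfold Carcsin. fold (arcsin_arg z). unfold Clog; simpl. rewrite <- Rabs_Ropp. f_equal. ring.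
Qed.

Lemma Cmod_Carcsin_bound (z : C) : Cmod (Carcsin z) <= 2 * Cmod z + PI.
Proof.
  unfold Carcsin. fold (arcsin_arg z).
  rewrite Cmod_mult, Cmod_opp, Cmod_Ci, Rmult_1_l.
  eapply Rle_trans; [apply Cmod_le_re_im|].
  apply Rplus_le_compat; [apply ln_arcsin_arg_bound | apply Carg_bound].
Qed.

Lemma Carg_1 : Carg 1 = 0.
Proof.
  unfold Carg. rewrite Cmod_1. destruct (Rle_dec 0 (Im 1)) as [_|N].
  - simpl. replace (1 / 1) with 1 by field. apply acos_1.
  - exfalso. apply N. simpl. lra.
Qed.

Lemma Clog_1 : Clog 1 = 0%C.
Proof. unfold Clog. rewrite Carg_1, Cmod_1, ln_1. reflexivity. Qed.

Lemma Carcsin_0 : Carcsin 0 = 0%C.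
Proof.
  unfold Carcsin.
  replace (1 - 0 ^ 2)%C with (RtoC 1) by (simpl; ring).
  replace (Csqrt 1) with (RtoC 1).
  - replace (Ci * 0 + 1)%C with (RtoC 1) by ring. rewrite Clog_1. ring.
  - unfold Csqrt. rewrite Carg_1, Cmod_1, sqrt_1. unfold Rdiv. rewrite Rmult_0_l, cos_0, sin_0.
    apply injective_projections; simpl; ring.
Qed.

Lemma Re_one_sub_sqr_pos (z : C) : Omega z -> 0 < Re (1 - z ^ 2).
Proof.
  intros H. unfold Omega in H. assert (P := Cmod_ge_0 z).
  assert (A := re_le_Cmod (z ^ 2)). rewrite Cmod_pow in A.
  apply Rabs_le_between in A.
  change (Re (1 - z ^ 2)) with (1 + - Re (z ^ 2)). nra.
Qed.

(** Write z = x + i y and sqrt (1 - z^2) = p + i q with p > 0; the real part in question is p - y.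
    Squaring gives p^2 = q^2 + 1 - x^2 + y^2 > y^2. Thus [Clog] is applied only in the right
    half-plane, where it is holomorphic. *)
Lemma Re_arcsin_arg_pos (z : C) : Omega z -> 0 < Re (arcsin_arg z).
Proof.
  intros H. assert (A := Re_Csqrt_pos _ (Re_one_sub_sqr_pos z H)).
  assert (E := Csqrt_sqr (1 - z ^ 2)). unfold arcsin_arg.
  assert (Hx := re_le_Cmod z). unfold Omega in H.
  destruct (Csqrt (1 - z ^ 2)) as [p q]. destruct z as [x y].
  injection E as E1 E2. simpl in *.
  assert (Hx' : Rabs x < 1) by lra. apply Rabs_lt_between in Hx'.
  destruct (Rlt_le_dec y p) as [L|L]; [lra|]. nra.
Qed.

Lemma hol_Carcsin : hol Omega Carcsin.
Proof.
  apply (hol_mult Omega (fun _ => - Ci)%C (fun z => Clog (arcsin_arg z))); [apply hol_const|].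
  apply (hol_comp _ (fun z => 0 < Re z) arcsin_arg Clog);
    [|apply hol_Clog | apply Re_arcsin_arg_pos].
  apply hol_plus; [apply hol_mult; [apply hol_const | apply hol_id]|].
  apply (hol_comp _ (fun z => 0 < Re z) (fun z => 1 - z ^ 2)%C Csqrt);
    [|apply hol_Csqrt | apply Re_one_sub_sqr_pos].
  apply (hol_ext _ (fun z => 1 + - (1) * (z * z))%C).
  - intros z _. exists 1. split; [lra|]. intros; simpl; ring.
  - apply hol_plus; [apply hol_const|].
    apply hol_mult; [apply hol_const|]. apply hol_mult; apply hol_id.
Qed.

(** * Series and power series *)

(** Sums the first [n] terms, whereas [sum_n u n] includes the term of index [n]; hence the shift in
    [sum_n_psum]. *)
Fixpoint psum (u : nat -> C) (n : nat) : C :=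
  match n with O => 0%C | S m => (psum u m + u m)%C end.

Fixpoint rsum (v : nat -> R) (n : nat) : R :=
  match n with O => 0 | S m => rsum v m + v m end.

Definition csum (u : nat -> C) (l : C) : Prop :=
  forall eps, 0 < eps -> exists N, forall n, (N <= n)%nat -> Cmod (psum u n - l) < eps.

Lemma sum_n_psum (u : nat -> C) n :
  @sum_n C_AbelianMonoid u n = psum u (S n).
Proof.
  induction n as [|n IH].
  - rewrite sum_O. simpl. ring.
  - rewrite sum_Sn, IH. reflexivity.
Qed.

Lemma sum_n_rsum (v : nat -> R) n : sum_n v n = rsum v (S n).
Proof.
  induction n as [|n IH].
  - rewrite sum_O. simpl. ring.
  - rewrite sum_Sn, IH. reflexivity.
Qed.

Lemma csum_is_series (u : nat -> C) (l : C) :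
  csum u l <-> @is_series C_AbsRing C_NormedModule u l.
Proof.
  split.
  - intros H P HP. apply (locally_norm_le_locally (V := C_NormedModule)) in HP. destruct HP as [e He].
    destruct (H e (cond_pos e)) as (N & HN). exists N. intros n Hn.
    apply He. unfold ball_norm.
    change (Cmod (@sum_n C_AbelianMonoid u n - l) < e).
    rewrite sum_n_psum. apply HN. lia.
  - intros H e He.
    assert (L : locally (T := C_UniformSpace) l (fun x => Cmod (x - l) < e)).
    { apply (locally_le_locally_norm (V := C_NormedModule)).
      exists (mkposreal e He). intros x Hx. exact Hx. }
    destruct (H _ L) as (N & HN). exists (S N). intros [|n] Hn; [lia|].
    rewrite <- sum_n_psum. apply HN. lia.
Qed.

Lemma csum_unique u a b : csum u a -> csum u b -> a = b.
Proof.
  intros Ha Hb. apply Cmod_eq_of_sub_0, Rle_antisym; [|apply Cmod_ge_0].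
  apply le_epsilon. intros e He. rewrite Rplus_0_l.
  destruct (Ha (e / 2)) as (N1 & H1); [lra|]. destruct (Hb (e / 2)) as (N2 & H2); [lra|].
  specialize (H1 (N1 + N2)%nat ltac:(lia)). specialize (H2 (N1 + N2)%nat ltac:(lia)).
  rewrite Cmod_sub_sym in H1.
  assert (T := Cmod_dist_triangle a (psum u (N1 + N2)) b). lra.
Qed.

Lemma psum_ext u v n : (forall k, u k = v k) -> psum u n = psum v n.
Proof. intros H. induction n; simpl; [auto|]. rewrite IHn, H. auto. Qed.

Lemma csum_ext u v l : (forall n, u n = v n) -> csum u l -> csum v l.
Proof.
  intros E H e He. destruct (H e He) as (N & HN). exists N. intros n Hn.
  rewrite <- (psum_ext u v n E). auto.
Qed.

Lemma csum_plus u v a b : csum u a -> csum v b -> csum (fun n => u n + v n)%C (a + b).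
Proof.
  intros Ha Hb e He.
  destruct (Ha (e / 2)) as (N1 & H1); [lra|]. destruct (Hb (e / 2)) as (N2 & H2); [lra|].
  exists (N1 + N2)%nat. intros n Hn.
  assert (E : psum (fun n => u n + v n)%C n = (psum u n + psum v n)%C).
  { clear. induction n; simpl; [ring|]. rewrite IHn. ring. }
  rewrite E. replace (psum u n + psum v n - (a + b))%C
    with ((psum u n - a) + (psum v n - b))%C by ring.
  eapply Rle_lt_trans; [apply Cmod_triangle|].
  specialize (H1 n ltac:(lia)). specialize (H2 n ltac:(lia)). lra.
Qed.

Lemma csum_scal c u a : csum u a -> csum (fun n => c * u n)%C (c * a).
Proof.
  intros Ha e He. assert (P := Cmod_ge_0 c).
  destruct (Ha (e / (Cmod c + 1))) as (N & H); [apply Rdiv_lt_0_compat; lra|].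
  exists N. intros n Hn.
  assert (E : psum (fun n => c * u n)%C n = (c * psum u n)%C).
  { clear. induction n; simpl; [ring|]. rewrite IHn. ring. }
  rewrite E. replace (c * psum u n - c * a)%C with (c * (psum u n - a))%C by ring.
  rewrite Cmod_mult. specialize (H n Hn).
  apply Rle_lt_trans with ((Cmod c + 1) * Cmod (psum u n - a)).
  - apply Rmult_le_compat_r; [apply Cmod_ge_0 | lra].
  - apply Rlt_le_trans with ((Cmod c + 1) * (e / (Cmod c + 1))).
    + apply Rmult_lt_compat_l; lra.
    + apply Req_le. field. lra.
Qed.

Lemma psum_shift u n : psum u (S n) = (u 0%nat + psum (fun k => u (S k)) n)%C.
Proof.
  induction n as [|n IH]; [simpl; ring|].
  change (psum u (S (S n))) with (psum u (S n) + u (S n))%C. rewrite IH. simpl. ring.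
Qed.

Lemma csum_tail u l : csum u l -> csum (fun n => u (S n)) (l - u 0%nat).
Proof.
  intros H e He. destruct (H e He) as (N & HN). exists N. intros n Hn.
  specialize (HN (S n) ltac:(lia)). rewrite psum_shift in HN.
  replace (psum (fun k => u (S k)) n - (l - u 0%nat))%C
    with (u 0%nat + psum (fun k => u (S k)) n - l)%C by ring. auto.
Qed.

Lemma csum_cons u l : csum (fun n => u (S n)) l -> csum u (u 0%nat + l).
Proof.
  intros H e He. destruct (H e He) as (N & HN). exists (S N). intros [|n] Hn; [lia|].
  specialize (HN n ltac:(lia)). rewrite psum_shift.
  replace (u 0%nat + psum (fun k => u (S k)) n - (u 0%nat + l))%C
    with (psum (fun k => u (S k)) n - l)%C by ring. auto.
Qed.

Lemma csum_single c : csum (fun n => match n with O => c | S _ => RtoC 0 end) c.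
Proof.
  set (u := fun n : nat => match n with O => c | S _ => RtoC 0 end).
  assert (H : csum u (u 0%nat + 0)).
  { apply csum_cons. intros e He. exists 0%nat. intros n _.
    assert (Z : psum (fun n => u (S n)) n = RtoC 0).
    { induction n; [auto|]. cbn [psum]. rewrite IHn. simpl. ring. }
    rewrite Z. replace (0 - 0)%C with (RtoC 0) by ring. rewrite Cmod_0. auto. }
  replace (u 0%nat + 0)%C with c in H by (simpl; ring). exact H.
Qed.

Lemma csum_terms_bounded u l : csum u l -> exists M, 0 < M /\ forall n, Cmod (u n) <= M.
Proof.
  intros H. apply csum_is_series in H.
  destruct (filterlim_bounded (V := C_NormedModule) (@sum_n C_AbelianMonoid u)) as (M & HM).
  { exists l. exact H. }
  assert (B : forall n, Cmod (psum u (S n)) <= M).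
  { intros n. rewrite <- sum_n_psum. apply HM. }
  assert (PM : 0 <= M) by (eapply Rle_trans; [apply Cmod_ge_0 | apply (B 0%nat)]).
  exists (2 * M + 1). split; [lra|]. intros n.
  replace (u n) with (psum u (S n) - psum u n)%C by (simpl; ring).
  eapply Rle_trans; [apply Cmod_sub_le|].
  assert (Cmod (psum u n) <= M).
  { destruct n; [simpl; rewrite Cmod_0; auto | apply B]. }
  specialize (B n). lra.
Qed.

Lemma psum_le u v n : (forall k, Cmod (u k) <= v k) -> Cmod (psum u n) <= rsum v n.
Proof.
  intros H. induction n; simpl; [rewrite Cmod_0; lra|].
  eapply Rle_trans; [apply Cmod_triangle|]. specialize (H n). lra.
Qed.

Lemma csum_norm_le u l L : csum u l -> (forall n, Cmod (psum u n) <= L) -> Cmod l <= L.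
Proof.
  intros H B. apply le_epsilon. intros e He. destruct (H e He) as (N & HN).
  specialize (HN N (le_n _)). specialize (B N). rewrite Cmod_sub_sym in HN.
  assert (T := Cmod_sub_ge l (psum u N)). lra.
Qed.

Lemma rsum_le_Series v n : (forall k, 0 <= v k) -> ex_series v -> rsum v n <= Series v.
Proof.
  intros P H. apply Rle_trans with (rsum v (S n)); [simpl; specialize (P n); lra|].
  rewrite <- sum_n_rsum.
  apply (is_lim_seq_incr_compare (sum_n v)).
  - apply (Series_correct v H).
  - intros k. rewrite sum_Sn. unfold plus; simpl. specialize (P (S k)). lra.
Qed.

Definition CSeries (u : nat -> C) : C :=
  (Series (fun n => fst (u n)), Series (fun n => snd (u n))).

Lemma csum_CSeries (u : nat -> C) (v : nat -> R) :
  (forall n, Cmod (u n) <= v n) -> ex_series v -> csum u (CSeries u).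
Proof.
  intros H Hv.
  assert (E1 : ex_series (fun n => fst (u n))).
  { apply (ex_series_le (V := R_CompleteNormedModule) _ v); auto. intros n.
    eapply Rle_trans; [apply (re_le_Cmod (u n)) | apply H]. }
  assert (E2 : ex_series (fun n => snd (u n))).
  { apply (ex_series_le (V := R_CompleteNormedModule) _ v); auto. intros n.
    eapply Rle_trans; [apply (im_le_Cmod (u n)) | apply H]. }
  apply Series_correct in E1. apply Series_correct in E2.
  intros e He. assert (He2 : 0 < e / 2) by lra.
  change (is_lim_seq (sum_n (fun n => fst (u n))) (Finite (Series (fun n => fst (u n))))) in E1.
  change (is_lim_seq (sum_n (fun n => snd (u n))) (Finite (Series (fun n => snd (u n))))) in E2.
  apply is_lim_seq_spec in E1. apply is_lim_seq_spec in E2.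
  destruct (E1 (mkposreal _ He2)) as (N1 & H1).
  destruct (E2 (mkposreal _ He2)) as (N2 & H2).
  exists (S (N1 + N2)). intros [|n] Hn; [lia|].
  specialize (H1 n ltac:(lia)). specialize (H2 n ltac:(lia)). simpl in H1, H2.
  rewrite sum_n_rsum in H1, H2.
  assert (F : forall m, psum u m = (rsum (fun n => fst (u n)) m, rsum (fun n => snd (u n)) m)).
  { clear. induction m; [reflexivity|]. simpl psum. rewrite IHm. reflexivity. }
  rewrite F. eapply Rle_lt_trans; [apply Cmod_le_re_im|].
  unfold CSeries, Re, Im, Cminus, Cplus, Copp; simpl fst; simpl snd.
  unfold Rminus in *. simpl rsum in H1, H2. lra.
Qed.

(** * Power series: differentiation and uniqueness *)

Definition has_ps (r : R) (a : nat -> C) (f : C -> C) : Prop :=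
  forall z, Cmod z < r -> csum (fun n => a n * z ^ n)%C (f z).

Lemma has_ps_ext r a f g : (forall z, Cmod z < r -> f z = g z) ->
  has_ps r a f -> has_ps r a g.
Proof. intros E H z Hz. rewrite <- E; auto. Qed.

Lemma pow_n_Cpow (z : C) n : @pow_n C_Ring z n = (z ^ n)%C.
Proof. induction n; [reflexivity|]. simpl. rewrite IHn. reflexivity. Qed.

Lemma is_pseries_csum a z l :
  @is_pseries C_AbsRing C_NormedModule a z l <-> csum (fun n => a n * z ^ n)%C l.
Proof.
  unfold is_pseries. rewrite <- csum_is_series.
  assert (E : forall n, @scal C_Ring C_ModuleSpace (@pow_n C_Ring z n) (a n) = (a n * z ^ n)%C).
  { intros n. rewrite pow_n_Cpow. change (z ^ n * a n = a n * z ^ n)%C. ring. }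
  split; apply csum_ext; intros n; [|symmetry]; apply E.
Qed.

Definition ps_derive (a : nat -> C) (n : nat) : C := (RtoC (INR (S n)) * a (S n))%C.

(** The remainder of degree N + 1 is [y] times that of degree N plus N z^(N-1) (y - z)^2. Leaving
    out the Taylor factor 1/2 makes the bound match, term by term, the second derivative of the
    series of moduli. *)
Lemma Cpow_taylor_bound (z y : C) (s : R) (n : nat) :
  Cmod z <= s -> Cmod y <= s ->
  Cmod (y ^ (S (S n)) - z ^ (S (S n)) - RtoC (INR (S (S n))) * (z ^ (S n) * (y - z)))
  <= INR (S n) * INR (S (S n)) * s ^ n * (Cmod (y - z) * Cmod (y - z)).
Proof.
  intros Hz Hy. assert (Ps : 0 <= s) by (eapply Rle_trans; [apply Cmod_ge_0 | exact Hz]).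
  assert (PD := Cmod_ge_0 (y - z)).
  assert (Pow : forall n, 0 <= s ^ n) by (intros; apply pow_le; auto).
  induction n as [|n IH].
  - simpl Cpow. simpl INR.
    replace (y * (y * 1) - z * (z * 1) - RtoC (1 + 1) * (z * 1 * (y - z)))%C
      with ((y - z) * (y - z))%C by (rewrite RtoC_plus; ring).
    rewrite Cmod_mult. simpl. nra.
  - set (N := S (S n)) in *.
    replace (y ^ S N - z ^ S N - RtoC (INR (S N)) * (z ^ N * (y - z)))%C
      with (y * (y ^ N - z ^ N - RtoC (INR N) * (z ^ S n * (y - z)))
        + RtoC (INR N) * (z ^ S n * ((y - z) * (y - z))))%C.
    2: { rewrite (S_INR N), RtoC_plus. unfold N. simpl Cpow. ring. }
    eapply Rle_trans; [apply Cmod_triangle|]. rewrite !Cmod_mult, Cmod_pow, Cmod_R.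
    rewrite (Rabs_pos_eq (INR N)) by apply pos_INR.
    set (D := Cmod (y - z) * Cmod (y - z)) in *.
    assert (PDD : 0 <= D) by (unfold D; nra).
    apply Rle_trans with (s * (INR (S n) * INR N * s ^ n * D) + INR N * (s ^ S n * D)).
    + apply Rplus_le_compat.
      * apply Rmult_le_compat; auto using Cmod_ge_0.
      * apply Rmult_le_compat_l; [apply pos_INR|]. apply Rmult_le_compat_r; auto.
        apply pow_incr. split; [apply Cmod_ge_0 | auto].
    + replace (s * (INR (S n) * INR N * s ^ n * D) + INR N * (s ^ S n * D))
        with ((INR (S n) + 1) * (INR N * s ^ S n * D)) by (simpl pow; ring).
      replace (INR N * INR (S N) * s ^ S n * D)
        with (INR (S N) * (INR N * s ^ S n * D)) by ring.
      apply Rmult_le_compat_r.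
      * apply Rmult_le_pos; auto. apply Rmult_le_pos; auto. apply pos_INR.
      * unfold N. rewrite !S_INR. lra.
Qed.

Lemma has_ps_coef_bound r a f s : has_ps r a f -> 0 < s < r ->
  exists M, 0 < M /\ forall n, Cmod (a n) * s ^ n <= M.
Proof.
  intros H Hs.
  assert (Hc : Cmod (RtoC s) < r) by (rewrite Cmod_R, Rabs_pos_eq; lra).
  destruct (csum_terms_bounded _ _ (H (RtoC s) Hc)) as (M & PM & B).
  exists M. split; auto. intros n. specialize (B n).
  rewrite Cmod_mult, Cmod_pow, Cmod_R, Rabs_pos_eq in B; lra.
Qed.

Lemma has_ps_CV_radius r a f s : has_ps r a f -> 0 <= s < r ->
  Rbar_lt (Rabs s) (CV_radius (fun n => Cmod (a n))).
Proof.
  intros H Hs. rewrite (Rabs_pos_eq s) by lra.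
  destruct (has_ps_coef_bound r a f ((s + r) / 2) H) as (M & PM & B); [lra|].
  apply Rbar_lt_le_trans with (Finite ((s + r) / 2)); [simpl; lra|].
  apply (CV_radius_bounded (fun n => Cmod (a n))).
  exists M. intros n. rewrite Rabs_pos_eq; auto.
  apply Rmult_le_pos; [apply Cmod_ge_0 | apply pow_le; lra].
Qed.

(** The remainder f y - f z - f'(z) (y - z) is summed termwise and dominated by |y - z|^2 times the
    second derivative of the series of moduli at a radius [s] strictly between |z| and [r]. *)
Lemma has_ps_derive r a f : has_ps r a f ->
  exists f', has_ps r (ps_derive a) f' /\ forall z, Cmod z < r -> cder f z (f' z).
Proof.
  intros H.
  exists (fun z => CSeries (fun n => ps_derive a n * z ^ n)%C).
  set (b := fun n => Cmod (a n)).
  assert (C1 : has_ps r (ps_derive a) (fun z => CSeries (fun n => ps_derive a n * z ^ n)%C)).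
  { intros z Hz. assert (Pz := Cmod_ge_0 z).
    apply (csum_CSeries _ (fun n => Rabs (PS_derive b n * Cmod z ^ n))).
    - intros n. unfold ps_derive, PS_derive, b. apply Req_le.
      rewrite !Cmod_mult, Cmod_R, Cmod_pow.
      rewrite Rabs_mult, Rabs_mult. rewrite (Rabs_pos_eq (Cmod (a (S n)))) by apply Cmod_ge_0.
      rewrite (Rabs_pos_eq (Cmod z ^ n)) by (apply pow_le; auto). ring.
    - apply CV_disk_inside. rewrite CV_radius_derive.
      apply (has_ps_CV_radius r a f); auto. }
  split; auto.
  intros z Hz. assert (Pz := Cmod_ge_0 z).
  set (s := (Cmod z + r) / 2).
  set (w := fun n => Rabs (PS_derive (PS_derive b) n * s ^ n)).
  assert (Ew : ex_series w).
  { apply CV_disk_inside. rewrite !CV_radius_derive.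
    apply (has_ps_CV_radius r a f); auto. unfold s; lra. }
  apply (cder_of_quadratic _ _ _ (Series w) (s - Cmod z)); [unfold s; lra|].
  intros y Hy.
  assert (Hys : Cmod y <= s).
  { assert (T := Cmod_sub_ge y z). lra. }
  assert (Hyr : Cmod y < r) by (unfold s in Hys; lra).
  set (f'z := CSeries (fun n => ps_derive a n * z ^ n)%C).
  set (D := Cmod (y - z) * Cmod (y - z)).
  assert (PD : 0 <= D) by (unfold D; assert (Q := Cmod_ge_0 (y - z)); nra).
  (* [e n] is n a_n z^(n-1): the derivative series moved up one index, so that the three series are
     combined degree by degree. *)
  set (e := fun n => match n with O => RtoC 0 | S m => (ps_derive a m * z ^ m)%C end).
  assert (Ce : csum e f'z).
  { replace f'z with (e 0%nat + f'z)%C by (simpl; ring).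
    apply csum_cons. simpl. apply C1; auto. }
  assert (S1 := csum_plus _ _ _ _ (csum_plus _ _ _ _ (H y Hyr)
     (csum_scal (- (1)) _ _ (H z Hz))) (csum_scal (- (y - z)) _ _ Ce)).
  (* The terms of degree 0 and 1 cancel in the remainder; [Cpow_taylor_bound] covers the degrees
     from 2 on. *)
  apply csum_tail, csum_tail in S1. cbv beta in S1.
  match type of S1 with csum ?u ?l => set (uu := u) in S1; set (ll := l) in S1 end.
  assert (El : ll = (f y - f z - f'z * (y - z))%C).
  { unfold ll, e, ps_derive. simpl INR. simpl Cpow. ring. }
  rewrite <- El. apply (csum_norm_le uu); auto. intros n.
  apply Rle_trans with (rsum (fun k => w k * D) n).
  - apply psum_le. intros k. unfold uu, e, ps_derive.
    replace (a (S (S k)) * y ^ S (S k) + - (1) * (a (S (S k)) * z ^ S (S k))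
       + - (y - z) * (RtoC (INR (S (S k))) * a (S (S k)) * z ^ S k))%C
     with (a (S (S k)) * (y ^ (S (S k)) - z ^ (S (S k)) - RtoC (INR (S (S k))) * (z ^ (S k) * (y - z))))%C
     by ring.
    rewrite Cmod_mult.
    eapply Rle_trans; [apply Rmult_le_compat_l; [apply Cmod_ge_0|]; apply (Cpow_taylor_bound z y s)|].
    + unfold s; lra.
    + auto.
    + fold D. apply Req_le. unfold w, PS_derive, b. rewrite Rabs_pos_eq; [ring|].
      repeat apply Rmult_le_pos; try apply pos_INR; try apply Cmod_ge_0.
      apply pow_le. unfold s; lra.
  - assert (E : forall m, rsum (fun k => w k * D) m = rsum w m * D).
    { clear. induction m; simpl; [ring|]. rewrite IHm. ring. }
    rewrite E. apply Rmult_le_compat_r; auto.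
    apply rsum_le_Series; auto. intros k. apply Rabs_pos.
Qed.

Lemma has_ps_ccont r a f z : has_ps r a f -> Cmod z < r -> ccont f z.
Proof.
  intros H Hz. destruct (has_ps_derive r a f H) as (f' & _ & D).
  eapply cder_ccont, D, Hz.
Qed.

Lemma has_ps_hol r a f : has_ps r a f -> hol (fun z => Cmod z < r) f.
Proof.
  intros H. destruct (has_ps_derive r a f H) as (f' & H1 & D). exists f'.
  intros z Hz. split; [apply D; auto | eapply has_ps_ccont; eauto].
Qed.

Lemma has_ps_at_0 r a f : 0 < r -> has_ps r a f -> f 0%C = a 0%nat.
Proof.
  intros Hr H. specialize (H 0%C). rewrite Cmod_0 in H.
  apply (csum_unique (fun n => a n * 0 ^ n)%C); auto.
  replace (a 0%nat) with ((fun n => a n * 0 ^ n)%C 0%nat + 0)%C by (simpl; ring).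
  apply csum_cons. intros e He. exists 0%nat. intros n _.
  replace (psum (fun n0 : nat => (a (S n0) * 0 ^ S n0)%C) n) with (RtoC 0).
  - replace (0 - 0)%C with (RtoC 0) by ring. rewrite Cmod_0; auto.
  - induction n; [auto|]. cbn [psum]. rewrite <- IHn. cbn [Cpow]. ring.
Qed.

(** The derivative of the zero function is again zero, and [ps_derive] lowers the index, so the
    induction runs over all sequences [a]. *)
Lemma has_ps_zero r a n : 0 < r -> has_ps r a (fun _ => RtoC 0) -> a n = RtoC 0.
Proof.
  intros Hr. revert a. induction n as [|n IH]; intros a H.
  - symmetry. apply (has_ps_at_0 r a (fun _ => RtoC 0)); auto.
  - destruct (has_ps_derive r a _ H) as (f' & H1 & D).
    assert (Z : ps_derive a n = RtoC 0).
    { apply IH. eapply has_ps_ext; [|exact H1]. intros z Hz.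
      apply (cder_unique (fun _ => RtoC 0) z); [auto | apply cder_const]. }
    unfold ps_derive in Z.
    assert (N : RtoC (INR (S n)) <> RtoC 0).
    { apply C_neq_0_of_Cmod. rewrite Cmod_R, Rabs_pos_eq; [|apply pos_INR].
      apply lt_0_INR. lia. }
    destruct (Ceq_dec (a (S n)) 0) as [E|E]; auto.
    exfalso. exact (Cmult_neq_0 _ _ N E Z).
Qed.

Lemma has_ps_unique r a b f n : 0 < r -> has_ps r a f -> has_ps r b f -> a n = b n.
Proof.
  intros Hr Ha Hb.
  assert (H : has_ps r (fun n => a n + - (1) * b n)%C (fun _ => RtoC 0)).
  { intros z Hz. specialize (Ha z Hz). specialize (Hb z Hz).
    assert (S := csum_plus _ _ _ _ Ha (csum_scal (- (1)) _ _ Hb)).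
    replace (f z + - (1) * f z)%C with (RtoC 0) in S by ring.
    eapply csum_ext; [|exact S]. intros k. simpl. ring. }
  assert (Z := has_ps_zero _ _ n Hr H). simpl in Z.
  replace (a n) with (a n + - (1) * b n + b n)%C by ring. rewrite Z. ring.
Qed.

(** With s = r / 2 the terms |a_n| s^n are bounded by some M; for |z| < s / 2 the tail is dominated
    by a geometric series of ratio 1/2, whose sum is at most 2. *)
Lemma has_ps_taylor3 r a f : 0 < r -> has_ps r a f ->
  exists K d, 0 <= K /\ 0 < d /\ d <= r /\ forall z, Cmod z < d ->
    Cmod (f z - (a 0%nat + a 1%nat * z + a 2%nat * (z * z))) <= K * Cmod z ^ 3.
Proof.
  intros Hr H.
  destruct (has_ps_coef_bound r a f (r / 2) H) as (M & PM & B); [lra|].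
  set (s := r / 2) in *. assert (Ps : 0 < s) by (unfold s; lra).
  exists (2 * M / s ^ 3), (s / 2).
  assert (Ps3 : 0 < s ^ 3) by (apply pow_lt; auto).
  split. { apply Rmult_le_pos; [lra|]. left. apply Rinv_0_lt_compat; auto. }
  split; [lra|]. split; [unfold s; lra|]. intros z Hz. assert (Pz := Cmod_ge_0 z).
  assert (Hzr : Cmod z < r) by (unfold s in Hz; lra).
  assert (S1 := H z Hzr). apply csum_tail, csum_tail, csum_tail in S1. cbv beta in S1.
  match type of S1 with csum ?u ?l => set (uu := u) in S1; set (ll := l) in S1 end.
  replace (f z - (a 0%nat + a 1%nat * z + a 2%nat * (z * z)))%C with ll
    by (unfold ll; simpl; ring).
  apply (csum_norm_le uu); auto. intros n.
  apply Rle_trans with (rsum (fun k => (M / s ^ 3 * Cmod z ^ 3) * (1 / 2) ^ k) n).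
  - apply psum_le. intros k. unfold uu. rewrite Cmod_mult, Cmod_pow.
    specialize (B (S (S (S k)))).
    assert (Q : Cmod z ^ S (S (S k)) <= Cmod z ^ 3 * ((1 / 2) ^ k * s ^ k)).
    { rewrite <- Rpow_mult_distr.
      replace (Cmod z ^ S (S (S k))) with (Cmod z ^ 3 * Cmod z ^ k) by (simpl; ring).
      apply Rmult_le_compat_l; [apply pow_le; auto|]. apply pow_incr. lra. }
    eapply Rle_trans; [apply Rmult_le_compat_l; [apply Cmod_ge_0 | exact Q]|].
    replace (Cmod (a (S (S (S k)))) * (Cmod z ^ 3 * ((1 / 2) ^ k * s ^ k)))
      with ((Cmod (a (S (S (S k)))) * s ^ S (S (S k))) * (Cmod z ^ 3 * (1 / 2) ^ k / s ^ 3))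
      by (simpl; field; lra).
    replace (M / s ^ 3 * Cmod z ^ 3 * (1 / 2) ^ k)
      with (M * (Cmod z ^ 3 * (1 / 2) ^ k / s ^ 3)) by (field; lra).
    apply Rmult_le_compat_r; auto.
    apply Rmult_le_pos; [|left; apply Rinv_0_lt_compat; auto].
    apply Rmult_le_pos; apply pow_le; lra.
  - assert (E : forall c m, rsum (fun k => c * (1 / 2) ^ k) m = c * (2 - 2 * (1 / 2) ^ m)).
    { clear. intros c. induction m; simpl; [ring|]. rewrite IHm. field. }
    rewrite E.
    assert (0 <= (1 / 2) ^ n) by (apply pow_le; lra).
    assert (0 <= M / s ^ 3 * Cmod z ^ 3).
    { apply Rmult_le_pos; [|apply pow_le; auto].
      apply Rmult_le_pos; [lra|]. left. apply Rinv_0_lt_compat; auto. }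
    replace (2 * M / s ^ 3 * Cmod z ^ 3) with (M / s ^ 3 * Cmod z ^ 3 * 2) by (field; lra).
    apply Rmult_le_compat_l; auto. lra.
Qed.

(** * Circle integrals and Taylor expansions *)

(** Paths are functions on [C] evaluated at real points, so that the rules for [ccont] and [cder]
    serve for a real parameter as well. *)
Definition pcont (G : C -> C) : Prop := forall t : R, ccont G (RtoC t).

(* The imaginary part of [z] is written [Re (- Ci * z)], so that only real
   parts are ever integrated. *)
Definition rint (G : C -> C) : R := RInt (fun t => Re (G (RtoC t))) 0 (2 * PI).

Definition cint (G : C -> C) : C := (rint G, rint (fun y => - Ci * G y)%C).

Lemma ccont_continuous (G : C -> C) (t : R) :
  ccont G (RtoC t) -> continuous (fun s => Re (G (RtoC s))) t.
Proof.
  intros H P [e He]. destruct (H e (cond_pos e)) as (d & Hd & K).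
  exists (mkposreal d Hd). intros s Hs. apply He.
  change (Rabs (Re (G (RtoC s)) - Re (G (RtoC t))) < e).
  change (Rabs (s - t) < d) in Hs.
  eapply Rle_lt_trans; [|apply (K (RtoC s))].
  - apply (re_le_Cmod (G (RtoC s) - G (RtoC t))).
  - rewrite <- RtoC_minus, Cmod_R. exact Hs.
Qed.

Lemma cder_is_derive_Re (G : C -> C) (t : R) (l : C) :
  cder G (RtoC t) l -> is_derive (fun s => Re (G (RtoC s))) t (Re l).
Proof.
  intros (q & <- & Hq & H). split; [apply is_linear_scal_l|].
  intros x Hx. apply (is_filter_lim_locally_unique (K := R_AbsRing) (V := R_NormedModule)) in Hx.
  subst x. intros e. destruct (Hq e (cond_pos e)) as (d & Hd & K).
  exists (mkposreal d Hd). intros s Hs. change (Rabs (s - t) < d) in Hs.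
  change (Rabs (Re (G (RtoC s)) - Re (G (RtoC t)) - (s - t) * Re (q (RtoC t))) <= e * Rabs (s - t)).
  assert (K' : Cmod (q (RtoC s) - q (RtoC t)) < e).
  { apply K. rewrite <- RtoC_minus, Cmod_R. exact Hs. }
  assert (E : Re (G (RtoC s)) - Re (G (RtoC t)) - (s - t) * Re (q (RtoC t))
     = Re ((q (RtoC s) - q (RtoC t)) * RtoC (s - t))).
  { rewrite (H (RtoC s)). rewrite RtoC_minus. destruct (q (RtoC s)), (q (RtoC t)), (G (RtoC t)).
    simpl. ring. }
  rewrite E. eapply Rle_trans; [apply re_le_Cmod|].
  rewrite Cmod_mult, Cmod_R. apply Rmult_le_compat_r; [apply Rabs_pos | lra].
Qed.

Lemma ex_rint G a b : pcont G -> ex_RInt (fun t => Re (G (RtoC t))) a b.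
Proof.
  intros H. apply (ex_RInt_continuous (V := R_CompleteNormedModule)).
  intros t _. apply ccont_continuous, H.
Qed.

Lemma pcont_mult F G : pcont F -> pcont G -> pcont (fun y => F y * G y)%C.
Proof. intros HF HG t. apply ccont_mult; auto. Qed.

Lemma pcont_plus F G : pcont F -> pcont G -> pcont (fun y => F y + G y)%C.
Proof. intros HF HG t. apply ccont_plus; auto. Qed.

Lemma pcont_const c : pcont (fun _ => c).
Proof. intros t. apply ccont_const. Qed.

Lemma rint_ext F G : (forall t, F (RtoC t) = G (RtoC t)) -> rint F = rint G.
Proof. intros H. apply RInt_ext. intros t _. rewrite H. auto. Qed.

Lemma cint_ext F G : (forall t, F (RtoC t) = G (RtoC t)) -> cint F = cint G.
Proof. intros H. unfold cint. f_equal; apply rint_ext; auto. intros t. rewrite H. auto. Qed.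

Lemma rint_plus F G : pcont F -> pcont G -> rint (fun y => F y + G y)%C = rint F + rint G.
Proof.
  intros HF HG. unfold rint.
  rewrite <- (RInt_plus (V := R_CompleteNormedModule)) by (apply ex_rint; auto).
  apply RInt_ext. reflexivity.
Qed.

Lemma rint_scal (c : R) G : pcont G -> rint (fun y => RtoC c * G y)%C = c * rint G.
Proof.
  intros HG. unfold rint.
  rewrite <- (RInt_scal (V := R_CompleteNormedModule)) by (apply ex_rint; auto).
  apply RInt_ext. intros t _. change (Re (RtoC c * G (RtoC t)) = c * Re (G (RtoC t))).
  destruct (G (RtoC t)). simpl. ring.
Qed.

Lemma cint_plus F G : pcont F -> pcont G -> cint (fun y => F y + G y)%C = (cint F + cint G)%C.
Proof.
  intros HF HG. unfold cint. apply injective_projections; [apply rint_plus; auto|].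
  change (rint (fun y => - Ci * (F y + G y))%C
    = rint (fun y => - Ci * F y)%C + rint (fun y => - Ci * G y)%C).
  rewrite <- rint_plus by (apply pcont_mult; auto using pcont_const).
  apply rint_ext. intros t. ring.
Qed.

Lemma cint_scal c G : pcont G -> cint (fun y => c * G y)%C = (c * cint G)%C.
Proof.
  intros HG. destruct c as [a b].
  assert (H1 : pcont (fun y => - Ci * G y)%C) by (apply pcont_mult; auto using pcont_const).
  unfold cint. apply injective_projections.
  - change (rint (fun y => (a, b) * G y)%C = a * rint G - b * rint (fun y => - Ci * G y)%C).
    replace (a * rint G - b * rint (fun y => - Ci * G y)%C)
      with (a * rint G + (- b) * rint (fun y => - Ci * G y)%C) by ring.
    rewrite <- !rint_scal, <- rint_plus by auto using pcont_mult, pcont_const.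
    apply rint_ext. intros t. destruct (G (RtoC t)). apply injective_projections; simpl; ring.
  - change (rint (fun y => - Ci * ((a, b) * G y))%C = a * rint (fun y => - Ci * G y)%C + b * rint G).
    rewrite <- !rint_scal, <- rint_plus by auto using pcont_mult, pcont_const.
    apply rint_ext. intros t. destruct (G (RtoC t)). apply injective_projections; simpl; ring.
Qed.

Lemma cint_const c : cint (fun _ => c) = (RtoC (2 * PI) * c)%C.
Proof.
  unfold cint, rint. rewrite !RInt_const. unfold scal; simpl; unfold mult; simpl.
  destruct c. apply injective_projections; simpl; ring.
Qed.

Lemma rint_derive G G' :
  (forall t : R, cder G (RtoC t) (G' (RtoC t)) /\ ccont G' (RtoC t)) ->
  rint G' = Re (G (RtoC (2 * PI))) - Re (G 0%C).
Proof.
  intros H. apply is_RInt_unique.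
  apply (is_RInt_derive (V := R_CompleteNormedModule) (fun t => Re (G (RtoC t)))).
  - intros t _. apply cder_is_derive_Re, H.
  - intros t _. apply ccont_continuous, H.
Qed.

Lemma cint_derive G G' :
  (forall t : R, cder G (RtoC t) (G' (RtoC t)) /\ ccont G' (RtoC t)) ->
  cint G' = (G (RtoC (2 * PI)) - G 0%C)%C.
Proof.
  intros H. unfold cint. rewrite (rint_derive G G' H).
  rewrite (rint_derive (fun y => - Ci * G y)%C).
  - destruct (G (RtoC (2 * PI))), (G 0%C). apply injective_projections; simpl; ring.
  - intros t. destruct (H t) as [D K]. split.
    + replace (- Ci * G' (RtoC t))%C with (0 * G (RtoC t) + - Ci * G' (RtoC t))%C by ring.
      apply (cder_mult (fun _ => - Ci)%C); auto. apply cder_const.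
    + apply ccont_mult; auto using ccont_const.
Qed.

Lemma rint_norm_le G M : pcont G -> (forall t, 0 <= t <= 2 * PI -> Cmod (G (RtoC t)) <= M) ->
  Rabs (rint G) <= 2 * PI * M.
Proof.
  intros HG B. assert (PP := PI_RGT_0).
  replace (2 * PI * M) with ((2 * PI - 0) * M) by ring.
  apply abs_RInt_le_const; [lra | apply ex_rint; auto|].
  intros t Ht. eapply Rle_trans; [apply re_le_Cmod | auto].
Qed.

(** Real and imaginary parts are bounded separately, hence 4 pi instead of the optimal 2 pi; the
    bound serves only to show that a remainder tends to 0. *)
Lemma cint_norm_le G M : pcont G -> (forall t, 0 <= t <= 2 * PI -> Cmod (G (RtoC t)) <= M) ->
  Cmod (cint G) <= 4 * PI * M.
Proof.
  intros HG B. eapply Rle_trans; [apply Cmod_le_re_im|]. unfold cint; simpl.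
  assert (H1 := rint_norm_le G M HG B).
  assert (H2 : Rabs (rint (fun y => - Ci * G y)%C) <= 2 * PI * M).
  { apply rint_norm_le; [apply pcont_mult; auto using pcont_const|].
    intros t Ht. rewrite Cmod_mult, Cmod_opp, Cmod_Ci, Rmult_1_l. auto. }
  lra.
Qed.

Definition circ (r : R) (y : C) : C := (RtoC r * Cexp (Ci * y))%C.

Lemma cder_circ r y : cder (circ r) y (Ci * circ r y).
Proof.
  unfold circ.
  replace (Ci * (RtoC r * Cexp (Ci * y)))%C
    with (0 * Cexp (Ci * y) + RtoC r * (Cexp (Ci * y) * (0 * y + Ci * 1)))%C by ring.
  apply (cder_mult (fun _ => RtoC r) (fun y => Cexp (Ci * y)%C)); [apply cder_const|].
  apply (cder_comp (fun y => Ci * y)%C Cexp); [|apply cder_Cexp].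
  apply (cder_mult (fun _ => Ci) (fun y => y)); [apply cder_const | apply cder_id].
Qed.

Lemma ccont_circ r y : ccont (circ r) y.
Proof. eapply cder_ccont, cder_circ. Qed.

Lemma pcont_circ r : pcont (circ r).
Proof. intros t. apply ccont_circ. Qed.

Lemma Cmod_circ r t : 0 <= r -> Cmod (circ r (RtoC t)) = r.
Proof.
  intros Hr. unfold circ. rewrite Cmod_mult, Cmod_R, Cmod_Cexp, Rabs_pos_eq by auto.
  simpl. replace (0 * t - 1 * 0) with 0 by ring. rewrite exp_0. ring.
Qed.

Lemma circ_neq_0 r t : 0 < r -> circ r (RtoC t) <> 0%C.
Proof. intros H. apply C_neq_0_of_Cmod. rewrite Cmod_circ; lra. Qed.

Lemma circ_periodic r : circ r (RtoC (2 * PI)) = circ r 0%C.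
Proof.
  unfold circ, Cexp; simpl.
  replace (0 * 0 + 1 * (2 * PI)) with (2 * PI) by ring.
  replace (0 * (2 * PI) - 1 * 0) with 0 by ring.
  replace (0 * 0 - 1 * 0) with 0 by ring. replace (0 * 0 + 1 * 0) with 0 by ring.
  rewrite cos_2PI, sin_2PI, cos_0, sin_0. reflexivity.
Qed.

Lemma circ_sub_neq_0 r z t : Cmod z < r -> (circ r (RtoC t) - z)%C <> 0%C.
Proof.
  intros H. assert (P := Cmod_ge_0 z). apply C_neq_0_of_Cmod.
  assert (T := Cmod_sub_ge (circ r (RtoC t)) z). rewrite Cmod_circ in T; lra.
Qed.

(** * Joint continuity in the homotopy parameter and the angle *)

Definition jcont (H : R -> R -> C) (s t : R) : Prop :=
  forall e, 0 < e -> exists d, 0 < d /\ forall s' t', Rabs (s' - s) < d -> Rabs (t' - t) < d ->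
    Cmod (H s' t' - H s t) < e.

Lemma jcont_fst (G : C -> C) s t : ccont G (RtoC s) -> jcont (fun s' _ => G (RtoC s')) s t.
Proof.
  intros H e He. destruct (H e He) as (d & Hd & K). exists d. split; auto.
  intros s' t' Hs _. apply K. rewrite <- RtoC_minus, Cmod_R. auto.
Qed.

Lemma jcont_snd (G : C -> C) s t : ccont G (RtoC t) -> jcont (fun _ t' => G (RtoC t')) s t.
Proof.
  intros H e He. destruct (H e He) as (d & Hd & K). exists d. split; auto.
  intros s' t' _ Ht. apply K. rewrite <- RtoC_minus, Cmod_R. auto.
Qed.

Lemma jcont_comp (G : C -> C) H s t :
  ccont G (H s t) -> jcont H s t -> jcont (fun s' t' => G (H s' t')) s t.
Proof.
  intros HG HH e He. destruct (HG e He) as (d & Hd & K).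
  destruct (HH d Hd) as (d' & Hd' & K'). exists d'. auto.
Qed.

Lemma jcont_plus H K s t : jcont H s t -> jcont K s t -> jcont (fun s' t' => H s' t' + K s' t')%C s t.
Proof.
  intros H1 H2 e He.
  destruct (H1 (e / 2)) as (d1 & Hd1 & B1); [lra|].
  destruct (H2 (e / 2)) as (d2 & Hd2 & B2); [lra|].
  exists (Rmin d1 d2). split; [apply Rmin_pos; auto|]. intros s' t' Hs Ht.
  assert (M1 := Rmin_l d1 d2). assert (M2 := Rmin_r d1 d2).
  specialize (B1 s' t' ltac:(lra) ltac:(lra)). specialize (B2 s' t' ltac:(lra) ltac:(lra)).
  replace (H s' t' + K s' t' - (H s t + K s t))%C
    with ((H s' t' - H s t) + (K s' t' - K s t))%C by ring.
  eapply Rle_lt_trans; [apply Cmod_triangle|]. lra.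
Qed.

Lemma jcont_mult H K s t : jcont H s t -> jcont K s t -> jcont (fun s' t' => H s' t' * K s' t')%C s t.
Proof.
  (* polarization: [4 h k = (h + k) ^ 2 - (h - k) ^ 2] *)
  intros H1 H2.
  assert (Sq : forall L, jcont L s t -> jcont (fun s' t' => L s' t' * L s' t')%C s t).
  { intros L HL. apply (jcont_comp (fun w => w * w)%C L); auto.
    apply ccont_mult; apply ccont_id. }
  assert (Sc : forall c L, jcont L s t -> jcont (fun s' t' => c * L s' t')%C s t).
  { intros c L HL. apply (jcont_comp (fun w => c * w)%C L); auto.
    apply ccont_mult; [apply ccont_const | apply ccont_id]. }
  assert (A := jcont_plus _ _ _ _ (Sc (/ 4)%C _ (Sq _ (jcont_plus _ _ _ _ H1 H2)))
    (Sc (- / 4)%C _ (Sq _ (jcont_plus _ _ _ _ H1 (Sc (- (1))%C _ H2))))).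
  assert (E : forall h k : C, (h * k = / 4 * ((h + k) * (h + k)) + - / 4 * ((h + - (1) * k) * (h + - (1) * k)))%C).
  { intros h k. field. }
  intros e He. destruct (A e He) as (d & Hd & B). exists d. split; auto.
  intros s' t' Hs Ht. specialize (B s' t' Hs Ht). cbv beta in B. rewrite <- !E in B. exact B.
Qed.

(** * Cauchy's formula on a circle *)

Section Cauchy.

Variables (R0 r : R) (F F' : C -> C) (z : C).
Hypothesis HF : forall w, Cmod w < R0 -> cder F w (F' w) /\ ccont F' w.
Hypothesis Hr : r < R0.
Hypothesis Hz : Cmod z < r.

(** Linear homotopy from the constant [z] at s = 0 to the circle at s = 1. The kernel [ker] that
    follows is dzeta / (i (zeta - z)) written in the angle. *)
Let pt (s : C) (y : C) : C := (z + s * (circ r y - z))%C.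
Let ker (y : C) : C := (circ r y * / (circ r y - z))%C.

Lemma r_pos : 0 < r.
Proof. eapply Rle_lt_trans; [apply Cmod_ge_0 | apply Hz]. Qed.

(** Margin by which the homotopy parameter may leave [0, 1] while [pt] stays in the disc of radius
    [R0]; two-sided derivatives then exist at both ends. *)
Let eta : R := (R0 - r) / (2 * r).

Lemma eta_pos : 0 < eta.
Proof. assert (P := r_pos). apply Rdiv_lt_0_compat; lra. Qed.

Lemma pt_in_disc s t : - eta < s < 1 + eta -> Cmod (pt (RtoC s) (RtoC t)) < R0.
Proof.
  intros Hs. assert (P := r_pos). assert (Pz := Cmod_ge_0 z). assert (Pe := eta_pos).
  unfold pt. replace (z + RtoC s * (circ r (RtoC t) - z))%C
    with (RtoC (1 - s) * z + RtoC s * circ r (RtoC t))%C by (rewrite RtoC_minus; ring).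
  eapply Rle_lt_trans; [apply Cmod_triangle|].
  rewrite !Cmod_mult, !Cmod_R, Cmod_circ by lra.
  assert (E : 2 * (eta * r) = R0 - r) by (unfold eta; field; lra).
  assert (A1 := Rabs_pos (1 - s)). assert (A2 := Rabs_pos s).
  apply Rle_lt_trans with ((Rabs (1 - s) + Rabs s) * r).
  { rewrite Rmult_plus_distr_r. apply Rplus_le_compat_r, Rmult_le_compat_l; lra. }
  assert (Rabs (1 - s) + Rabs s < 1 + 2 * eta).
  { unfold Rabs. destruct (Rcase_abs (1 - s)), (Rcase_abs s); lra. }
  apply Rlt_le_trans with ((1 + 2 * eta) * r); [apply Rmult_lt_compat_r; auto|]. lra.
Qed.

Lemma cder_pt_l y s : cder (fun s => pt s y) s (circ r y - z).
Proof.
  apply (cder_eq _ _ (0 + (1 * (circ r y - z) + s * 0))); [|ring].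
  apply (cder_plus (fun _ => z) (fun s => s * (circ r y - z))%C); [apply cder_const|].
  apply (cder_mult (fun s => s) (fun _ => (circ r y - z)%C)); [apply cder_id | apply cder_const].
Qed.

Lemma cder_pt_r s y : cder (fun y => pt s y) y (s * (Ci * circ r y)).
Proof.
  apply (cder_eq _ _ (0 + (0 * (circ r y + - z) + s * (Ci * circ r y + 0)))); [|ring].
  apply (cder_plus (fun _ => z) (fun y => s * (circ r y - z))%C); [apply cder_const|].
  apply (cder_mult (fun _ => s) (fun y => (circ r y - z)%C)); [apply cder_const|].
  apply (cder_plus (circ r) (fun _ => - z)%C); [apply cder_circ | apply cder_const].
Qed.

Lemma pcont_ker : pcont ker.
Proof.
  intros t. apply ccont_mult; [apply ccont_circ|]. apply ccont_inv; [apply circ_sub_neq_0, Hz|].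
  apply (ccont_plus (circ r) (fun _ => - z)%C); [apply ccont_circ | apply ccont_const].
Qed.

(** The chain rule in [s] produces the factor zeta - z, which cancels the denominator of [ker]. The
    constant [c] lets one statement treat the real part (c = 1) and the imaginary part (c = - i). *)
Lemma is_derive_rint_pt (c : C) s : - eta < s < 1 + eta ->
  is_derive (fun s => rint (fun y => c * (F (pt (RtoC s) y) * ker y))%C) s
    (rint (fun y => c * (F' (pt (RtoC s) y) * circ r y))%C).
Proof.
  intros Hs. assert (Pe := eta_pos).
  set (f := fun s t : R => Re (c * (F (pt (RtoC s) (RtoC t)) * ker (RtoC t)))).
  assert (D : forall s t, - eta < s < 1 + eta ->
    is_derive (fun s => f s t) s (Re (c * (F' (pt (RtoC s) (RtoC t)) * circ r (RtoC t))))).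
  { intros s' t Hs'.
    apply (cder_is_derive_Re (fun s => c * (F (pt s (RtoC t)) * ker (RtoC t)))%C).
    apply (cder_eq _ _ (0 * (F (pt (RtoC s') (RtoC t)) * ker (RtoC t)) +
        c * ((F' (pt (RtoC s') (RtoC t)) * (circ r (RtoC t) - z)) * ker (RtoC t)
         + F (pt (RtoC s') (RtoC t)) * 0))).
    2: { unfold ker. field. apply circ_sub_neq_0, Hz. }
    apply (cder_mult (fun _ => c) (fun s => F (pt s (RtoC t)) * ker (RtoC t))%C);
      [apply cder_const|].
    apply (cder_mult (fun s => F (pt s (RtoC t))) (fun _ => ker (RtoC t))); [|apply cder_const].
    apply (cder_comp (fun s => pt s (RtoC t)) F); [apply cder_pt_l|].
    apply HF, pt_in_disc, Hs'. }
  set (d := Rmin (s + eta) (1 + eta - s)).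
  assert (Pd : 0 < d) by (apply Rmin_pos; lra).
  assert (Near : forall u, Rabs (u - s) < d -> - eta < u < 1 + eta).
  { intros u Hu. apply Rabs_lt_between in Hu.
    assert (M1 := Rmin_l (s + eta) (1 + eta - s)). assert (M2 := Rmin_r (s + eta) (1 + eta - s)).
    fold d in M1, M2. lra. }
  replace (rint (fun y => c * (F' (pt (RtoC s) y) * circ r y))%C)
    with (RInt (fun t => Derive (fun u => f u t) s) 0 (2 * PI)).
  2: { apply RInt_ext. intros t _. apply is_derive_unique, D, Hs. }
  apply (is_derive_RInt_param f 0 (2 * PI) s).
  - exists (mkposreal d Pd). intros u Hu t _. eexists. apply D, Near, Hu.
  - intros t _.
    apply (continuity_2d_pt_ext_loc
      (fun u v => Re (c * (F' (pt (RtoC u) (RtoC v)) * circ r (RtoC v))))).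
    + exists (mkposreal d Pd). intros u v Hu _. symmetry. apply is_derive_unique, D, Near, Hu.
    + assert (J : jcont (fun u v => c * (F' (pt (RtoC u) (RtoC v)) * circ r (RtoC v)))%C s t).
      { apply jcont_mult; [apply (jcont_fst (fun _ => c)), ccont_const|].
        apply jcont_mult; [|apply jcont_snd, ccont_circ].
        apply (jcont_comp F' (fun u v => pt (RtoC u) (RtoC v))); [apply HF, pt_in_disc, Hs|].
        unfold pt. apply jcont_plus; [apply (jcont_fst (fun _ => z)), ccont_const|].
        apply jcont_mult; [apply (jcont_fst (fun s => s)), ccont_id|].
        apply (jcont_plus (fun _ v => circ r (RtoC v)) (fun _ _ => - z)%C);
          [apply jcont_snd, ccont_circ | apply (jcont_fst (fun _ => - z)%C), ccont_const]. }
      intros e. destruct (J e (cond_pos e)) as (d' & Hd' & B).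
      exists (mkposreal d' Hd'). intros u v Hu Hv.
      eapply Rle_lt_trans; [|apply (B u v Hu Hv)].
      match goal with |- Rabs (Re ?a - Re ?b) <= _ => apply (re_le_Cmod (a - b)) end.
  - exists (mkposreal d Pd). intros u Hu.
    apply (ex_rint (fun y => c * (F (pt (RtoC u) y) * ker y))%C).
    apply pcont_mult; [apply pcont_const|]. apply pcont_mult; [|apply pcont_ker].
    intros t. apply (ccont_comp (fun y => pt (RtoC u) y) F).
    + eapply cder_ccont, cder_pt_r.
    + eapply cder_ccont, HF, pt_in_disc, Near, Hu.
Qed.

Lemma pcont_F'_pt s : - eta < s < 1 + eta -> pcont (fun y => F' (pt (RtoC s) y) * circ r y)%C.
Proof.
  intros Hs. apply pcont_mult; [|apply pcont_circ]. intros t.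
  apply (ccont_comp (fun y => pt (RtoC s) y) F').
  - eapply cder_ccont, cder_pt_r.
  - apply HF, pt_in_disc, Hs.
Qed.

(** For s <> 0 the integrand is, up to the factor i s, the derivative in the angle of the periodic
    function F (pt s y). For s = 0 it is a constant times [circ r], itself the derivative of a
    periodic function up to a factor. *)
Lemma cint_derive_pt_0 s : - eta < s < 1 + eta ->
  cint (fun y => F' (pt (RtoC s) y) * circ r y)%C = RtoC 0.
Proof.
  intros Hs.
  destruct (Req_dec s 0) as [->|Ns].
  - rewrite (cint_ext _ (fun y => (F' z * - Ci) * (Ci * circ r y)))%C.
    2: { intros t. unfold pt. replace (z + 0 * (circ r (RtoC t) - z))%C with z by ring.
         transitivity (F' z * circ r (RtoC t) * - (Ci * Ci))%C; [|ring].
         replace (Ci * Ci)%C with (- (1))%C by (apply injective_projections; simpl; ring). ring. }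
    rewrite cint_scal by (apply pcont_mult; [apply pcont_const | apply pcont_circ]).
    rewrite (cint_derive (circ r)).
    + rewrite circ_periodic. ring.
    + intros t. split; [apply cder_circ|]. apply ccont_mult; [apply ccont_const | apply ccont_circ].
  - assert (N : RtoC s <> 0%C) by (intros E; apply (f_equal fst) in E; simpl in E; lra).
    rewrite (cint_ext _ (fun y => (- Ci / RtoC s) * (F' (pt (RtoC s) y) * (RtoC s * (Ci * circ r y))))%C).
    2: { intros t. transitivity (F' (pt (RtoC s) (RtoC t)) * circ r (RtoC t) * - (Ci * Ci))%C.
         - replace (Ci * Ci)%C with (- (1))%C by (apply injective_projections; simpl; ring). ring.
         - field. auto. }
    assert (D : forall t : R,
       cder (fun y => F (pt (RtoC s) y)) (RtoC t)
         (F' (pt (RtoC s) (RtoC t)) * (RtoC s * (Ci * circ r (RtoC t)))) /\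
       ccont (fun y => F' (pt (RtoC s) y) * (RtoC s * (Ci * circ r y)))%C (RtoC t)).
    { intros t. split.
      - apply (cder_comp (fun y => pt (RtoC s) y) F); [apply cder_pt_r|]. apply HF, pt_in_disc, Hs.
      - apply ccont_mult.
        + apply (ccont_comp (fun y => pt (RtoC s) y) F').
          * eapply cder_ccont, cder_pt_r.
          * apply HF, pt_in_disc, Hs.
        + apply ccont_mult; [apply ccont_const|].
          apply ccont_mult; [apply ccont_const | apply ccont_circ]. }
    rewrite cint_scal by (intros t; apply D).
    rewrite (cint_derive _ _ D). unfold pt. rewrite circ_periodic. ring.
Qed.

(** The integral of F (pt s y) times [ker] has zero derivative in [s], so its values at s = 1 and s
    = 0 agree. The total mass of the kernel is evaluated separately in [cint_ker]. *)
Lemma cauchy_formula :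
  cint (fun y => F (circ r y) * ker y)%C = (F z * cint ker)%C.
Proof.
  assert (Pe := eta_pos).
  assert (Step : forall c : C,
    rint (fun y => c * (F (pt (RtoC 1) y) * ker y))%C = rint (fun y => c * (F (pt (RtoC 0) y) * ker y))%C).
  { intros c.
    destruct (MVT_gen (fun s => rint (fun y => c * (F (pt (RtoC s) y) * ker y))%C) 0 1 (fun _ => 0))
      as (x & _ & E).
    - intros s Hs. rewrite Rmin_left, Rmax_right in Hs by lra.
      replace 0 with (rint (fun y => c * (F' (pt (RtoC s) y) * circ r y))%C).
      + apply is_derive_rint_pt. lra.
      + assert (B : - eta < s < 1 + eta) by lra.
        change (fst (cint (fun y => c * (F' (pt (RtoC s) y) * circ r y))%C) = 0).
        rewrite cint_scal by (apply pcont_F'_pt; auto). rewrite cint_derive_pt_0 by auto.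
        simpl. ring.
    - intros s Hs. rewrite Rmin_left, Rmax_right in Hs by lra.
      apply continuity_pt_filterlim. apply (ex_derive_continuous (V := R_NormedModule)).
      eexists. apply is_derive_rint_pt. lra.
    - lra. }
  assert (E : forall c : C, rint (fun y => c * (F (circ r y) * ker y))%C
    = rint (fun y => c * (F z * ker y))%C).
  { intros c. transitivity (rint (fun y => c * (F (pt (RtoC 1) y) * ker y))%C).
    - apply rint_ext. intros t. unfold pt.
      replace (z + 1 * (circ r (RtoC t) - z))%C with (circ r (RtoC t)) by ring. auto.
    - rewrite Step. apply rint_ext. intros t. unfold pt.
      replace (z + 0 * (circ r (RtoC t) - z))%C with z by ring. auto. }
  rewrite <- cint_scal by apply pcont_ker. unfold cint. f_equal; [|apply E].
  transitivity (rint (fun y => RtoC 1 * (F (circ r y) * ker y))%C).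
  - apply rint_ext. intros t. ring.
  - rewrite E. apply rint_ext. intros t. ring.
Qed.

(** From ker = 1 + (z / zeta) ker, n iterations give the partial sum of the geometric expansion with
    exact remainder (z / zeta)^n ker, which is O((|z| / r)^n) uniformly on the circle. *)
Lemma csum_cauchy_kernel (G : C -> C) : pcont G ->
  csum (fun n => cint (fun y => G y * (/ circ r y) ^ n)%C * z ^ n)%C
    (cint (fun y => G y * ker y)%C).
Proof.
  intros HG. assert (P := r_pos). assert (Pz := Cmod_ge_0 z). assert (PP := PI_RGT_0).
  assert (Hi : pcont (fun y => / circ r y)%C).
  { intros t. apply ccont_inv; [apply circ_neq_0, P | apply ccont_circ]. }
  assert (Hp : forall n, pcont (fun y => (/ circ r y) ^ n)%C).
  { induction n; simpl; [apply pcont_const | apply pcont_mult; auto]. }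
  assert (Hk := pcont_ker).
  assert (E : forall n, cint (fun y => G y * ker y)%C =
    (psum (fun n => cint (fun y => G y * (/ circ r y) ^ n)%C * z ^ n)%C n
      + z ^ n * cint (fun y => (G y * ker y) * (/ circ r y) ^ n)%C)%C).
  { induction n as [|n IH].
    - simpl. rewrite (cint_ext (fun y => G y * ker y * 1)%C (fun y => G y * ker y)%C); [ring|].
      intros; ring.
    - rewrite IH at 1. simpl psum.
      rewrite (cint_ext (fun y => (G y * ker y) * (/ circ r y) ^ n)%C
        (fun y => G y * (/ circ r y) ^ n + z * ((G y * ker y) * (/ circ r y) ^ S n))%C).
      + rewrite cint_plus, cint_scal by auto 10 using pcont_mult, pcont_const. simpl. ring.
      + intros t. unfold ker. simpl. field. split; [apply circ_neq_0, P | apply circ_sub_neq_0, Hz]. }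
  destruct (bounded_continuity (V := R_NormedModule) (fun t => Cmod (G (RtoC t))) 0 (2 * PI)) as (M & HM).
  { intros t _. apply (ccont_continuous (fun y => RtoC (Cmod (G y)))).
    apply (ccont_comp G (fun w => RtoC (Cmod w))); [apply HG | apply ccont_Cmod]. }
  assert (HM' : forall t, 0 <= t <= 2 * PI -> Cmod (G (RtoC t)) <= M).
  { intros t Ht. left. eapply Rle_lt_trans; [|apply (HM t Ht)]. apply Rle_abs. }
  assert (PM : 0 <= M) by (eapply Rle_trans; [apply Cmod_ge_0 | apply (HM' 0); lra]).
  set (B := 4 * PI * (M * (r / (r - Cmod z)))).
  assert (PB : 0 <= B).
  { assert (PI0 : 0 < / (r - Cmod z)) by (apply Rinv_0_lt_compat; lra).
    unfold B, Rdiv. apply Rmult_le_pos; [lra|].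
    apply Rmult_le_pos; [auto|]. apply Rmult_le_pos; lra. }
  assert (Q : 0 <= Cmod z / r < 1).
  { split; [apply Rmult_le_pos; [auto | left; apply Rinv_0_lt_compat; auto]|].
    apply (Rmult_lt_reg_r r); auto. unfold Rdiv. rewrite Rmult_assoc, Rinv_l; lra. }
  intros e He.
  destruct (pow_lt_1_zero (Cmod z / r)) with (y := e / (B + 1)) as (N & HN).
  { rewrite Rabs_pos_eq; lra. }
  { apply Rdiv_lt_0_compat; lra. }
  exists N. intros n Hn. specialize (HN n Hn).
  rewrite (E n), Cmod_sub_sym.
  match goal with |- Cmod (?a + ?b - ?a) < _ => replace (a + b - a)%C with b by ring end.
  rewrite Cmod_mult, Cmod_pow.
  assert (Hb : Cmod (cint (fun y => (G y * ker y) * (/ circ r y) ^ n)%C)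
    <= 4 * PI * (M * (r / (r - Cmod z)) * (/ r) ^ n)).
  { apply cint_norm_le; [auto using pcont_mult|]. intros t Ht.
    rewrite !Cmod_mult, Cmod_pow, Cmod_inv, Cmod_circ by (try apply circ_neq_0; lra).
    apply Rmult_le_compat_r; [apply pow_le; left; apply Rinv_0_lt_compat; auto|].
    apply Rmult_le_compat; auto using Cmod_ge_0.
    unfold ker. rewrite Cmod_mult, Cmod_inv, Cmod_circ by (try apply circ_sub_neq_0; lra).
    apply Rmult_le_compat_l; [lra|]. apply Rinv_le_contravar; [lra|].
    assert (T := Cmod_sub_ge (circ r (RtoC t)) z). rewrite Cmod_circ in T; lra. }
  apply Rle_lt_trans with (Cmod z ^ n * (4 * PI * (M * (r / (r - Cmod z)) * (/ r) ^ n))).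
  { apply Rmult_le_compat_l; auto. apply pow_le; auto. }
  replace (Cmod z ^ n * (4 * PI * (M * (r / (r - Cmod z)) * (/ r) ^ n)))
    with (B * (Cmod z / r) ^ n) by (unfold B, Rdiv; rewrite Rpow_mult_distr; ring).
  rewrite Rabs_pos_eq in HN by (apply pow_le; lra).
  apply Rle_lt_trans with ((B + 1) * (Cmod z / r) ^ n).
  { apply Rmult_le_compat_r; [apply pow_le; lra | lra]. }
  apply Rlt_le_trans with ((B + 1) * (e / (B + 1))).
  { apply Rmult_lt_compat_l; lra. }
  apply Req_le. field. lra.
Qed.

(** The expansion of [csum_cauchy_kernel] with G = 1: each negative power of zeta is the derivative
    of a periodic function up to a factor, so only the constant term survives. *)
Lemma cint_ker : cint ker = RtoC (2 * PI).
Proof.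
  assert (P := r_pos).
  assert (H := csum_cauchy_kernel (fun _ => RtoC 1) (pcont_const _)).
  rewrite (cint_ext _ ker) in H by (intros; ring).
  apply (csum_unique _ _ _ H).
  apply (csum_ext (fun n => match n with O => RtoC (2 * PI) | S _ => RtoC 0 end)).
  - intros [|n].
    + simpl. rewrite (cint_ext _ (fun _ => RtoC 1)) by (intros; ring).
      rewrite cint_const. ring.
    + assert (N : RtoC (INR (S n)) <> 0%C).
      { intros E. apply (f_equal fst) in E. revert E. apply not_0_INR. lia. }
      rewrite (cint_ext _ (fun y => (Ci / RtoC (INR (S n))) * ((RtoC (INR (S n)) * (- Ci)) * (/ circ r y) ^ S n))%C).
      2: { intros t. transitivity ((/ circ r (RtoC t)) ^ S n * - (Ci * Ci))%C.
           - replace (Ci * Ci)%C with (- (1))%C by (apply injective_projections; simpl; ring). ring.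
           - field. auto. }
      assert (D : forall t : R,
        cder (fun y => (/ circ r y) ^ S n)%C (RtoC t)
          (RtoC (INR (S n)) * (- Ci) * (/ circ r (RtoC t)) ^ S n) /\
        ccont (fun y => RtoC (INR (S n)) * (- Ci) * (/ circ r y) ^ S n)%C (RtoC t)).
      { intros t. assert (Nc := circ_neq_0 r t P).
        assert (D1 : forall k, cder (fun y => (/ circ r y) ^ k)%C (RtoC t)
          (RtoC (INR k) * (- Ci) * (/ circ r (RtoC t)) ^ k)).
        { induction k as [|k IH].
          - simpl Cpow. simpl INR. replace (0 * - Ci * 1)%C with (RtoC 0) by ring. apply cder_const.
          - simpl Cpow.
            replace (RtoC (INR (S k)) * - Ci * (/ circ r (RtoC t) * (/ circ r (RtoC t)) ^ k))%C
              with ((- (Ci * circ r (RtoC t)) / (circ r (RtoC t) * circ r (RtoC t))) * (/ circ r (RtoC t)) ^ k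
               + / circ r (RtoC t) * (RtoC (INR k) * (- Ci) * (/ circ r (RtoC t)) ^ k))%C.
            2: { rewrite S_INR, RtoC_plus. field. auto. }
            apply (cder_mult (fun y => / circ r y)%C (fun y => (/ circ r y) ^ k)%C); auto.
            apply cder_inv; auto. apply cder_circ. }
        split; [apply D1|]. apply ccont_mult; [apply ccont_const|].
        eapply cder_ccont, D1. }
      rewrite cint_scal by (intros t; apply D).
      rewrite (cint_derive _ _ D), circ_periodic. ring.
  - apply csum_single.
Qed.

End Cauchy.

Definition circ_coef (r : R) (F : C -> C) (n : nat) : C :=
  (cint (fun y => F (circ r y) * (/ circ r y) ^ n) / RtoC (2 * PI))%C.

Lemma two_PI_neq_0 : RtoC (2 * PI) <> 0%C.
Proof. intros E. apply (f_equal fst) in E. simpl in E. generalize PI_RGT_0. lra. Qed.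

Lemma hol_has_ps_circ (R0 r : R) F : 0 < r < R0 -> hol (fun z => Cmod z < R0) F ->
  has_ps r (circ_coef r F) F.
Proof.
  intros Hr (F' & HF) z Hz.
  assert (N := two_PI_neq_0).
  assert (HG : pcont (fun y => F (circ r y))).
  { intros t. apply (ccont_comp (circ r) F); [apply ccont_circ|].
    eapply cder_ccont, HF. rewrite Cmod_circ; lra. }
  assert (S := csum_cauchy_kernel r z Hz _ HG). cbv beta in S.
  rewrite (cauchy_formula R0 r F F' z HF (proj2 Hr) Hz), (cint_ker r z Hz) in S.
  apply (csum_scal (/ RtoC (2 * PI))) in S.
  replace (/ RtoC (2 * PI) * (F z * RtoC (2 * PI)))%C with (F z) in S by (field; auto).
  eapply csum_ext; [|exact S]. intros n. unfold circ_coef, Cdiv. ring.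
Qed.

(** Coefficients computed on two circles agree by uniqueness on the smaller disc, so one sequence
    serves the whole disc. The integral formula on every circle is kept in the conclusion for the
    estimate of [schwarz_coef_circ]. *)
Lemma hol_has_ps (R0 : R) F : 0 < R0 -> hol (fun z => Cmod z < R0) F ->
  exists a, has_ps R0 a F /\ forall r n, 0 < r < R0 -> circ_coef r F n = a n.
Proof.
  intros HR HF. exists (circ_coef (R0 / 2) F).
  assert (U : forall r n, 0 < r < R0 -> circ_coef r F n = circ_coef (R0 / 2) F n).
  { intros r n Hr. assert (M1 := Rmin_l r (R0 / 2)). assert (M2 := Rmin_r r (R0 / 2)).
    apply (has_ps_unique (Rmin r (R0 / 2)) _ _ F).
    - apply Rmin_pos; lra.
    - intros z Hz. apply (hol_has_ps_circ R0); auto. lra.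
    - intros z Hz. apply (hol_has_ps_circ R0); auto; lra. }
  split; auto. intros z Hz. assert (Pz := Cmod_ge_0 z).
  eapply csum_ext; [|apply (hol_has_ps_circ R0 ((Cmod z + R0) / 2) F); auto; lra].
  intros n. simpl. rewrite U; auto. lra.
Qed.

(** * Second order expansions at the origin *)

(* The bounds ignore the value at 0, where quotients such as [g z / z] are junk. *)
Definition bigO (k : nat) (h : C -> C) : Prop :=
  exists K d, 0 <= K /\ 0 < d /\
    forall z : C, z <> 0%C -> Cmod z < d -> Cmod (h z) <= K * Cmod z ^ k.

Lemma bigO_ext (k : nat) (h g : C -> C) (d : R) : 0 < d -> (forall z : C, z <> 0%C -> Cmod z < d -> h z = g z) ->
  bigO k h -> bigO k g.
Proof.
  intros Hd E (K & e & PK & Pe & H). exists K, (Rmin d e).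
  split; auto. split; [apply Rmin_pos; auto|]. intros z Nz Hz.
  rewrite <- E; [apply H|..]; auto; eapply Rlt_le_trans; try exact Hz; [apply Rmin_r | apply Rmin_l].
Qed.

Lemma bigO_plus k (h g : C -> C) : bigO k h -> bigO k g -> bigO k (fun z => h z + g z)%C.
Proof.
  intros (K & d & PK & Pd & H) (L & e & PL & Pe & G). exists (K + L), (Rmin d e).
  split; [lra|]. split; [apply Rmin_pos; auto|]. intros z Nz Hz.
  eapply Rle_trans; [apply Cmod_triangle|]. rewrite Rmult_plus_distr_r.
  apply Rplus_le_compat; [apply H | apply G]; auto;
    eapply Rlt_le_trans; try exact Hz; [apply Rmin_l | apply Rmin_r].
Qed.

Lemma bigO_mult k l (h g : C -> C) : bigO k h -> bigO l g -> bigO (k + l) (fun z => h z * g z)%C.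
Proof.
  intros (K & d & PK & Pd & H) (L & e & PL & Pe & G). exists (K * L), (Rmin d e).
  split; [apply Rmult_le_pos; auto|]. split; [apply Rmin_pos; auto|]. intros z Nz Hz.
  rewrite Cmod_mult, pow_add.
  replace (K * L * (Cmod z ^ k * Cmod z ^ l)) with ((K * Cmod z ^ k) * (L * Cmod z ^ l)) by ring.
  apply Rmult_le_compat; auto using Cmod_ge_0; [apply H | apply G]; auto;
    eapply Rlt_le_trans; try exact Hz; [apply Rmin_l | apply Rmin_r].
Qed.

Lemma bigO_weaken k l h : (l <= k)%nat -> bigO k h -> bigO l h.
Proof.
  intros Hkl (K & d & PK & Pd & H). exists K, (Rmin d 1).
  split; auto. split; [apply Rmin_pos; lra|]. intros z Nz Hz.
  eapply Rle_trans; [apply H; auto; eapply Rlt_le_trans; [exact Hz | apply Rmin_l]|].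
  apply Rmult_le_compat_l; auto.
  replace k with (l + (k - l))%nat by lia. rewrite pow_add.
  assert (P := Cmod_ge_0 z).
  assert (Cmod z < 1) by (eapply Rlt_le_trans; [exact Hz | apply Rmin_r]).
  rewrite <- (Rmult_1_r (Cmod z ^ l)) at 2. apply Rmult_le_compat_l; [apply pow_le; auto|].
  rewrite <- (pow1 (k - l)). apply pow_incr. lra.
Qed.

Lemma bigO_const c : bigO 0 (fun _ => c).
Proof.
  exists (Cmod c), 1. split; [apply Cmod_ge_0|]. split; [lra|]. intros z _ _. simpl. lra.
Qed.

Lemma bigO_id : bigO 1 (fun z => z).
Proof. exists 1, 1. split; [lra|]. split; [lra|]. intros z _ _. simpl. lra. Qed.

Lemma bigO_const_0 c : bigO 1 (fun _ => c) -> c = RtoC 0.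
Proof.
  intros (K & d & PK & Pd & H). apply Cmod_eq_0, Rle_antisym; [|apply Cmod_ge_0].
  apply le_epsilon. intros e He. rewrite Rplus_0_l.
  set (t := Rmin (d / 2) (e / (K + 1))).
  assert (Pt : 0 < t) by (apply Rmin_pos; [lra | apply Rdiv_lt_0_compat; lra]).
  assert (Et : Cmod (RtoC t) = t) by (rewrite Cmod_R, Rabs_pos_eq; lra).
  assert (M1 := Rmin_l (d / 2) (e / (K + 1))). assert (M2 := Rmin_r (d / 2) (e / (K + 1))).
  fold t in M1, M2.
  eapply Rle_trans; [apply (H (RtoC t))|].
  - apply C_neq_0_of_Cmod. lra.
  - lra.
  - rewrite Et, pow_1. apply Rle_trans with ((K + 1) * (e / (K + 1))).
    + apply Rmult_le_compat; lra.
    + apply Req_le. field. lra.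
Qed.

Lemma bigO_div_id k (h : C -> C) : bigO (S k) (fun z => z * h z)%C -> bigO k h.
Proof.
  intros (K & d & PK & Pd & H). exists K, d. split; auto. split; auto. intros z Nz Hz.
  assert (P := Cmod_pos _ Nz). specialize (H z Nz Hz). rewrite Cmod_mult in H. simpl in H.
  apply (Rmult_le_reg_l (Cmod z)); auto. lra.
Qed.

(** Expansion to second order with error O(z^3). It is stable under products, inverses and
    composition by plain algebra, and [T2_unique] reads off coefficients. *)
Definition T2 (f : C -> C) (a b c : C) : Prop :=
  bigO 3 (fun z => f z - (a + b * z + c * (z * z)))%C.

Lemma T2_ext (f g : C -> C) (a b c : C) (d : R) : 0 < d -> (forall z : C, z <> 0%C -> Cmod z < d -> f z = g z) ->
  T2 f a b c -> T2 g a b c.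
Proof. intros Hd E. apply (bigO_ext _ _ _ d Hd). intros z N Hz. rewrite E; auto. Qed.

Lemma T2_eq (f : C -> C) a b c a' b' c' : T2 f a b c -> a = a' -> b = b' -> c = c' -> T2 f a' b' c'.
Proof. intros H <- <- <-. exact H. Qed.

Lemma bigO_poly a b c : bigO 0 (fun z => a + b * z + c * (z * z))%C.
Proof.
  apply bigO_plus; [apply bigO_plus|].
  - apply bigO_const.
  - apply (bigO_weaken 1); [lia|]. apply (bigO_mult 0 1); [apply bigO_const | apply bigO_id].
  - apply (bigO_weaken 2); [lia|]. apply (bigO_mult 0 2); [apply bigO_const|].
    apply (bigO_mult 1 1); apply bigO_id.
Qed.

Lemma T2_bounded (f : C -> C) a b c : T2 f a b c -> bigO 0 f.
Proof.
  intros H. apply (bigO_ext 0 (fun z => (f z - (a + b * z + c * (z * z)))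
    + (a + b * z + c * (z * z)))%C f 1); [lra | intros; ring|].
  apply bigO_plus; [apply (bigO_weaken 3); [lia | exact H] | apply bigO_poly].
Qed.

Lemma T2_const c : T2 (fun _ => c) c 0 0.
Proof.
  apply (bigO_ext _ (fun z => 0 * (z * (z * z)))%C _ 1); [lra | intros; ring|].
  apply (bigO_mult 0 3); [apply bigO_const|]. apply (bigO_mult 1 2); [apply bigO_id|].
  apply (bigO_mult 1 1); apply bigO_id.
Qed.

Lemma bigO_cube : bigO 3 (fun z => z * (z * z))%C.
Proof. apply (bigO_mult 1 2); [apply bigO_id|]. apply (bigO_mult 1 1); apply bigO_id. Qed.

Lemma T2_id : T2 (fun z => z) 0 1 0.
Proof.
  apply (bigO_ext _ (fun z => 0 * (z * (z * z)))%C _ 1); [lra | intros; ring|].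
  apply (bigO_mult 0 3); [apply bigO_const | apply bigO_cube].
Qed.

Lemma T2_plus (f g : C -> C) a b c a' b' c' : T2 f a b c -> T2 g a' b' c' ->
  T2 (fun z => f z + g z)%C (a + a') (b + b') (c + c').
Proof.
  intros Hf Hg. eapply (bigO_ext 3 _ _ 1); [lra | | apply (bigO_plus _ _ _ Hf Hg)].
  intros; simpl; ring.
Qed.

Lemma T2_mult (f g : C -> C) a b c a' b' c' : T2 f a b c -> T2 g a' b' c' ->
  T2 (fun z => f z * g z)%C (a * a') (a * b' + b * a') (a * c' + b * b' + c * a').
Proof.
  intros Hf Hg.
  apply (bigO_ext 3 (fun z => f z * (g z - (a' + b' * z + c' * (z * z)))
    + ((f z - (a + b * z + c * (z * z))) * (a' + b' * z + c' * (z * z))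
    + (z * (z * z)) * ((b * c' + c * b') + c * c' * z + 0 * (z * z))))%C _ 1);
    [lra | intros; ring|].
  apply bigO_plus; [|apply bigO_plus].
  - apply (bigO_mult 0 3); [eapply T2_bounded; eauto | exact Hg].
  - apply (bigO_mult 3 0); [exact Hf | apply bigO_poly].
  - apply (bigO_mult 3 0); [apply bigO_cube | apply bigO_poly].
Qed.

Lemma T2_inv (f : C -> C) (a b c : C) : a <> 0%C -> T2 f a b c ->
  T2 (fun z => / f z)%C (/ a) (- b / (a * a)) ((b * b - a * c) / (a * a * a)).
Proof.
  intros Na H. assert (P := Cmod_pos _ Na).
  assert (Hb : exists d, 0 < d /\ forall z : C, z <> 0%C -> Cmod z < d -> Cmod a / 2 <= Cmod (f z)).
  { assert (H1 : bigO 1 (fun z => f z - a)%C).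
    { apply (bigO_ext 1 (fun z => (f z - (a + b * z + c * (z * z))) + z * (b + c * z + 0 * (z * z)))%C _ 1);
        [lra | intros; ring|].
      apply bigO_plus; [apply (bigO_weaken 3); [lia | exact H]|].
      apply (bigO_mult 1 0); [apply bigO_id | apply bigO_poly]. }
    destruct H1 as (K & d & PK & Pd & B).
    exists (Rmin d (Cmod a / (2 * (K + 1)))). split.
    { apply Rmin_pos; auto. apply Rdiv_lt_0_compat; lra. }
    intros z Nz Hz. assert (Pz := Cmod_pos _ Nz).
    specialize (B z Nz (Rlt_le_trans _ _ _ Hz (Rmin_l _ _))). rewrite pow_1 in B.
    assert (Hz2 := Rlt_le_trans _ _ _ Hz (Rmin_r _ _)).
    assert (B2 : (K + 1) * Cmod z <= Cmod a / 2).
    { apply Rle_trans with ((K + 1) * (Cmod a / (2 * (K + 1)))).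
      - apply Rmult_le_compat_l; lra.
      - apply Req_le. field. lra. }
    assert (T := Cmod_sub_ge a (f z)). rewrite Cmod_sub_sym in T. lra. }
  destruct Hb as (d & Pd & Hb).
  assert (Nf : forall z : C, z <> 0%C -> Cmod z < d -> f z <> 0%C).
  { intros z Nz Hz. apply C_neq_0_of_Cmod. specialize (Hb z Nz Hz). lra. }
  set (p := fun z : C => (/ a + (- b / (a * a)) * z + ((b * b - a * c) / (a * a * a)) * (z * z))%C).
  (* With P the quadratic part of [f], 1/f - p = (1/f) (- (f - P) p + (1 - P p)), and 1 - P p is
     divisible by z^3 by the choice of [p]. *)
  apply (bigO_ext 3 (fun z => / f z * (- ((f z - (a + b * z + c * (z * z))) * p z)
     + (z * (z * z)) * ((2 * a * b * c - b * b * b) / (a * a * a) + (a * c * c - b * b * c) / (a * a * a) * z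
        + 0 * (z * z))))%C _ d Pd).
  - intros z Nz Hz. unfold p. field. auto.
  - apply (bigO_mult 0 3).
    + exists (2 / Cmod a), d. split; [left; apply Rdiv_lt_0_compat; lra|]. split; auto.
      intros z Nz Hz. rewrite Cmod_inv by auto. simpl. rewrite Rmult_1_r.
      replace (2 / Cmod a) with (/ (Cmod a / 2)) by (field; lra).
      apply Rinv_le_contravar; [lra | auto].
    + apply bigO_plus.
      * apply (bigO_ext 3 (fun z => (f z - (a + b * z + c * (z * z))) * (- (1) * p z))%C _ 1);
          [lra | intros; ring|].
        apply (bigO_mult 3 0); [exact H|].
        apply (bigO_mult 0 0); [apply bigO_const | apply bigO_poly].
      * apply (bigO_mult 3 0); [apply bigO_cube | apply bigO_poly].
Qed.

Lemma T2_bigO_1 (f : C -> C) b c : T2 f 0 b c -> bigO 1 f.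
Proof.
  intros H. apply (bigO_ext 1 (fun z => (f z - (0 + b * z + c * (z * z))) + z * (b + c * z + 0 * (z * z)))%C _ 1);
    [lra | intros; ring|].
  apply bigO_plus; [apply (bigO_weaken 3); [lia | exact H]|].
  apply (bigO_mult 1 0); [apply bigO_id | apply bigO_poly].
Qed.

(** [T2] says nothing about the value at 0, yet g z may vanish for z <> 0; the condition on f 0
    covers those points. *)
Lemma T2_comp (f g : C -> C) (a b c b' c' : C) : f 0%C = a -> T2 f a b c -> T2 g 0 b' c' ->
  T2 (fun z => f (g z)) a (b * b') (b * c' + c * (b' * b')).
Proof.
  intros F0 Hf Hg.
  assert (A : bigO 3 (fun z => f (g z) - (a + b * g z + c * (g z * g z)))%C).
  { destruct (T2_bigO_1 _ _ _ Hg) as (L & e & PL & Pe & G).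
    destruct Hf as (K & d & PK & Pd & H).
    exists (K * L ^ 3), (Rmin e (d / (L + 1))).
    split; [apply Rmult_le_pos; [|apply pow_le]; auto|].
    split; [apply Rmin_pos; auto; apply Rdiv_lt_0_compat; lra|].
    intros z Nz Hz. specialize (G z Nz (Rlt_le_trans _ _ _ Hz (Rmin_l _ _))). rewrite pow_1 in G.
    assert (Hz2 := Rlt_le_trans _ _ _ Hz (Rmin_r _ _)). assert (Pz := Cmod_pos _ Nz).
    assert (Hd : Cmod (g z) < d).
    { eapply Rle_lt_trans; [exact G|]. apply Rle_lt_trans with ((L + 1) * Cmod z).
      - apply Rmult_le_compat_r; lra.
      - apply Rlt_le_trans with ((L + 1) * (d / (L + 1))).
        + apply Rmult_lt_compat_l; lra.
        + apply Req_le. field. lra. }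
    rewrite Rmult_assoc, <- Rpow_mult_distr.
    apply Rle_trans with (K * Cmod (g z) ^ 3).
    - destruct (Ceq_dec (g z) 0) as [E|N]; [|apply H; auto].
      rewrite E, F0. replace (a - (a + b * 0 + c * (0 * 0)))%C with (RtoC 0) by ring.
      rewrite Cmod_0. simpl. lra.
    - apply Rmult_le_compat_l; auto. apply pow_incr. split; [apply Cmod_ge_0 | auto]. }
  assert (B := T2_plus _ _ _ _ _ _ _ _ (T2_plus _ _ _ _ _ _ _ _ (T2_const a)
    (T2_mult _ _ _ _ _ _ _ _ (T2_const b) Hg))
    (T2_mult _ _ _ _ _ _ _ _ (T2_const c) (T2_mult _ _ _ _ _ _ _ _ Hg Hg))).
  eapply (bigO_ext 3 _ _ 1); [lra | | apply (bigO_plus _ _ _ A B)].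
  intros; simpl; ring.
Qed.

Lemma T2_unique (f : C -> C) a b c a' b' c' : T2 f a b c -> T2 f a' b' c' -> a = a' /\ b = b' /\ c = c'.
Proof.
  intros H H'.
  assert (A : bigO 3 (fun z => (a' - a) + z * ((b' - b) + z * (c' - c)))%C).
  { eapply (bigO_ext 3 _ _ 1); [lra | |
      apply (bigO_plus _ _ _ H (bigO_mult 0 3 _ _ (bigO_const (- (1))%C) H'))].
    intros; simpl; ring. }
  assert (S : forall (u : C) (h : C -> C), bigO 0 h -> bigO 1 (fun z => u + z * h z)%C -> u = RtoC 0).
  { intros u h Hh Hu. apply bigO_const_0.
    apply (bigO_ext 1 (fun z => (u + z * h z) + (- (1) * z) * h z)%C _ 1); [lra | intros; ring|].
    apply bigO_plus; auto. apply (bigO_mult 1 0); auto.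
    apply (bigO_mult 0 1); [apply bigO_const | apply bigO_id]. }
  assert (L : bigO 0 (fun z => (b' - b) + z * (c' - c))%C).
  { apply (bigO_ext 0 (fun z => (b' - b) + (c' - c) * z + 0 * (z * z))%C _ 1); [lra | intros; ring|].
    apply bigO_poly. }
  assert (E0 : (a' - a)%C = RtoC 0).
  { apply (S _ (fun z => (b' - b) + z * (c' - c))%C); auto. apply (bigO_weaken 3); auto. }
  assert (A1 : bigO 2 (fun z => (b' - b) + z * (c' - c))%C).
  { apply bigO_div_id. apply (bigO_ext 3 (fun z => (a' - a) + z * ((b' - b) + z * (c' - c)))%C _ 1);
      [lra | intros; rewrite E0; ring | exact A]. }
  assert (E1 : (b' - b)%C = RtoC 0).
  { apply (S _ (fun z => c' - c)%C); [apply bigO_const|]. apply (bigO_weaken 2); auto. }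
  assert (E2 : (c' - c)%C = RtoC 0).
  { apply bigO_const_0, bigO_div_id.
    apply (bigO_ext 2 (fun z => (b' - b) + z * (c' - c))%C _ 1);
      [lra | intros; rewrite E1; ring | exact A1]. }
  repeat split; symmetry; apply Cmod_eq_of_sub_0;
    [rewrite E0 | rewrite E1 | rewrite E2]; apply Cmod_0.
Qed.

Lemma has_ps_T2 r a f : 0 < r -> has_ps r a f -> T2 f (a 0%nat) (a 1%nat) (a 2%nat).
Proof.
  intros Hr H. destruct (has_ps_taylor3 r a f Hr H) as (K & d & PK & Pd & _ & B).
  exists K, d. split; auto.
Qed.

(** Since [Cexp] is its own derivative, its Taylor coefficients satisfy (n + 1) e_(n+1) = e_n. *)
Lemma T2_Cexp : T2 Cexp 1 1 (RtoC (1 / 2)).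
Proof.
  destruct (hol_has_ps 1 Cexp) as (e & He & _); [lra | apply hol_Cexp|].
  destruct (has_ps_derive _ _ _ He) as (E' & HE' & D).
  assert (H : has_ps 1 (ps_derive e) Cexp).
  { eapply has_ps_ext; [|exact HE']. intros z Hz.
    apply (cder_unique Cexp z); [auto | apply cder_Cexp]. }
  assert (U : forall n, ps_derive e n = e n) by (intros n; apply (has_ps_unique 1 _ _ Cexp); auto; lra).
  assert (E0 : e 0%nat = RtoC 1) by (rewrite <- (has_ps_at_0 1 e Cexp); [apply Cexp_0 | lra | auto]).
  assert (E1 : e 1%nat = RtoC 1).
  { assert (U0 := U 0%nat). unfold ps_derive in U0. simpl in U0. rewrite E0 in U0.
    rewrite <- U0. ring. }
  assert (E2 : e 2%nat = RtoC (1 / 2)).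
  { assert (U1 := U 1%nat). unfold ps_derive in U1. simpl in U1. rewrite E1 in U1.
    replace (e 2%nat) with (RtoC (1 / 2) * (RtoC (1 + 1) * e 2%nat))%C.
    - rewrite U1. ring.
    - rewrite Cmult_assoc, <- RtoC_mult. replace (1 / 2 * (1 + 1)) with 1 by field. ring. }
  rewrite <- E0 at 1. rewrite <- E1, <- E2. apply (has_ps_T2 1); auto. lra.
Qed.

(** * Coefficients of Schwarz functions *)

Lemma exists_unit_phase (c : C) : exists u, Cmod u = 1 /\ (Cconj u * c)%C = RtoC (Cmod c).
Proof.
  destruct (Ceq_dec c 0) as [->|N].
  - exists (RtoC 1). split; [apply Cmod_1|]. rewrite Cmod_0. ring.
  - assert (P := Cmod_pos _ N).
    assert (N' : RtoC (Cmod c) <> RtoC 0) by (intros E; apply (f_equal fst) in E; simpl in E; lra).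
    exists (c / RtoC (Cmod c))%C. split.
    + rewrite Cmod_div by auto. rewrite Cmod_R, Rabs_pos_eq by lra. field. lra.
    + rewrite Cdiv_conj by auto.
      replace (Cconj (RtoC (Cmod c))) with (RtoC (Cmod c)) by (apply injective_projections; simpl; ring).
      transitivity (c * Cconj c / RtoC (Cmod c))%C; [field; auto|].
      rewrite <- Cmod2_conj, RtoC_pow. simpl. field. auto.
Qed.

Lemma cint_circ r : cint (circ r) = RtoC 0.
Proof.
  rewrite (cint_ext _ (fun y => - Ci * (Ci * circ r y))%C).
  - rewrite cint_scal, (cint_derive (circ r)).
    + rewrite circ_periodic. ring.
    + intros t. split; [apply cder_circ|]. apply ccont_mult; [apply ccont_const | apply ccont_circ].
    + apply pcont_mult; [apply pcont_const | apply pcont_circ].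
  - intros t. transitivity (- (Ci * Ci) * circ r (RtoC t))%C; [|ring].
    replace (Ci * Ci)%C with (- (1))%C by (apply injective_projections; simpl; ring). ring.
Qed.

Lemma Re_conj_Cmod2 (a : C) : (Cconj a * a)%C = RtoC (Cmod a ^ 2).
Proof. rewrite Cmod2_conj. ring. Qed.

(* With [q = 1 + conj (c 1) u e] and [u] the phase of [c 2], integrate the
   pointwise bound [Re (w * conj u * q ^ 2 / e ^ 2) <= |q| ^ 2] over the circle. *)
Lemma schwarz_coef_circ (w : C -> C) (c : nat -> C) (r : R) :
  hol (fun z => Cmod z < 1) w -> has_ps 1 c w -> c 0%nat = RtoC 0 ->
  (forall z, Cmod z < 1 -> Cmod (w z) <= 1) -> 0 < r < 1 ->
  r * r * Cmod (c 2%nat) + 2 * r * Cmod (c 1%nat) ^ 2 <= 1 + Cmod (c 1%nat) ^ 2.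
Proof.
  intros Hw Hc C0 Hb Hr. assert (PP := PI_RGT_0).
  destruct (hol_has_ps 1 w Rlt_0_1 Hw) as (a & Ha & Hi).
  assert (Ea : forall n, circ_coef r w n = c n).
  { intros n. rewrite Hi by auto. apply (has_ps_unique 1 _ _ w); auto; lra. }
  assert (Ec : forall n, cint (fun y => w (circ r y) * (/ circ r y) ^ n)%C = (RtoC (2 * PI) * c n)%C).
  { intros n. rewrite <- Ea. unfold circ_coef. field. apply two_PI_neq_0. }
  destruct (exists_unit_phase (c 2%nat)) as (u & Hu & Eu).
  set (al := c 1%nat) in *.
  set (m := fun y => (Cconj al * u * circ 1 y)%C).
  set (W := fun y => (Cconj u * RtoC (r * r) * (/ circ r y) ^ 2 + 2 * Cconj al * RtoC r * (/ circ r y) ^ 1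
      + Cconj al * Cconj al * u * (/ circ r y) ^ 0)%C).
  assert (PI1 : pcont (fun y => / circ r y)%C).
  { intros t. apply ccont_inv; [apply circ_neq_0; lra | apply ccont_circ]. }
  assert (PIn : forall n, pcont (fun y => (/ circ r y) ^ n)%C).
  { induction n; simpl; [apply pcont_const | apply pcont_mult; auto]. }
  assert (Pw : pcont (fun y => w (circ r y))).
  { intros t. apply (ccont_comp (circ r) w); [apply ccont_circ|].
    eapply hol_ccont; [exact Hw|]. cbv beta. rewrite Cmod_circ; lra. }
  assert (PW : pcont W).
  { unfold W. repeat apply pcont_plus; apply pcont_mult; auto using pcont_const. }
  assert (Pm : pcont m).
  { apply pcont_mult; [apply pcont_const | apply pcont_circ]. }
  (* The three terms of [W] extract the coefficients of index 2, 1 and 0 of [w]; because |u| = 1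
     they assemble on the circle into a unimodular factor times a square. *)
  assert (EW : forall t : R, W (RtoC t) = (Cconj u * (/ circ 1 (RtoC t)) ^ 2 * (1 + m (RtoC t)) ^ 2)%C).
  { intros t. unfold W, m.
    assert (N := circ_neq_0 1 t Rlt_0_1).
    assert (Er : circ r (RtoC t) = (RtoC r * circ 1 (RtoC t))%C) by (unfold circ; ring).
    assert (Nr : RtoC r <> RtoC 0) by (intros E; apply (f_equal fst) in E; simpl in E; lra).
    rewrite Er, RtoC_mult.
    transitivity (Cconj u * (/ circ 1 (RtoC t)) ^ 2 + 2 * Cconj al * (Cconj u * u) * / circ 1 (RtoC t)
       + Cconj al * Cconj al * u * (Cconj u * u))%C.
    - rewrite Re_conj_Cmod2, Hu. replace (RtoC (1 ^ 2)) with (RtoC 1) by (f_equal; ring).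
      cbn [Cpow]. field. auto.
    - cbn [Cpow]. field. auto. }
  assert (L : rint (fun y => w (circ r y) * W y)%C <= rint (fun y => RtoC (1 + Cmod al ^ 2) + 2 * m y)%C).
  { apply RInt_le; [lra| | |].
    - apply (ex_rint (fun y => w (circ r y) * W y)%C), pcont_mult; auto.
    - apply (ex_rint (fun y => RtoC (1 + Cmod al ^ 2) + 2 * m y)%C).
      apply pcont_plus; [apply pcont_const | apply pcont_mult; auto using pcont_const].
    - intros t _. eapply Rle_trans; [apply Rle_abs|]. eapply Rle_trans; [apply re_le_Cmod|].
      rewrite Cmod_mult. apply Rle_trans with (1 * Cmod (W (RtoC t))).
      { apply Rmult_le_compat_r; [apply Cmod_ge_0|]. apply Hb. rewrite Cmod_circ; lra. }
      rewrite EW, !Cmod_mult, !Cmod_pow, Cmod_conj, Hu, Cmod_inv, Cmod_circ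
        by (try apply circ_neq_0; lra).
      replace (1 * (1 * (/ 1) ^ 2 * Cmod (1 + m (RtoC t)) ^ 2)) with (Cmod (1 + m (RtoC t)) ^ 2) by field.
      assert (Em : Cmod (m (RtoC t)) = Cmod al).
      { unfold m. rewrite !Cmod_mult, Cmod_conj, Hu, Cmod_circ by lra. ring. }
      apply Req_le. rewrite <- Em, !Cmod2_alt. destruct (m (RtoC t)). simpl. ring. }
  (* The term [m] is a multiple of e^(it) and has mean zero. *)
  assert (R1 : rint (fun y => RtoC (1 + Cmod al ^ 2) + 2 * m y)%C = 2 * PI * (1 + Cmod al ^ 2)).
  { change (fst (cint (fun y => RtoC (1 + Cmod al ^ 2) + 2 * m y)%C) = 2 * PI * (1 + Cmod al ^ 2)).
    rewrite cint_plus, cint_const, cint_scal by auto using pcont_mult, pcont_const.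
    unfold m. rewrite cint_scal, cint_circ by apply pcont_circ. simpl. ring. }
  assert (R2 : rint (fun y => w (circ r y) * W y)%C
    = 2 * PI * (r * r * Cmod (c 2%nat) + 2 * r * Cmod al ^ 2)).
  { change (fst (cint (fun y => w (circ r y) * W y)%C)
      = 2 * PI * (r * r * Cmod (c 2%nat) + 2 * r * Cmod al ^ 2)).
    rewrite (cint_ext _ (fun y =>
       (Cconj u * RtoC (r * r)) * (w (circ r y) * (/ circ r y) ^ 2) +
       ((2 * Cconj al * RtoC r) * (w (circ r y) * (/ circ r y) ^ 1)
      + (Cconj al * Cconj al * u) * (w (circ r y) * (/ circ r y) ^ 0)))%C)
      by (intros t; unfold W; ring).
    rewrite !cint_plus, !cint_scal, !Ec by auto 10 using pcont_mult, pcont_const, pcont_plus.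
    rewrite C0. fold al.
    replace (Cconj u * RtoC (r * r) * (RtoC (2 * PI) * c 2%nat) +
       (2 * Cconj al * RtoC r * (RtoC (2 * PI) * al) + Cconj al * Cconj al * u * (RtoC (2 * PI) * 0)))%C
      with (RtoC (2 * PI) * (RtoC (r * r) * (Cconj u * c 2%nat) + 2 * RtoC r * (Cconj al * al)))%C by ring.
    rewrite Eu, Re_conj_Cmod2. simpl. ring. }
  rewrite R1, R2 in L. apply Rmult_le_reg_l in L; lra.
Qed.

(** The limit r -> 1 of [schwarz_coef_circ]: there |c2| + 2 |c1|^2 <= 1 + |c1|^2. *)
Lemma schwarz_coef (w : C -> C) (c : nat -> C) :
  hol (fun z => Cmod z < 1) w -> has_ps 1 c w -> c 0%nat = RtoC 0 ->
  (forall z, Cmod z < 1 -> Cmod (w z) <= 1) ->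
  Cmod (c 2%nat) <= 1 - Cmod (c 1%nat) ^ 2.
Proof.
  intros Hw Hc C0 Hb.
  assert (P2 := Cmod_ge_0 (c 2%nat)). assert (P1 := pow2_ge_0 (Cmod (c 1%nat))).
  set (x := Cmod (c 2%nat)) in *. set (y := Cmod (c 1%nat) ^ 2) in *.
  apply le_epsilon. intros e He.
  (* With r = 1 - d the circle estimate reads x + y <= 1 + 2 d (x + y) - d^2 x, so d only has to
     make 2 d (x + y) at most e. *)
  set (d := Rmin (1 / 2) (e / (2 * (x + y) + 1))).
  assert (Pd : 0 < d) by (apply Rmin_pos; [lra | apply Rdiv_lt_0_compat; lra]).
  assert (M1 := Rmin_l (1 / 2) (e / (2 * (x + y) + 1))).
  assert (M2 := Rmin_r (1 / 2) (e / (2 * (x + y) + 1))). fold d in M1, M2.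
  assert (H := schwarz_coef_circ w c (1 - d) Hw Hc C0 Hb ltac:(lra)). fold x y in H.
  assert (Hd : d * (2 * (x + y) + 1) <= e).
  { apply Rle_trans with (e / (2 * (x + y) + 1) * (2 * (x + y) + 1)).
    - apply Rmult_le_compat_r; lra.
    - apply Req_le. field. lra. }
  assert (0 <= d * d * x) by (apply Rmult_le_pos; [nra | auto]). lra.
Qed.

(** * The class C_arcsin and its inverse logarithmic coefficients *)

Lemma csum_at_0 (a : nat -> C) : csum (fun n => a n * 0 ^ n)%C (a 0%nat).
Proof.
  apply (csum_ext (fun n => match n with O => a 0%nat | S _ => RtoC 0 end)).
  - intros [|n]; simpl; ring.
  - apply csum_single.
Qed.

Definition div_id (l : C) (f : C -> C) (z : C) : C :=
  if Ceq_dec z 0 then l else (f z / z)%C.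

Lemma div_id_neq_0 l f z : z <> RtoC 0 -> div_id l f z = (f z / z)%C.
Proof. intros N. unfold div_id. destruct (Ceq_dec z 0); [contradiction | auto]. Qed.

Lemma div_id_0 l f : div_id l f 0 = l.
Proof. unfold div_id. destruct (Ceq_dec 0 0); [auto | contradiction]. Qed.

Lemma has_ps_div_id r a f : has_ps r a f -> a 0%nat = RtoC 0 ->
  has_ps r (fun n => a (S n)) (div_id (a 1%nat) f).
Proof.
  intros H A0 z Hz. destruct (Ceq_dec z 0) as [->|N].
  - rewrite div_id_0. apply (csum_at_0 (fun n => a (S n))).
  - rewrite div_id_neq_0 by auto. assert (S1 := csum_scal (/ z) _ _ (csum_tail _ _ (H z Hz))).
    cbv beta in S1.
    replace (/ z * (f z - a 0%nat * z ^ 0))%C with (f z / z)%C in S1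
      by (rewrite A0; simpl; field; auto).
    eapply csum_ext; [|exact S1]. intros n. simpl. field. auto.
Qed.

(* Off the zeros of [F], [|z F'| <= M |F|]; hence [t |-> |F (t z)|^2 exp (2 M t / t0)]
   is nondecreasing on [t0, 1] and cannot vanish at 1. *)
Lemma nonvanishing_of_log_derivative_bound (F F' : C -> C) (M : R) :
  (forall z, Cmod z < 1 -> cder F z (F' z)) -> F 0 <> RtoC 0 ->
  (forall z, Cmod z < 1 -> F z <> RtoC 0 -> Cmod (z * F' z) <= M * Cmod (F z)) ->
  forall z, Cmod z < 1 -> F z <> RtoC 0.
Proof.
  intros D F0 B z0 Hz0 E.
  assert (Pz := Cmod_ge_0 z0).
  assert (C0 : ccont F 0) by (eapply cder_ccont, D; rewrite Cmod_0; lra).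
  assert (PF0 := Cmod_pos _ F0).
  destruct (C0 (Cmod (F 0)) PF0) as (d & Pd & Hd).
  (* The bound on z F' controls the derivative along the ray only up to a factor 1/t, so the ray is
     started at a positive t0, close enough to 0 for F to be nonzero there. *)
  set (t0 := Rmin (1 / 2) (d / 2)).
  assert (Pt0 : 0 < t0) by (apply Rmin_pos; lra).
  assert (M1 := Rmin_l (1 / 2) (d / 2)). assert (M2 := Rmin_r (1 / 2) (d / 2)). fold t0 in M1, M2.
  assert (N0 : F (RtoC t0 * z0)%C <> RtoC 0).
  { intros Z. specialize (Hd (RtoC t0 * z0)%C). rewrite Z in Hd.
    replace (0 - F 0)%C with (- F 0)%C in Hd by ring. rewrite Cmod_opp in Hd.
    apply (Rlt_irrefl (Cmod (F 0))), Hd.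
    replace (RtoC t0 * z0 - 0)%C with (RtoC t0 * z0)%C by ring.
    rewrite Cmod_mult, Cmod_R, Rabs_pos_eq by lra. nra. }
  set (p := fun y => F (y * z0)%C). set (p' := fun y => (F' (y * z0) * z0)%C).
  assert (In : forall t, 0 <= t <= 1 -> Cmod (RtoC t * z0) < 1).
  { intros t Ht. rewrite Cmod_mult, Cmod_R, Rabs_pos_eq by lra. nra. }
  assert (Dp : forall t, 0 <= t <= 1 -> cder p (RtoC t) (p' (RtoC t))).
  { intros t Ht. apply (cder_comp (fun y => y * z0)%C F).
    - apply (cder_eq _ _ (1 * z0 + RtoC t * 0)); [|ring].
      apply (cder_mult (fun y => y) (fun _ => z0)); [apply cder_id | apply cder_const].
    - apply D, In, Ht. }
  set (A := fun t => Re (p (RtoC t))). set (K := fun t => Re (- Ci * p (RtoC t))).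
  set (A' := fun t => Re (p' (RtoC t))). set (K' := fun t => Re (- Ci * p' (RtoC t))).
  assert (DA : forall t, 0 <= t <= 1 -> is_derive A t (A' t)).
  { intros t Ht. apply (cder_is_derive_Re p), Dp, Ht. }
  assert (DK : forall t, 0 <= t <= 1 -> is_derive K t (K' t)).
  { intros t Ht. apply (cder_is_derive_Re (fun y => - Ci * p y)%C).
    apply (cder_eq _ _ (0 * p (RtoC t) + - Ci * p' (RtoC t))); [|ring].
    apply (cder_mult (fun _ => - Ci)%C p); [apply cder_const | apply Dp, Ht]. }
  set (k := 2 * M / t0).
  set (g := fun t => (A t * A t + K t * K t) * exp (k * t)).
  set (g' := fun t => (2 * (A t * A' t + K t * K' t) + k * (A t * A t + K t * K t)) * exp (k * t)).
  assert (Dg : forall t, 0 <= t <= 1 -> is_derive g t (g' t)).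
  { intros t Ht. unfold g, g'.
    assert (EA : ex_derive A t) by (exists (A' t); auto).
    assert (EK : ex_derive K t) by (exists (K' t); auto). auto_derive.
    - repeat split; assumption.
    - rewrite (is_derive_unique (fun x : R => A x) _ _ (DA t Ht)),
        (is_derive_unique (fun x : R => K x) _ _ (DK t Ht)). ring. }
  destruct (MVT_gen g t0 1 g') as (c & Hc & Eg).
  - intros t Ht. rewrite Rmin_left, Rmax_right in Ht by lra. apply Dg. lra.
  - intros t Ht. rewrite Rmin_left, Rmax_right in Ht by lra.
    apply continuity_pt_filterlim, (ex_derive_continuous (V := R_NormedModule)).
    eexists. apply Dg. lra.
  - rewrite Rmin_left, Rmax_right in Hc by lra.
    assert (Hnorm : forall t, A t * A t + K t * K t = Cmod (p (RtoC t)) * Cmod (p (RtoC t))).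
    { intros t. replace (Cmod (p (RtoC t)) * Cmod (p (RtoC t))) with (Cmod (p (RtoC t)) ^ 2) by ring.
      rewrite Cmod2_alt. unfold A, K. destruct (p (RtoC t)). simpl. ring. }
    assert (G1 : g 1 = 0).
    { unfold g. rewrite Hnorm. unfold p. replace (1 * z0)%C with z0 by ring. rewrite E, Cmod_0. ring. }
    assert (G0 : 0 < g t0).
    { unfold g. apply Rmult_lt_0_compat; [|apply exp_pos]. rewrite Hnorm.
      assert (P := Cmod_pos _ N0). apply Rmult_lt_0_compat; exact P. }
    assert (Gc : 0 <= g' c).
    { unfold g'. apply Rmult_le_pos; [|left; apply exp_pos].
      set (y := p (RtoC c)). set (y' := p' (RtoC c)).
      assert (Hre : Rabs (A c * A' c + K c * K' c) <= Cmod y * Cmod y').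
      { replace (A c * A' c + K c * K' c) with (Re (Cconj y * y')).
        - rewrite <- (Cmod_conj y), <- Cmod_mult. apply re_le_Cmod.
        - unfold A, A', K, K'. fold y y'. destruct y, y'. simpl. ring. }
      rewrite Hnorm. fold y.
      (* At a zero of F on the ray both products in the derivative of |F|^2 vanish; elsewhere the
         hypothesis [B] applies. *)
      destruct (Ceq_dec y 0) as [Z|N].
      - rewrite Z, Cmod_0 in *. apply Rabs_le_between in Hre. lra.
      - assert (Bc := B (RtoC c * z0)%C (In c ltac:(lra)) N).
        assert (Ey : (RtoC c * z0 * F' (RtoC c * z0))%C = (RtoC c * y')%C) by (unfold y', p'; ring).
        rewrite Ey, Cmod_mult, Cmod_R, Rabs_pos_eq in Bc by lra.
        change (c * Cmod y' <= M * Cmod y) in Bc.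
        assert (Py := Cmod_pos _ N). assert (Py' := Cmod_ge_0 y').
        assert (B2 : t0 * Cmod y' <= M * Cmod y) by nra.
        assert (B3 : Cmod y' <= k / 2 * Cmod y).
        { apply (Rmult_le_reg_l t0); auto. unfold k.
          replace (t0 * (2 * M / t0 / 2 * Cmod y)) with (M * Cmod y) by (field; lra). auto. }
        apply Rabs_le_between in Hre. nra. }
    rewrite G1 in Eg. nra.
Qed.

Lemma disc_nbhd z r : Cmod z < r -> exists d, 0 < d /\ forall y, Cmod (y - z) < d -> Cmod y < r.
Proof.
  intros H. exists (r - Cmod z). split; [lra|]. intros y Hy. assert (T := Cmod_sub_ge y z). lra.
Qed.

Lemma RtoC_neq_0 x : x <> 0 -> RtoC x <> RtoC 0.
Proof. intros H E. apply (f_equal fst) in E. exact (H E). Qed.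

Lemma two_half : (2 * RtoC (1 / 2))%C = RtoC 1.
Proof. rewrite <- RtoC_mult. f_equal. field. Qed.

(** (pi/2) z f''/f' = pi a2 z + pi (3 a3 - 2 a2^2) z^2 + ..., and sin v = v + O(v^3), so taking the
    sine leaves both coefficients unchanged. *)
Lemma class_C_arcsin_schwarz (f : C -> C) (a : nat -> C) (w : C -> C) :
  has_ps 1 a f -> a 1%nat = RtoC 1 -> schwarz_function w ->
  (forall z, Omega z -> (1 + z * C_derive (C_derive f) z / C_derive f z
     = 1 + RtoC (2 / PI) * Carcsin (w z))%C) ->
  hol Omega w /\
  T2 w 0 (RtoC PI * a 2%nat) (RtoC PI * (3 * a 3%nat - 2 * (a 2%nat * a 2%nat))).
Proof.
  intros Hf A1 (_ & W0 & Wb) Hs. assert (PP := PI_RGT_0).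
  destruct (has_ps_derive _ _ _ Hf) as (f1 & Hf1 & D1).
  destruct (has_ps_derive _ _ _ Hf1) as (f2 & Hf2 & D2).
  assert (E1 : forall z, Omega z -> C_derive f z = f1 z).
  { intros z Hz. apply is_C_derive_unique, cder_is_derive, D1, Hz. }
  assert (E2 : forall z, Omega z -> C_derive (C_derive f) z = f2 z).
  { intros z Hz. apply is_C_derive_unique, cder_is_derive.
    destruct (disc_nbhd z 1 Hz) as (d & Pd & Hd).
    apply (cder_ext_loc f1 _ z _ d Pd); [|apply D2, Hz].
    intros y Hy. symmetry. apply E1, Hd, Hy. }
  assert (Eq : forall z, Omega z -> (z * f2 z / f1 z = RtoC (2 / PI) * Carcsin (w z))%C).
  { intros z Hz. specialize (Hs z Hz). rewrite E1, E2 in Hs by auto.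
    transitivity (1 + z * f2 z / f1 z - 1)%C; [ring|]. rewrite Hs. ring. }
  assert (F0 : f1 0 = RtoC 1).
  { rewrite (has_ps_at_0 1 _ f1 Rlt_0_1 Hf1). unfold ps_derive. simpl. rewrite A1. ring. }
  (* At a zero of [f1] the quotient is a default value and carries no information, so the bound on z
     f2 is derived only where [f1] is nonzero. *)
  assert (N1 : forall z, Cmod z < 1 -> f1 z <> RtoC 0).
  { apply (nonvanishing_of_log_derivative_bound f1 f2 (2 / PI * (2 + PI))); auto.
    - rewrite F0. apply RtoC_neq_0. lra.
    - intros z Hz N. assert (P := Cmod_pos _ N).
      replace (z * f2 z)%C with (RtoC (2 / PI) * Carcsin (w z) * f1 z)%C
        by (rewrite <- Eq by auto; field; auto).
      rewrite !Cmod_mult, Cmod_R, Rabs_pos_eq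
        by (left; apply Rdiv_lt_0_compat; lra).
      apply Rmult_le_compat_r; [lra|]. apply Rmult_le_compat_l.
      + left; apply Rdiv_lt_0_compat; lra.
      + eapply Rle_trans; [apply Cmod_Carcsin_bound|]. specialize (Wb z Hz). lra. }
  set (v := fun z => (RtoC (PI / 2) * (z * (f2 z * / f1 z)))%C).
  assert (Ev : forall z, Omega z -> Carcsin (w z) = v z).
  { intros z Hz. unfold v. replace (z * (f2 z * / f1 z))%C with (z * f2 z / f1 z)%C by (unfold Cdiv; ring).
    rewrite Eq by auto. rewrite Cmult_assoc, <- RtoC_mult.
    replace (PI / 2 * (2 / PI)) with 1 by (field; lra). ring. }
  (* This is sin (v z), built from functions already known to be [hol]. *)
  set (w' := fun z => ((Cexp (Ci * v z) + - (1) * Cexp (- Ci * v z)) * / (2 * Ci))%C).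
  assert (Ew : forall z, Omega z -> w' z = w z).
  { intros z Hz. unfold w'. rewrite <- (Ev z Hz). rewrite (sin_Carcsin (w z)) at 3.
    replace (- Ci * Carcsin (w z))%C with (- (Ci * Carcsin (w z)))%C by ring.
    rewrite Cexp_opp. ring. }
  split.
  - apply (hol_ext Omega w').
    { intros z Hz. destruct (disc_nbhd z 1 Hz) as (d & Pd & Hd). exists d. split; auto.
      intros y Hy. apply Ew, Hd, Hy. }
    assert (Hv : hol Omega v).
    { apply hol_mult; [apply hol_const|]. apply hol_mult; [apply hol_id|].
      apply hol_mult; [apply (has_ps_hol _ _ _ Hf2)|].
      apply hol_inv; [apply (has_ps_hol _ _ _ Hf1) | exact N1]. }
    assert (He : forall c : C, hol Omega (fun z => Cexp (c * v z))).
    { intros c. apply (hol_comp Omega (fun _ => True) (fun z => c * v z)%C Cexp); auto using hol_Cexp.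
      apply hol_mult; [apply hol_const | exact Hv]. }
    apply hol_mult; [|apply hol_const]. apply hol_plus; [apply He|].
    apply (hol_mult Omega (fun _ => - (1))%C); [apply hol_const | apply He].
  - apply (T2_ext w' w _ _ _ 1); [lra | intros; apply Ew; auto|].
    assert (T1 : T2 f1 1 (2 * a 2%nat) (3 * a 3%nat)).
    { eapply T2_eq; [apply (has_ps_T2 1 _ _ Rlt_0_1 Hf1)|..]; unfold ps_derive; simpl INR.
      - rewrite A1. ring.
      - rewrite RtoC_plus. ring.
      - rewrite !RtoC_plus. ring. }
    assert (T3 := has_ps_T2 1 _ _ Rlt_0_1 Hf2). unfold ps_derive in T3. simpl INR in T3.
    assert (N1' : RtoC 1 <> RtoC 0) by (apply RtoC_neq_0; lra).
    assert (Tv := T2_mult _ _ _ _ _ _ _ _ (T2_const (RtoC (PI / 2)))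
      (T2_mult _ _ _ _ _ _ _ _ T2_id (T2_mult _ _ _ _ _ _ _ _ T3 (T2_inv _ _ _ _ N1' T1)))).
    change (fun z => (RtoC (PI / 2) * (z * (f2 z * / f1 z)))%C) with v in Tv.
    assert (Tv' : T2 v 0 (RtoC PI * a 2%nat) (RtoC PI * (3 * a 3%nat - 2 * (a 2%nat * a 2%nat)))).
    { assert (EP : RtoC PI = (2 * RtoC (PI / 2))%C) by (rewrite <- RtoC_mult; f_equal; field).
      eapply T2_eq; [exact Tv|..].
      - ring.
      - rewrite EP, !RtoC_plus. field; auto.
      - rewrite EP, !RtoC_plus. field; auto. }
    set (v1 := (RtoC PI * a 2%nat)%C) in *.
    set (v2 := (RtoC PI * (3 * a 3%nat - 2 * (a 2%nat * a 2%nat)))%C) in *.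
    assert (Te : forall c : C, T2 (fun z => Cexp (c * v z)) 1 (c * v1)
      (c * v2 + RtoC (1 / 2) * (c * v1 * (c * v1)))).
    { intros c. assert (Tcv : T2 (fun z => c * v z)%C 0 (c * v1) (c * v2)).
      { eapply T2_eq; [apply (T2_mult _ _ _ _ _ _ _ _ (T2_const c) Tv')|..]; ring. }
      eapply T2_eq; [apply (T2_comp Cexp _ _ _ _ _ _ Cexp_0 T2_Cexp Tcv)|..]; ring. }
    assert (Tw := T2_mult _ _ _ _ _ _ _ _ (T2_plus _ _ _ _ _ _ _ _ (Te Ci)
       (T2_mult _ _ _ _ _ _ _ _ (T2_const (- (1))%C) (Te (- Ci)%C))) (T2_const (/ (2 * Ci)))).
    assert (NC : Ci <> RtoC 0) by (apply C_neq_0_of_Cmod; rewrite Cmod_Ci; lra).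
    eapply T2_eq; [exact Tw|..].
    + field; auto.
    + field; auto.
    + field; auto.
Qed.

(** Write g z = z e(z) with e = exp (2 s), s being the sum of the G-series, and f z = z phi(z). Then
    f (g z) = z becomes e(z) phi(z e(z)) = 1, and the coefficients of z and z^2 on the left must
    vanish. *)
Lemma inverse_log_coeffs_formula (f : C -> C) (a : nat -> C) (G : nat -> C) :
  has_ps 1 a f -> a 0%nat = RtoC 0 -> a 1%nat = RtoC 1 -> inverse_log_coeffs f G ->
  (2 * G 1%nat = - a 2%nat /\
   2 * G 2%nat = - (a 3%nat - RtoC (3 / 2) * (a 2%nat * a 2%nat)))%C.
Proof.
  intros Hf A0 A1 (g & r & Pr & Hg & HG).
  (* The value [G 0] is arbitrary, so the power series of half the logarithm is given constant term
     0. *)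
  set (b := fun n => match n with O => RtoC 0 | S m => G (S m) end).
  set (s := fun z => if Ceq_dec z 0 then RtoC 0 else (Clog (g z / z) * RtoC (1 / 2))%C).
  assert (Hs : has_ps r b s).
  { intros z Hz. unfold s. destruct (Ceq_dec z 0) as [->|N]; [apply (csum_at_0 b)|].
    destruct (HG z N Hz) as (l & Hl & El). apply csum_is_series in Hl. rewrite El.
    replace (2 * l * RtoC (1 / 2))%C with (b 0%nat * z ^ 0 + l)%C.
    - apply csum_cons. eapply csum_ext; [|exact Hl]. intros n. reflexivity.
    - simpl. transitivity ((2 * RtoC (1 / 2)) * l)%C; [|ring].
      rewrite two_half. ring. }
  assert (F0 : f 0 = RtoC 0) by (rewrite (has_ps_at_0 1 a f); auto; lra).
  assert (Ng : forall z, z <> RtoC 0 -> Cmod z < r -> g z <> RtoC 0).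
  { intros z N Hz E. destruct (Hg z Hz) as [_ H]. rewrite E, F0 in H. auto. }
  set (e := fun z => Cexp (2 * s z)).
  assert (Eg : forall z, z <> RtoC 0 -> Cmod z < r -> (z * e z)%C = g z).
  { intros z N Hz. unfold e, s. destruct (Ceq_dec z 0); [contradiction|].
    replace (2 * (Clog (g z / z) * RtoC (1 / 2)))%C with (Clog (g z / z)).
    - rewrite Cexp_Clog; [field; auto|]. unfold Cdiv.
      apply Cmult_neq_0; [apply Ng; auto|]. apply C_neq_0_of_Cmod. rewrite Cmod_inv by auto.
      apply Rinv_0_lt_compat, Cmod_pos, N.
    - transitivity ((2 * RtoC (1 / 2)) * Clog (g z / z))%C; [|ring].
      rewrite two_half. ring. }
  assert (Ts : T2 s 0 (G 1%nat) (G 2%nat)) by apply (has_ps_T2 r b s Pr Hs).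
  assert (Te : T2 e 1 (2 * G 1%nat) (2 * G 2%nat + 2 * (G 1%nat * G 1%nat))).
  { assert (T0 := T2_mult _ _ _ _ _ _ _ _ (T2_const 2) Ts).
    assert (T0' := T2_eq _ _ _ _ 0 _ _ T0 ltac:(ring) eq_refl eq_refl).
    eapply T2_eq; [apply (T2_comp Cexp _ _ _ _ _ _ Cexp_0 T2_Cexp T0')| ring | ring |].
    transitivity (2 * G 2%nat + (2 * RtoC (1 / 2)) * (2 * (G 1%nat * G 1%nat)))%C; [ring|].
    rewrite two_half. ring. }
  set (phi := div_id (a 1%nat) f).
  assert (Hphi : has_ps 1 (fun n => a (S n)) phi) by (apply has_ps_div_id; auto).
  assert (Tphi := has_ps_T2 1 _ _ Rlt_0_1 Hphi). cbv beta in Tphi.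
  assert (Tg := T2_mult _ _ _ _ _ _ _ _ T2_id Te).
  assert (Tg' := T2_eq _ _ _ _ 0 _ _ Tg ltac:(ring) eq_refl eq_refl).
  assert (Tc := T2_mult _ _ _ _ _ _ _ _ Te
     (T2_comp phi _ _ _ _ _ _ (div_id_0 (a 1%nat) f) Tphi Tg')).
  assert (Tone : T2 (fun z => e z * phi (z * e z))%C 1 0 0).
  { apply (T2_ext (fun _ => RtoC 1) _ _ _ _ r Pr); [|apply T2_const].
    intros z N Hz. rewrite (Eg z N Hz). unfold phi. rewrite div_id_neq_0 by (apply Ng; auto).
    destruct (Hg z Hz) as [_ H]. rewrite H.
    replace (e z) with (g z / z)%C by (rewrite <- (Eg z N Hz); field; auto).
    field. split; [apply Ng; auto | auto]. }
  destruct (T2_unique _ _ _ _ _ _ _ Tc Tone) as (_ & U1 & U2).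
  rewrite A1 in U1, U2.
  assert (V1 : (2 * G 1%nat = - a 2%nat)%C).
  { transitivity ((1 * (a 2%nat * (0 * (2 * G 1%nat) + 1 * 1)) + 2 * G 1%nat * 1) - a 2%nat)%C; [ring|].
    rewrite U1. ring. }
  split; auto.
  (* The vanishing quadratic coefficient contains 2 * G 2 with factor 1; the other terms are
     subtracted and simplified by [V1]. *)
  match type of U2 with ?l = _ =>
    transitivity (l - (a 3%nat + (2 * RtoC (1 / 2)) * (2 * G 1%nat) * (G 1%nat)
      + 2 * a 2%nat * (2 * G 1%nat)))%C end.
  - rewrite two_half. ring.
  - rewrite U2. rewrite V1.
    transitivity (- (a 3%nat + RtoC (1 / 2) * (- a 2%nat) * (2 * G 1%nat) - 2 * (a 2%nat * a 2%nat)))%C; [ring|].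
    rewrite V1. replace (RtoC (3 / 2)) with (2 - RtoC (1 / 2))%C by (rewrite <- RtoC_minus; f_equal; field).
    ring.
Qed.

(** Taking any second order expansion of [w] lets the lemma serve both the bounds, where [w] is
    unknown, and the extremal functions, where it is explicit. *)
Lemma class_C_arcsin_inverse_log_coeffs (f w : C -> C) (G : nat -> C) (c1 c2 : C) :
  class_A f -> schwarz_function w ->
  (forall z, Omega z -> (1 + z * C_derive (C_derive f) z / C_derive f z
     = 1 + RtoC (2 / PI) * Carcsin (w z))%C) ->
  inverse_log_coeffs f G -> T2 w 0 c1 c2 ->
  G 1%nat = (- RtoC (1 / (2 * PI)) * c1)%C /\
  G 2%nat = (- RtoC (1 / (6 * PI)) * (c2 - RtoC (5 / (2 * PI)) * (c1 * c1)))%C.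
Proof.
  intros (_ & a & A0 & A1 & Ha) Sw Hs HG T. assert (PP := PI_RGT_0).
  assert (Hf : has_ps 1 a f).
  { intros z Hz. apply is_pseries_csum, Ha, Hz. }
  destruct (class_C_arcsin_schwarz f a w Hf A1 Sw Hs) as (Hw & Tw).
  destruct (inverse_log_coeffs_formula f a G Hf A0 A1 HG) as (G1 & G2).
  destruct (T2_unique _ _ _ _ _ _ _ T Tw) as (_ & -> & ->).
  assert (N2 : RtoC 2 <> RtoC 0) by (apply RtoC_neq_0; lra).
  assert (K1 : (RtoC (1 / (2 * PI)) * RtoC PI)%C = (/ 2)%C).
  { rewrite <- RtoC_mult, <- RtoC_inv by lra. f_equal. field. lra. }
  assert (K2 : (RtoC (1 / (6 * PI)) * RtoC PI)%C = (/ 6)%C).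
  { rewrite <- RtoC_mult, <- RtoC_inv by lra. f_equal. field. lra. }
  assert (K3 : (RtoC (5 / (2 * PI)) * RtoC PI)%C = (5 * / 2)%C).
  { rewrite <- RtoC_inv by lra. rewrite <- !RtoC_mult. f_equal. field. lra. }
  assert (K4 : RtoC (3 / 2) = (3 * / 2)%C).
  { rewrite <- RtoC_inv by lra. rewrite <- !RtoC_mult. f_equal. }
  assert (N6 : RtoC 6 <> RtoC 0) by (apply RtoC_neq_0; lra).
  split.
  - transitivity (/ 2 * (2 * G 1%nat))%C; [field; auto|]. rewrite G1, <- K1. ring.
  - transitivity (/ 2 * (2 * G 2%nat))%C; [field; auto|]. rewrite G2, K4.
    transitivity (- ((RtoC (1 / (6 * PI)) * RtoC PI) * (3 * a 3%nat - 2 * (a 2%nat * a 2%nat)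
      - (RtoC (5 / (2 * PI)) * RtoC PI) * (a 2%nat * a 2%nat))))%C; [|ring].
    rewrite K2, K3. field; auto.
Qed.

(** * The two inequalities *)

(** Here x = |c1|, y = |c2| and q = |c2 - k c1^2| with k = 5 / (2 pi). Dividing by 1 / (6 pi) leaves
    bounds on q - 3 x. *)
Lemma arcsin_coef_bounds (x y q : R) : 0 <= x -> 0 <= y <= 1 - x ^ 2 ->
  Rabs (5 / (2 * PI) * x ^ 2 - y) <= q <= 5 / (2 * PI) * x ^ 2 + y ->
  - (1 / (6 * PI) + 3 / (4 * (5 + 2 * PI))) <= 1 / (6 * PI) * q - 1 / (2 * PI) * x <= 1 / (6 * PI).
Proof.
  intros Hx Hy Hq. assert (PP := PI_RGT_0). assert (P2 := PI2_3_2).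
  apply and_comm in Hq. destruct Hq as [Q2 Q1].
  assert (x <= 1) by nra.
  set (k := 5 / (2 * PI)) in *.
  assert (Pk : 0 < k) by (apply Rdiv_lt_0_compat; lra).
  assert (Kb : k <= 4).
  { apply (Rmult_le_reg_r (2 * PI)); [lra|]. unfold k, Rdiv. rewrite Rmult_assoc, Rinv_l; lra. }
  assert (E : 3 / (4 * (5 + 2 * PI)) = 1 / (6 * PI) * (9 / (4 * (k + 1)))) by (unfold k; field; lra).
  rewrite E. replace (1 / (2 * PI)) with (1 / (6 * PI) * 3) by (field; lra).
  set (i := 1 / (6 * PI)). assert (Pi : 0 < i) by (apply Rdiv_lt_0_compat; lra).
  split.
  - assert (Q3 : k * x ^ 2 - y <= q) by (eapply Rle_trans; [apply Rle_abs | exact Q1]).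
    assert (Q : - (1 + 9 / (4 * (k + 1))) <= q - 3 * x).
    (* Completing the square in (k + 1) x^2 - 3 x; equality holds at x = 3 / (2 (k + 1)). *)
    { assert (S : 0 <= (2 * (k + 1) * x - 3) ^ 2 / (4 * (k + 1))).
      { apply Rmult_le_pos; [apply pow2_ge_0 | left; apply Rinv_0_lt_compat; lra]. }
      replace ((2 * (k + 1) * x - 3) ^ 2 / (4 * (k + 1)))
        with ((k + 1) * x ^ 2 - 3 * x + 9 / (4 * (k + 1))) in S by (field; lra).
      lra. }
    nra.
  (* q <= 1 + (k - 1) x^2, and (k - 1) x^2 <= 3 x because k <= 4 and 0 <= x <= 1. *)
  - assert (Q : q - 3 * x <= 1) by nra. nra.
Qed.

Lemma class_C_arcsin_bounds (f : C -> C) (G : nat -> C) :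
  class_C_arcsin f -> inverse_log_coeffs f G ->
  - (1 / (6 * PI) + 3 / (4 * (5 + 2 * PI))) <= Cmod (G 2%nat) - Cmod (G 1%nat) <= 1 / (6 * PI).
Proof.
  intros ((Hf & _) & (w & Sw & Hs)) HG. assert (PP := PI_RGT_0).
  assert (Hw : hol Omega w).
  { destruct Hf as (_ & a & A0 & A1 & Ha). apply (class_C_arcsin_schwarz f a w); auto.
    intros z Hz. apply is_pseries_csum, Ha, Hz. }
  destruct (hol_has_ps 1 w Rlt_0_1 Hw) as (c & Hc & _).
  assert (C0 : c 0%nat = RtoC 0) by (rewrite <- (has_ps_at_0 1 c w Rlt_0_1 Hc); apply Sw).
  assert (T := has_ps_T2 1 c w Rlt_0_1 Hc). rewrite C0 in T.
  destruct (class_C_arcsin_inverse_log_coeffs f w G _ _ Hf Sw Hs HG T) as (-> & ->).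
  assert (S := schwarz_coef w c Hw Hc C0 (proj2 (proj2 Sw))).
  rewrite !Cmod_mult, !Cmod_opp, !Cmod_R, !Rabs_pos_eq
    by (left; apply Rdiv_lt_0_compat; lra).
  apply (arcsin_coef_bounds (Cmod (c 1%nat)) (Cmod (c 2%nat))).
  - apply Cmod_ge_0.
  - split; [apply Cmod_ge_0 | exact S].
  - assert (E : Cmod (RtoC (5 / (2 * PI)) * (c 1%nat * c 1%nat)) = 5 / (2 * PI) * Cmod (c 1%nat) ^ 2).
    { rewrite !Cmod_mult, Cmod_R, Rabs_pos_eq by (left; apply Rdiv_lt_0_compat; lra). ring. }
    rewrite <- E. split.
    + apply Rabs_le. split.
      * assert (T1 := Cmod_sub_ge (c 2%nat) (RtoC (5 / (2 * PI)) * (c 1%nat * c 1%nat))). lra.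
      * assert (T1 := Cmod_sub_ge (RtoC (5 / (2 * PI)) * (c 1%nat * c 1%nat)) (c 2%nat)).
        rewrite Cmod_sub_sym in T1. lra.
    + eapply Rle_trans; [apply Cmod_sub_le|]. lra.
Qed.

(** * Local inverses *)

(** The mean value theorem fails for complex values, so the real one is applied to Re (c F) along
    the segment; [c] selects the direction that matters. *)
Lemma complex_mean_value (r : R) (F F' : C -> C) (c y z : C) :
  (forall w, Cmod w < r -> cder F w (F' w)) -> Cmod y < r -> Cmod z < r ->
  exists t, 0 < t < 1 /\ Cmod (y + RtoC t * (z - y)) < r /\
    Re (c * (F z - F y)) = Re (c * (F' (y + RtoC t * (z - y))%C * (z - y))).
Proof.
  intros D Hy Hz.
  assert (In : forall t, 0 <= t <= 1 -> Cmod (y + RtoC t * (z - y)) < r).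
  { intros t Ht. replace (y + RtoC t * (z - y))%C with (RtoC (1 - t) * y + RtoC t * z)%C
      by (rewrite RtoC_minus; ring).
    eapply Rle_lt_trans; [apply Cmod_triangle|]. rewrite !Cmod_mult, !Cmod_R, !Rabs_pos_eq by lra.
    destruct (Rle_lt_or_eq_dec 0 t) as [P|<-]; [apply Ht| |lra].
    assert ((1 - t) * Cmod y <= (1 - t) * r) by (apply Rmult_le_compat_l; lra).
    assert (t * Cmod z < t * r) by (apply Rmult_lt_compat_l; lra). lra. }
  set (p := fun s => (c * F (y + s * (z - y)))%C).
  destruct (MVT_cor2 (fun t => Re (p (RtoC t)))
    (fun t => Re (c * (F' (y + RtoC t * (z - y))%C * (z - y)))) 0 1) as (t & E & Ht); [lra| |].
  - intros t Ht. apply is_derive_Reals, (cder_is_derive_Re p).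
    apply (cder_eq _ _ (0 * F (y + RtoC t * (z - y))%C
      + c * (F' (y + RtoC t * (z - y))%C * (0 + (1 * (z - y) + RtoC t * 0))))); [|ring].
    apply (cder_mult (fun _ => c) (fun s => F (y + s * (z - y))%C)); [apply cder_const|].
    apply (cder_comp (fun s => y + s * (z - y))%C F); [|apply D, In, Ht].
    apply (cder_plus (fun _ => y) (fun s => s * (z - y))%C); [apply cder_const|].
    apply (cder_mult (fun s => s) (fun _ => z - y)%C); [apply cder_id | apply cder_const].
  - exists t. split; auto. split; [apply In; lra|].
    rewrite Rminus_0_r, Rmult_1_r in E. rewrite <- E. unfold p.
    replace (y + 1 * (z - y))%C with z by ring. replace (y + 0 * (z - y))%C with y by ring.
    destruct c, (F z), (F y). simpl. ring.
Qed.

(** The direction is the conjugate phase of F z - F y, for which the real part is the full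
    modulus. *)
Lemma complex_lipschitz (r L : R) (F F' : C -> C) (y z : C) :
  (forall w, Cmod w < r -> cder F w (F' w)) -> (forall w, Cmod w < r -> Cmod (F' w) <= L) ->
  Cmod y < r -> Cmod z < r -> Cmod (F z - F y) <= L * Cmod (z - y).
Proof.
  intros D B Hy Hz. destruct (exists_unit_phase (F z - F y)) as (u & Hu & Eu).
  destruct (complex_mean_value r F F' (Cconj u) y z D Hy Hz) as (t & _ & Ht & E).
  rewrite Eu in E. change (Re (RtoC (Cmod (F z - F y)))) with (Cmod (F z - F y)) in E. rewrite E.
  eapply Rle_trans; [apply Rle_abs|]. eapply Rle_trans; [apply re_le_Cmod|].
  rewrite !Cmod_mult, Cmod_conj, Hu, Rmult_1_l.
  apply Rmult_le_compat_r; [apply Cmod_ge_0 | apply B, Ht].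
Qed.

(* Newton-like iteration [z <- w + (z - f z)] for solving [f z = w]. *)
Fixpoint inverse_iter (f : C -> C) (w : C) (n : nat) : C :=
  match n with O => RtoC 0 | S m => (w + (inverse_iter f w m - f (inverse_iter f w m)))%C end.

Definition local_inverse (f : C -> C) (w : C) : C :=
  CSeries (fun n => inverse_iter f w (S n) - inverse_iter f w n)%C.

(** Successive increments halve, so the telescoping series converges. For |w| < r / 4 the iterates
    and their limit stay within 2 |w| < r / 2, where the contraction hypothesis applies. *)
Lemma local_inverse_spec (f : C -> C) (r : R) : 0 < r -> f 0 = RtoC 0 ->
  (forall y z, Cmod y < r -> Cmod z < r ->
     Cmod ((z - f z) - (y - f y)) <= 1 / 2 * Cmod (z - y)) ->
  forall w, Cmod w < r / 4 ->
    Cmod (local_inverse f w) <= 2 * Cmod w /\ f (local_inverse f w) = w.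
Proof.
  intros Pr F0 H w Hw. assert (Pw := Cmod_ge_0 w).
  set (x := inverse_iter f w).
  assert (XS : forall n, x (S n) = (w + (x n - f (x n)))%C) by reflexivity.
  assert (Bx : forall n, Cmod (x n) <= 2 * Cmod w).
  { induction n as [|n IH]; [change (x 0%nat) with (RtoC 0); rewrite Cmod_0; lra|]. rewrite XS.
    eapply Rle_trans; [apply Cmod_triangle|].
    assert (A := H 0%C (x n)). rewrite F0, Cmod_0 in A.
    replace (x n - f (x n) - (0 - 0))%C with (x n - f (x n))%C in A by ring.
    replace (x n - 0)%C with (x n) in A by ring.
    specialize (A ltac:(lra) ltac:(lra)). lra. }
  assert (Dx : forall n, Cmod (x (S n) - x n) <= Cmod w * (1 / 2) ^ n).
  { induction n as [|n IH].
    - rewrite XS. change (x 0%nat) with (RtoC 0). rewrite F0. simpl pow. replace (w + (0 - 0) - 0)%C with w by ring. lra.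
    - replace (x (S (S n)) - x (S n))%C
        with ((x (S n) - f (x (S n))) - (x n - f (x n)))%C.
      2: { rewrite (XS (S n)).
           transitivity (w + (x (S n) - f (x (S n))) - (w + (x n - f (x n))))%C; [ring|].
           rewrite <- (XS n). reflexivity. }
      assert (B1 := Bx n). assert (B2 := Bx (S n)).
      eapply Rle_trans; [apply H; lra|]. simpl pow. lra. }
  assert (Cx : csum (fun n => x (S n) - x n)%C (local_inverse f w)).
  { apply (csum_CSeries _ _ Dx).
    apply (ex_series_scal (V := R_NormedModule) (Cmod w) (fun n => (1 / 2) ^ n)).
    apply ex_series_geom. rewrite Rabs_pos_eq; lra. }
  assert (Px : forall n, psum (fun n => x (S n) - x n)%C n = x n).
  { induction n as [|n IH]; [reflexivity|]. cbn [psum]. rewrite IH. ring. }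
  set (l := local_inverse f w) in *.
  assert (Bl : Cmod l <= 2 * Cmod w).
  { apply (csum_norm_le _ _ _ Cx). intros n. rewrite Px. apply Bx. }
  split; auto.
  symmetry. apply Cmod_eq_of_sub_0, Rle_antisym; [|apply Cmod_ge_0].
  apply le_epsilon. intros e He. rewrite Rplus_0_l.
  destruct (Cx (e / 2)) as (N & HN); [lra|].
  assert (H1 := HN (S N) ltac:(lia)). assert (H2 := HN N ltac:(lia)). rewrite Px in H1, H2.
  replace (w - f l)%C with ((x (S N) - l) - ((x N - f (x N)) - (l - f l)))%C by (rewrite XS; ring).
  eapply Rle_trans; [apply Cmod_sub_le|].
  assert (B1 := Bx N). assert (A := H l (x N) ltac:(lra) ltac:(lra)). lra.
Qed.

(** Where |f' - 1| < 1/2, the map z - f z contracts by 1/2 and the inverse [g] is 2-Lipschitz, hence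
    continuous. Then [cder_inverse] gives g' = 1 / f'(g), which is continuous, and [g] has a power
    series. *)
Lemma exists_local_inverse (f : C -> C) (a : nat -> C) :
  has_ps 1 a f -> a 0%nat = RtoC 0 -> a 1%nat = RtoC 1 ->
  exists g r b, 0 < r /\ (forall w, Cmod w < r -> Omega (g w) /\ f (g w) = w) /\
    has_ps r b g /\ b 0%nat = RtoC 0 /\ b 1%nat = RtoC 1.
Proof.
  intros Hf A0 A1.
  destruct (has_ps_derive _ _ _ Hf) as (f' & Hf' & D).
  assert (F0 : f 0 = RtoC 0) by (rewrite (has_ps_at_0 1 a f Rlt_0_1 Hf); auto).
  assert (F'0 : f' 0 = RtoC 1).
  { rewrite (has_ps_at_0 1 _ f' Rlt_0_1 Hf'). unfold ps_derive. simpl. rewrite A1. ring. }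
  assert (Cf' : forall z, Cmod z < 1 -> ccont f' z) by (intros z Hz; eapply has_ps_ccont; eauto).
  destruct (Cf' 0%C ltac:(rewrite Cmod_0; lra) (1 / 2) ltac:(lra)) as (d & Pd & Hd).
  rewrite F'0 in Hd.
  set (r := Rmin 1 d). assert (Pr : 0 < r) by (apply Rmin_pos; lra).
  assert (R1 := Rmin_l 1 d). assert (R2 := Rmin_r 1 d). fold r in R1, R2.
  assert (Hd' : forall z, Cmod z < r -> Cmod (f' z - 1) < 1 / 2).
  { intros z Hz. apply Hd. replace (z - 0)%C with z by ring. lra. }
  assert (H : forall y z, Cmod y < r -> Cmod z < r ->
     Cmod ((z - f z) - (y - f y)) <= 1 / 2 * Cmod (z - y)).
  { intros y z Hy Hz.
    apply (complex_lipschitz r (1 / 2) (fun z => z - f z)%C (fun z => 1 + - (1) * f' z)%C y z); auto.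
    - intros w Hw. apply (cder_eq _ _ (1 + (0 * f w + - (1) * f' w))); [|ring].
      apply (cder_ext_loc (fun z => z + - (1) * f z)%C _ w _ 1); [lra | intros; ring|].
      apply (cder_plus (fun z => z) (fun z => - (1) * f z)%C); [apply cder_id|].
      apply (cder_mult (fun _ => - (1))%C f); [apply cder_const | apply D; lra].
    - intros w Hw. replace (1 + - (1) * f' w)%C with (1 - f' w)%C by ring.
      rewrite Cmod_sub_sym. left. apply Hd', Hw. }
  set (g := local_inverse f).
  assert (Hg : forall w, Cmod w < r / 4 -> Cmod (g w) <= 2 * Cmod w /\ f (g w) = w)
    by (apply local_inverse_spec; auto).
  assert (Lg : forall w v, Cmod w < r / 4 -> Cmod v < r / 4 -> Cmod (g w - g v) <= 2 * Cmod (w - v)).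
  { intros w v Hw Hv. destruct (Hg w Hw) as [B1 E1]. destruct (Hg v Hv) as [B2 E2].
    assert (A := H (g v) (g w) ltac:(lra) ltac:(lra)). rewrite E1, E2 in A.
    assert (T := Cmod_triangle (w - v) (g w - w - (g v - v))).
    replace (w - v + (g w - w - (g v - v)))%C with (g w - g v)%C in T by ring. lra. }
  assert (Cg : forall w, Cmod w < r / 4 -> ccont g w).
  { intros w Hw e He. exists (Rmin (e / 2) (r / 4 - Cmod w)). split; [apply Rmin_pos; lra|].
    intros y Hy. assert (M1 := Rmin_l (e / 2) (r / 4 - Cmod w)).
    assert (M2 := Rmin_r (e / 2) (r / 4 - Cmod w)).
    assert (T := Cmod_sub_ge y w). eapply Rle_lt_trans; [apply Lg; lra|]. lra. }
  assert (N' : forall w, Cmod w < r / 4 -> f' (g w) <> RtoC 0).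
  { intros w Hw E. destruct (Hg w Hw) as [B _]. specialize (Hd' (g w) ltac:(lra)).
    rewrite E in Hd'. replace (0 - 1)%C with (- (1))%C in Hd' by ring.
    rewrite Cmod_m1 in Hd'. lra. }
  assert (Dg : forall w, Cmod w < r / 4 -> cder g w (/ f' (g w))).
  { intros w Hw. destruct (Hg w Hw) as [B _].
    apply (cder_inverse f g w (f' (g w)) 0 (r / 4 - Cmod w)); auto; try lra.
    - intros y Hy. apply Hg. assert (T := Cmod_sub_ge y w). lra.
    - apply D. lra. }
  assert (HolG : hol (fun w => Cmod w < r / 4) g).
  { exists (fun w => / f' (g w))%C. intros w Hw. split; [apply Dg, Hw|].
    apply ccont_inv; [apply N', Hw|]. apply ccont_comp; [apply Cg, Hw|].
    destruct (Hg w Hw) as [B _]. apply Cf'. lra. }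
  destruct (hol_has_ps (r / 4) g ltac:(lra) HolG) as (b & Hb & _).
  assert (Pr4 : 0 < r / 4) by lra.
  assert (G0 : g 0 = RtoC 0).
  { destruct (Hg 0%C) as [B _]; [rewrite Cmod_0; lra|]. rewrite Cmod_0 in B.
    apply Cmod_eq_0. assert (P := Cmod_ge_0 (g 0)). lra. }
  exists g, (r / 4), b. split; auto. split.
  { intros w Hw. destruct (Hg w Hw). split; auto. unfold Omega. lra. }
  split; auto. split.
  - rewrite <- (has_ps_at_0 _ b g Pr4 Hb). auto.
  - destruct (has_ps_derive _ _ _ Hb) as (g' & Hg' & D').
    assert (E := has_ps_at_0 _ _ g' Pr4 Hg'). unfold ps_derive in E.
    assert (Z0 : Cmod 0 < r / 4) by (rewrite Cmod_0; lra).
    rewrite (cder_unique _ _ _ _ (D' _ Z0) (Dg _ Z0)), G0, F'0 in E. simpl in E.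
    transitivity (1 * b 1%nat)%C; [ring|]. rewrite <- E. field.
Qed.

(** g z / z, completed by 1 at 0, has positive real part near 0, so half its principal logarithm is
    holomorphic there; its Taylor coefficients are [G]. *)
Lemma exists_inverse_log_coeffs (f : C -> C) (a : nat -> C) :
  has_ps 1 a f -> a 0%nat = RtoC 0 -> a 1%nat = RtoC 1 -> exists G, inverse_log_coeffs f G.
Proof.
  intros Hf A0 A1.
  destruct (exists_local_inverse f a Hf A0 A1) as (g & r & b & Pr & Hg & Hb & B0 & B1).
  assert (Hk := has_ps_div_id r b g Hb B0). set (k := div_id (b 1%nat) g) in Hk.
  assert (K0 : k 0 = RtoC 1) by (unfold k; rewrite div_id_0; auto).
  destruct (has_ps_ccont r _ k 0 Hk ltac:(rewrite Cmod_0; auto) 1 ltac:(lra)) as (d & Pd & Hd).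
  rewrite K0 in Hd.
  set (e := Rmin r d). assert (Pe : 0 < e) by (apply Rmin_pos; auto).
  assert (E1 := Rmin_l r d). assert (E2 := Rmin_r r d). fold e in E1, E2.
  assert (Rk : forall z, Cmod z < e -> 0 < Re (k z)).
  { intros z Hz. specialize (Hd z). replace (z - 0)%C with z in Hd by ring.
    specialize (Hd ltac:(lra)). assert (A := re_le_Cmod (k z - 1)).
    assert (A' : Rabs (Re (k z - 1)) < 1) by lra. apply Rabs_lt_between in A'.
    destruct (k z). simpl in *. lra. }
  set (L := fun z => (Clog (k z) * RtoC (1 / 2))%C).
  assert (HL : hol (fun z => Cmod z < e) L).
  { apply hol_mult; [|apply hol_const].
    apply (hol_comp _ (fun z => 0 < Re z) k Clog); [|apply hol_Clog | exact Rk].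
    apply (hol_sub _ (fun z => Cmod z < r)); [intros; lra | apply (has_ps_hol _ _ _ Hk)]. }
  destruct (hol_has_ps e L Pe HL) as (G & HG & _).
  assert (G0 : G 0%nat = RtoC 0).
  { rewrite <- (has_ps_at_0 e G L Pe HG). unfold L. rewrite K0, Clog_1. ring. }
  exists G, g, e. split; auto. split; [intros z Hz; apply Hg; lra|].
  intros z N Hz. exists (L z). split.
  - apply csum_is_series. assert (S1 := csum_tail _ _ (HG z Hz)). cbv beta in S1.
    rewrite G0 in S1. replace (L z - 0 * z ^ 0)%C with (L z) in S1 by ring. exact S1.
  - unfold L, k. rewrite div_id_neq_0 by auto.
    transitivity ((2 * RtoC (1 / 2)) * Clog (g z / z))%C; [rewrite two_half; ring | ring].
Qed.

(** * Extremal functions *)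

Definition ps_primitive (a : nat -> C) (n : nat) : C :=
  match n with O => RtoC 0 | S m => (a m * / RtoC (INR (S m)))%C end.

Lemma has_ps_primitive r a f : has_ps r a f ->
  exists F, has_ps r (ps_primitive a) F /\ forall z, Cmod z < r -> cder F z (f z).
Proof.
  intros H.
  assert (HP : has_ps r (ps_primitive a) (fun z => CSeries (fun n => ps_primitive a n * z ^ n)%C)).
  { intros z Hz. assert (Pz := Cmod_ge_0 z).
    apply (csum_CSeries _ (fun n => match n with O => 0 | S m => Cmod z * Rabs (Cmod (a m) * Cmod z ^ m) end)).
    - intros [|n]; unfold ps_primitive; rewrite !Cmod_mult; [rewrite Cmod_0; lra|].
      assert (Nn : RtoC (INR (S n)) <> RtoC 0) by (apply RtoC_neq_0, not_0_INR; lia).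
      rewrite Cmod_inv, Cmod_R, Cmod_pow by auto. rewrite (Rabs_pos_eq (INR (S n))) by apply pos_INR.
      assert (P := Rmult_le_pos _ _ (Cmod_ge_0 (a n)) (pow_le _ n Pz)).
      rewrite Rabs_pos_eq by auto. simpl pow.
      replace (Cmod (a n) * / INR (S n) * (Cmod z * Cmod z ^ n))
        with (/ INR (S n) * (Cmod z * (Cmod (a n) * Cmod z ^ n))) by ring.
      rewrite <- (Rmult_1_l (Cmod z * (Cmod (a n) * Cmod z ^ n))) at 2.
      apply Rmult_le_compat_r; [apply Rmult_le_pos; auto|].
      rewrite <- Rinv_1. apply Rinv_le_contravar; [lra|]. rewrite S_INR.
      assert (Q := pos_INR n). lra.
    - apply ex_series_incr_1. apply (ex_series_scal (V := R_NormedModule) (Cmod z)).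
      apply CV_disk_inside. apply (has_ps_CV_radius r a f); auto. }
  destruct (has_ps_derive _ _ _ HP) as (f' & Hf' & D).
  eexists. split; [exact HP|]. intros z Hz.
  replace (f z) with (f' z); [apply D, Hz|].
  apply (csum_unique _ _ _ (Hf' z Hz)). eapply csum_ext; [|apply (H z Hz)].
  intros n. unfold ps_derive, ps_primitive. field.
  apply RtoC_neq_0, not_0_INR. lia.
Qed.

(* [f' = exp Q] with [z Q' = 2 / PI * arcsin w]; since [|Im Q| <= 4 / PI < PI / 2],
   [Re f' > 0] and [f] is univalent (Noshiro-Warschawski). *)
Lemma exists_class_C_arcsin (w : C -> C) :
  hol Omega w -> (forall z, Omega z -> Cmod (w z) <= Cmod z) ->
  exists f, class_S f /\ schwarz_function w /\ (exists G, inverse_log_coeffs f G) /\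
    forall z, Omega z -> (1 + z * C_derive (C_derive f) z / C_derive f z
      = 1 + RtoC (2 / PI) * Carcsin (w z))%C.
Proof.
  intros Hw Bw. assert (PP := PI_RGT_0).
  assert (W0 : w 0 = RtoC 0).
  { apply Cmod_eq_0. assert (B := Bw 0%C). unfold Omega in B. rewrite Cmod_0 in B.
    assert (P := Cmod_ge_0 (w 0)). specialize (B ltac:(lra)). lra. }
  set (q := fun z => (RtoC (2 / PI) * Carcsin (w z))%C).
  assert (Hq : hol Omega q).
  { apply hol_mult; [apply hol_const|]. apply (hol_comp Omega Omega w Carcsin); auto using hol_Carcsin.
    intros z Hz. specialize (Bw z Hz). unfold Omega in *. lra. }
  destruct (hol_has_ps 1 q Rlt_0_1 Hq) as (b & Hb & _).
  assert (Q0 : q 0 = RtoC 0) by (unfold q; rewrite W0, Carcsin_0; ring).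
  assert (B0 : b 0%nat = RtoC 0) by (rewrite <- (has_ps_at_0 1 b q Rlt_0_1 Hb); auto).
  assert (Hp := has_ps_div_id 1 b q Hb B0). set (p := div_id (b 1%nat) q) in Hp.
  assert (Ep : forall z, (z * p z)%C = q z).
  { intros z. destruct (Ceq_dec z 0) as [->|N]; [rewrite Q0; ring|].
    unfold p. rewrite div_id_neq_0 by auto. field. auto. }
  destruct (has_ps_primitive 1 _ p Hp) as (Q & HQ & DQ).
  assert (QQ0 : Q 0 = RtoC 0) by (rewrite (has_ps_at_0 1 _ Q Rlt_0_1 HQ); reflexivity).
  set (F := fun z => Cexp (Q z)).
  assert (DF : forall z, Cmod z < 1 -> cder F z (F z * p z)).
  { intros z Hz. apply (cder_comp Q Cexp); [apply DQ, Hz | apply cder_Cexp]. }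
  assert (HF : hol (fun z => Cmod z < 1) F).
  { apply (hol_comp _ (fun _ => True) Q Cexp); auto using hol_Cexp. apply (has_ps_hol _ _ _ HQ). }
  destruct (hol_has_ps 1 F Rlt_0_1 HF) as (d & Hd & _).
  assert (F0 : d 0%nat = RtoC 1).
  { rewrite <- (has_ps_at_0 1 d F Rlt_0_1 Hd). unfold F. rewrite QQ0. apply Cexp_0. }
  destruct (has_ps_primitive 1 d F Hd) as (f & Hf & Df).
  assert (A1 : ps_primitive d 1 = RtoC 1).
  { simpl. rewrite F0. field. }
  assert (ReF : forall z, Cmod z < 1 -> 0 < Re (F z)).
  { intros z Hz. assert (Pz := Cmod_ge_0 z).
    (* With c = - i this gives Im (Q z) = Im (p (t z) z) = Im (q (t z)) / t; the bound |w (t z)| <=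
       t |z| cancels the 1/t. *)
    destruct (complex_mean_value 1 Q p (- Ci)%C 0 z DQ) as (t & Ht & _ & E); auto.
    { rewrite Cmod_0; lra. }
    replace (z - 0)%C with z in E by ring. replace (0 + RtoC t * z)%C with (RtoC t * z)%C in E by ring.
    rewrite QQ0 in E. replace (- Ci * (Q z - 0))%C with (- Ci * Q z)%C in E by ring.
    assert (Nt : RtoC t <> RtoC 0) by (apply RtoC_neq_0; lra).
    assert (E2 : (p (RtoC t * z) * z = RtoC (/ t) * q (RtoC t * z))%C).
    { rewrite <- Ep. rewrite RtoC_inv by lra. field. auto. }
    rewrite E2 in E.
    assert (E3 : Im (Q z) = / t * (2 / PI * Im (Carcsin (w (RtoC t * z)%C)))).
    { transitivity (Re (- Ci * Q z)); [destruct (Q z); simpl; ring|]. rewrite E.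
      unfold q. destruct (Carcsin (w (RtoC t * z)%C)). simpl. ring. }
    assert (Mt : Cmod (RtoC t * z) = t * Cmod z) by (rewrite Cmod_mult, Cmod_R, Rabs_pos_eq; lra).
    assert (B1 := Im_Carcsin_bound (w (RtoC t * z)%C)).
    assert (B2 := Bw (RtoC t * z)%C ltac:(unfold Omega; rewrite Mt; nra)). rewrite Mt in B2.
    assert (B3 : Rabs (Im (Q z)) <= 4 / PI).
    { rewrite E3, !Rabs_mult, (Rabs_pos_eq (/ t)), (Rabs_pos_eq (2 / PI))
        by (left; try apply Rinv_0_lt_compat; try apply Rdiv_lt_0_compat; lra).
      assert (It : 0 < / t) by (apply Rinv_0_lt_compat; lra).
      assert (I2 : 0 < 2 / PI) by (apply Rdiv_lt_0_compat; lra).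
      apply Rle_trans with (/ t * (2 / PI * (2 * t))).
      - apply Rmult_le_compat_l; [lra|]. apply Rmult_le_compat_l; nra.
      - apply Req_le. field. lra. }
    assert (B4 : 4 / PI < PI / 2).
    { assert (P32 := PI2_3_2). apply (Rmult_lt_reg_r PI); auto.
      replace (4 / PI * PI) with 4 by (field; lra). nra. }
    apply Rabs_le_between in B3. unfold F, Cexp. simpl.
    apply Rmult_lt_0_compat; [apply exp_pos | apply cos_gt_0; lra]. }
  assert (NF : forall z, F z <> RtoC 0) by (intros z; apply Cexp_neq_0).
  assert (Sw : schwarz_function w).
  { split; [|split; [exact W0|]].
    - intros z Hz. destruct Hw as (w' & Dw). exists (w' z). apply cder_is_derive, Dw, Hz.
    - intros z Hz. specialize (Bw z Hz). unfold Omega in Hz. lra. }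
  exists f. split; [split; [split|]|].
  - intros z Hz. exists (F z). apply cder_is_derive, Df, Hz.
  - exists (ps_primitive d). split; [reflexivity|]. split; [exact A1|].
    intros z Hz. apply is_pseries_csum, Hf, Hz.
  - intros z y Hz Hy E. destruct (Ceq_dec z y) as [|N]; auto. exfalso.
    (* If f z = f y, this yields 0 = |z - y|^2 Re F at a point of the segment, against Re F > 0. *)
    destruct (complex_mean_value 1 f F (Cconj (z - y)) y z Df Hy Hz) as (t & _ & Ht & E').
    rewrite E in E'. replace (Cconj (z - y) * (f y - f y))%C with (RtoC 0) in E' by ring.
    set (x := F (y + RtoC t * (z - y))%C) in *.
    assert (Px : 0 < Re x) by (apply ReF, Ht).
    replace (Cconj (z - y) * (x * (z - y)))%C with ((Cconj (z - y) * (z - y)) * x)%C in E' by ring.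
    rewrite Re_conj_Cmod2 in E'.
    assert (Pzy : 0 < Cmod (z - y)).
    { apply Cmod_pos. intros Z. apply N. replace z with ((z - y) + y)%C by ring. rewrite Z. ring. }
    set (m := Cmod (z - y) ^ 2) in *. assert (Pm : 0 < m) by (apply pow_lt, Pzy).
    destruct x as [x1 x2]. simpl in *. nra.
  - split; [exact Sw|]. split; [apply (exists_inverse_log_coeffs f _ Hf eq_refl A1)|].
    assert (E1 : forall z, Omega z -> C_derive f z = F z).
    { intros z Hz. apply is_C_derive_unique, cder_is_derive, Df, Hz. }
    intros z Hz.
    assert (E2 : C_derive (C_derive f) z = (F z * p z)%C).
    { apply is_C_derive_unique, cder_is_derive.
      destruct (disc_nbhd z 1 Hz) as (e & Pe & He).
      apply (cder_ext_loc F _ z _ e Pe); [|apply DF, Hz].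
      intros y Hy. symmetry. apply E1, He, Hy. }
    rewrite E2, E1 by auto. fold (q z). rewrite <- Ep. field. apply NF.
Qed.

Lemma exists_with_schwarz_function (w : C -> C) (c1 c2 : C) :
  hol Omega w -> (forall z, Omega z -> Cmod (w z) <= Cmod z) -> T2 w 0 c1 c2 ->
  exists f G, class_C_arcsin f /\ inverse_log_coeffs f G /\
    G 1%nat = (- RtoC (1 / (2 * PI)) * c1)%C /\
    G 2%nat = (- RtoC (1 / (6 * PI)) * (c2 - RtoC (5 / (2 * PI)) * (c1 * c1)))%C.
Proof.
  intros Hw Bw T.
  destruct (exists_class_C_arcsin w Hw Bw) as (f & Sf & Sw & (G & HG) & Eq).
  exists f, G. split; [split; [exact Sf | exists w; auto]|]. split; auto.
  apply (class_C_arcsin_inverse_log_coeffs f w G c1 c2); auto. apply Sf.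
Qed.

Lemma upper_bound_sharp : exists f G, class_C_arcsin f /\ inverse_log_coeffs f G /\
  Cmod (G 2%nat) - Cmod (G 1%nat) = 1 / (6 * PI).
Proof.
  assert (PP := PI_RGT_0).
  destruct (exists_with_schwarz_function (fun z => z * z)%C 0 1) as (f & G & Hf & HG & E1 & E2).
  - apply hol_mult; apply hol_id.
  - intros z Hz. unfold Omega in Hz. rewrite Cmod_mult. assert (P := Cmod_ge_0 z). nra.
  - eapply T2_eq; [apply (T2_mult _ _ _ _ _ _ _ _ T2_id T2_id)|..]; ring.
  - exists f, G. split; auto. split; auto. rewrite E1, E2.
    replace (- RtoC (1 / (2 * PI)) * 0)%C with (RtoC 0) by ring.
    replace (- RtoC (1 / (6 * PI)) * (1 - RtoC (5 / (2 * PI)) * (0 * 0)))%C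
      with (- RtoC (1 / (6 * PI)))%C by ring.
    rewrite Cmod_0, Cmod_opp, Cmod_R, Rabs_pos_eq; [ring|].
    left. apply Rdiv_lt_0_compat; lra.
Qed.

(** |1 + c z|^2 - |z + c|^2 = (1 - c^2) (1 - |z|^2). *)
Lemma blaschke_bound (c : R) (z : C) : 0 < c < 1 -> Cmod z < 1 ->
  0 < Cmod (1 + RtoC c * z) /\ Cmod (z + RtoC c) <= Cmod (1 + RtoC c * z).
Proof.
  intros Hc Hz. assert (Pz := Cmod_ge_0 z). split.
  - assert (T := Cmod_sub_ge 1 (- (RtoC c * z))).
    rewrite Cmod_opp, Cmod_1, Cmod_mult, Cmod_R, Rabs_pos_eq in T by lra.
    replace (1 - - (RtoC c * z))%C with (1 + RtoC c * z)%C in T by ring. nra.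
  - apply Rsqr_incr_0_var; [|apply Cmod_ge_0]. unfold Rsqr.
    assert (S := Cmod2_alt z). assert (S1 := Cmod2_alt (z + RtoC c)).
    assert (S2 := Cmod2_alt (1 + RtoC c * z)).
    assert (Z2 : Cmod z ^ 2 < 1) by nra.
    assert (K : 0 <= (1 - c * c) * (1 - Cmod z ^ 2)) by (apply Rmult_le_pos; nra).
    rewrite S in K. destruct z as [x y]. simpl in *. lra.
Qed.

(* Extremal for [w z = z (z + c) / (1 + c z)], where [c] maximizes [3 c - k c ^ 2]
   with [k = 1 + 5 / (2 PI)]. *)
Lemma lower_bound_sharp : exists f G, class_C_arcsin f /\ inverse_log_coeffs f G /\
  Cmod (G 2%nat) - Cmod (G 1%nat) = - (1 / (6 * PI) + 3 / (4 * (5 + 2 * PI))).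
Proof.
  assert (PP := PI_RGT_0). assert (P3 := PI2_3_2).
  set (c := 3 * PI / (5 + 2 * PI)).
  assert (P4 := PI_4).
  assert (Hc : 0 < c < 1).
  { split; [apply Rdiv_lt_0_compat; lra|]. apply (Rmult_lt_reg_r (5 + 2 * PI)); [lra|].
    unfold c. replace (3 * PI / (5 + 2 * PI) * (5 + 2 * PI)) with (3 * PI) by (field; lra). lra. }
  set (w := fun z => (z * ((z + RtoC c) * / (1 + RtoC c * z)))%C).
  destruct (exists_with_schwarz_function w (RtoC c) (RtoC (1 - c ^ 2))) as (f & G & Hf & HG & E1 & E2).
  - apply hol_mult; [apply hol_id|]. apply hol_mult.
    + apply hol_plus; [apply hol_id | apply hol_const].
    + apply hol_inv.
      * apply hol_plus; [apply hol_const|]. apply hol_mult; [apply hol_const | apply hol_id].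
      * intros z Hz. apply C_neq_0_of_Cmod, (blaschke_bound c z Hc Hz).
  - intros z Hz. destruct (blaschke_bound c z Hc Hz) as [Pd B]. unfold w.
    rewrite !Cmod_mult, Cmod_inv by (apply C_neq_0_of_Cmod; auto).
    rewrite <- (Rmult_1_r (Cmod z)) at 2. apply Rmult_le_compat_l; [apply Cmod_ge_0|].
    apply (Rmult_le_reg_r (Cmod (1 + RtoC c * z))); auto.
    rewrite Rmult_assoc, Rinv_l by lra. lra.
  - assert (N1 : RtoC 1 <> RtoC 0) by (apply RtoC_neq_0; lra).
    assert (Td : T2 (fun z => 1 + RtoC c * z)%C 1 (RtoC c) 0).
    { eapply T2_eq; [apply (T2_plus _ _ _ _ _ _ _ _ (T2_const 1)
        (T2_mult _ _ _ _ _ _ _ _ (T2_const (RtoC c)) T2_id))|..]; ring. }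
    eapply T2_eq; [apply (T2_mult _ _ _ _ _ _ _ _ T2_id
      (T2_mult _ _ _ _ _ _ _ _ (T2_plus _ _ _ _ _ _ _ _ T2_id (T2_const (RtoC c)))
        (T2_inv _ _ _ _ N1 Td)))|..].
    + ring.
    + field.
    + rewrite RtoC_minus. replace (RtoC (c ^ 2)) with (RtoC c * RtoC c)%C
        by (rewrite <- RtoC_mult; f_equal; ring). field.
  - exists f, G. split; auto. split; auto. rewrite E1, E2.
    rewrite <- !RtoC_mult, <- RtoC_minus, !Cmod_mult, !Cmod_opp, !Cmod_R.
    rewrite (Rabs_pos_eq (1 / (6 * PI))), (Rabs_pos_eq (1 / (2 * PI))), (Rabs_pos_eq c)
      by (left; try apply Rdiv_lt_0_compat; lra).
    assert (V : 1 - c ^ 2 - 5 / (2 * PI) * (c * c) = (10 - 5 * PI) / (2 * (5 + 2 * PI))).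
    { unfold c. field. lra. }
    (* The value is negative because pi > 2, so the modulus is k c^2 - (1 - c^2) with k = 5 / (2
       pi), exactly the branch used for the lower bound. *)
    rewrite V, Rabs_left.
    + unfold c. field. lra.
    + apply (Rmult_lt_reg_r (2 * (5 + 2 * PI))); [lra|].
      unfold Rdiv. rewrite Rmult_assoc, Rinv_l by lra. lra.
Qed.

Theorem theorem3p5 :
  (forall (f : C -> C) (G : nat -> C),
     class_C_arcsin f -> inverse_log_coeffs f G ->
     - (1 / (6 * PI) + 3 / (4 * (5 + 2 * PI)))
       <= Cmod (G 2%nat) - Cmod (G 1%nat)
       <= 1 / (6 * PI)) /\
  (exists (f : C -> C) (G : nat -> C),
     class_C_arcsin f /\ inverse_log_coeffs f G /\
     Cmod (G 2%nat) - Cmod (G 1%nat)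
       = - (1 / (6 * PI) + 3 / (4 * (5 + 2 * PI)))) /\
  (exists (f : C -> C) (G : nat -> C),
     class_C_arcsin f /\ inverse_log_coeffs f G /\
     Cmod (G 2%nat) - Cmod (G 1%nat) = 1 / (6 * PI)).
Proof.
  split; [exact class_C_arcsin_bounds|]. split; [exact lower_bound_sharp | exact upper_bound_sharp].
Qed.
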